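(* Let $d\ge 1$ be an integer, $\beta\ge 0$ and $h\in\mathbb{R}$ be fixed, and let $\beta_c=\frac{1}{2d}$. For $n\ge 1$ let $\varepsilon=(\varepsilon_1,\dots,\varepsilon_n)$ be the vector of spins in the Curie-Weiss model on $n$ vertices with parameters $d,\beta,h$, and let $$Q_n=\sup_{x\in\mathbb{R}}\ \sup_{|v_1|,\dots,|v_n|\ge 1}P\Big(\sum_{i=1}^n v_i\varepsilon_i\in(x-1,x+1)\Big).$$ Let $z_*\ge 0$ be the maximal solution of the mean-field equation $\tanh\big(\frac{\beta}{\beta_c}z+|h|\big)=z$ and let $t_*=2d\beta z_*+|h|$. Then, as $n\to\infty$, $$Q_n\sim n^{-1/2}\sqrt{\frac2\pi}\cosh t_*.$$ More precisely, as $n\to+\infty$: (1) If $h=0$ and $\beta<\beta_c$, then $t_*=0$ and $Q_n=\sqrt{\frac2\pi}\,n^{-1/2}+O(n^{-3/2})$. (2) If $h=0$ and $\beta=\beta_c$, then $t_*=0$ and $Q_n=\sqrt{\frac2\pi}\,n^{-1/2}+\frac{2\cdot 3^{1/2}\cdot\pi^{1/2}}{(\Gamma(1/4))^2}\,n^{-1}+o(n^{-1})$. (3) If $h=0$ and $\beta>\beta_c$, then $t_*>0$ and $Q_n=\sqrt{\frac2\pi}\cosh(t_* )\,n^{-1/2}+O(n^{-3/2})$. (4) If $h\ne 0$, then $t_*>0$ and $Q_n=\sqrt{\frac2\pi}\cosh(t_* )\,n^{-1/2}+O(n^{-3/2})$.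
   Context: Curie-Weiss model on $n$ vertices: the spin vector $\varepsilon=(\varepsilon_1,\dots,\varepsilon_n)$ takes values in $\{-1,1\}^n$ with, for $\sigma\in\{-1,1\}^n$, $$P(\varepsilon=\sigma)=\frac{1}{Z_{d,\beta,h}}\exp\Big\{\frac{d\beta}{n}\Big(\sum_{j=1}^n\sigma_j\Big)^2+h\sum_{j=1}^n\sigma_j\Big\},$$ where $Z_{d,\beta,h}$ (depending on $n$) is the normalizing constant. The $v_i$ are real. $a_n\sim b_n$ means $a_n/b_n\to 1$. $\Gamma$ is the Gamma function. *)

(* Defs.v *)
From mathcomp Require Import all_boot all_order all_algebra.
From mathcomp Require Import all_classical all_reals all_analysis.

Set Implicit Arguments.
Unset Strict Implicit.
Unset Printing Implicit Defensive.

Import Order.TTheory GRing.Theory Num.Theory.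
Import numFieldNormedType.Exports.

Local Open Scope classical_set_scope.
Local Open Scope ring_scope.

Definition cosh {R : realType} (x : R) : R := (expR x + expR (- x)) / 2.

Definition sinh {R : realType} (x : R) : R := (expR x - expR (- x)) / 2.

Definition tanh {R : realType} (x : R) : R := sinh x / cosh x.

(* Euler's integral, meaningful for 0 < a. *)
Definition Gamma {R : realType} (a : R) : R :=
  \int[lebesgue_measure]_(x in `]0%R, +oo[) (x `^ (a - 1) * expR (- x)).

(* A point of {-1, 1}^n is encoded by a boolean per vertex. *)
Definition spins (n : nat) := {ffun 'I_n -> bool}.

Definition spin {R : realType} n (s : spins n) (i : 'I_n) : R :=
  if s i then 1 else -1.

Definition cw_weight {R : realType} (d : nat) (beta h : R) n (s : spins n) : R :=
  expR (d%:R * beta / n%:R * (\sum_(j < n) spin s j) ^+ 2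
        + h * \sum_(j < n) spin s j).

Definition cw_Z {R : realType} (d : nat) (beta h : R) (n : nat) : R :=
  \sum_(s : spins n) cw_weight d beta h s.

Definition cw_prob {R : realType} (d : nat) (beta h : R) n
    (A : {set spins n}) : R :=
  \sum_(s in A) (cw_weight d beta h s / cw_Z d beta h n).

Definition small_ball {R : realType} (d : nat) (beta h : R) n
    (v : 'I_n -> R) (x : R) : R :=
  cw_prob d beta h
    [set s : spins n | x - 1 < \sum_(i < n) v i * spin s i < x + 1]%SET.

Definition Q {R : realType} (d : nat) (beta h : R) (n : nat) : R :=
  sup [set sup [set small_ball d beta h v x
               | v in [set v : 'I_n -> R | forall i, 1 <= `|v i|]]
      | x in [set: R]].

Definition beta_c {R : realType} (d : nat) : R := (2 * d%:R)^-1.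

Definition mean_field {R : realType} (d : nat) (beta h z : R) : Prop :=
  tanh (beta / beta_c d * z + `|h|) = z.

Definition max_mean_field {R : realType} (d : nat) (beta h zs : R) : Prop :=
  [/\ 0 <= zs, mean_field d beta h zs &
      forall z : R, mean_field d beta h z -> z <= zs].

Lemma max_mean_field_ex {R : realType} (d : nat) (beta h : R) :
  exists zs, max_mean_field d beta h zs.
Proof.
have cosh_gt0 (x : R) : 0 < cosh x by rewrite divr_gt0// addr_gt0// expR_gt0.
have tanh_lt1 (x : R) : tanh x < 1.
  rewrite /tanh ltr_pdivrMr// mul1r ltr_pM2r ?invr_gt0// ltrD2l.
  by rewrite (@lt_trans _ _ 0) ?oppr_lt0 ?expR_gt0.
have tanh_ge0 (x : R) : 0 <= x -> 0 <= tanh x.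
  move=> x0; rewrite divr_ge0 ?(ltW (cosh_gt0 _))// divr_ge0// subr_ge0 ler_expR.
  by rewrite (@le_trans _ _ 0)// oppr_le0.
have cN : continuous (fun x : R => expR (- x)).
  by move=> x; apply: continuous_comp; [exact: opp_continuous|exact: continuous_expR].
have ctanh : continuous (@tanh R).
  move=> x; apply: cvgM.
    by apply: cvgM (cvg_cst _); apply: cvgB; [exact: continuous_expR|exact: cN].
  apply: cvgV; first by rewrite gt_eqF.
  by apply: cvgM (cvg_cst _); apply: cvgD; [exact: continuous_expR|exact: cN].
pose f (z : R) := tanh (beta / beta_c d * z + `|h|) - z.
have cf : continuous f.
  move=> z; apply: cvgB; last exact: cvg_id.
  apply: (@continuous_comp _ _ _ (fun x => beta / beta_c d * x + `|h|)).
    by apply: cvgD; [apply: cvgM; [exact: cvg_cst|exact: cvg_id]|exact: cvg_cst].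
  exact: ctanh.
have fE z : f z = 0 <-> mean_field d beta h z.
  by split=> [/eqP|mz]; [rewrite subr_eq0 => /eqP|apply/eqP; rewrite subr_eq0 mz].
have [c c01 fc] : exists2 c, c \in `[(0 : R), 1]%R & f c = 0.
  apply: IVT => //; first exact: continuous_subspaceT.
  have f0 : 0 <= f 0 by rewrite /f mulr0 add0r subr0 tanh_ge0.
  have f1 : f 1 <= 0 by rewrite subr_le0 ltW.
  by rewrite ge_min f1 orbT le_max f0.
have cS : compact (`[(0 : R), 1] `&` f @^-1` [set 0]).
  apply: compact_closedI; first exact: segment_compact.
  by apply: preimage_closed => //; exact: closed_eq.
have [||zs] := @compact_EVT_max _ R idfun _ _ cS.
- by exists c; split.
- by apply: continuous_subspaceT => x; exact: cvg_id.
rewrite inE => -[/= ]; rewrite in_itv/= => /andP[zs0 _] /fE mzs zsM.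
exists zs; split => // z mz; have [z0|z0] := leP 0 z; last exact: le_trans (ltW z0) zs0.
apply: zsM; rewrite inE; split; last exact/fE.
by rewrite /= in_itv/= z0 /= -mz ltW.
Qed.

(* Main.v *)
Require Import Defs.
From mathcomp Require Import all_boot all_order all_algebra.
From mathcomp Require Import all_classical all_reals all_analysis.
From mathcomp Require Import measurable_realfun ring lra.

Set Implicit Arguments.
Unset Strict Implicit.
Unset Printing Implicit Defensive.

Import Order.TTheory GRing.Theory Num.Theory.
Import numFieldNormedType.Exports.

Local Open Scope classical_set_scope.
Local Open Scope ring_scope.

(** The model is a mixture of product measures, and the concentration function
    of a product measure with equally biased spins can be computed up to a
    relative error [O(1/n)].

    Mixture. Put [b = 2 * d * beta]. Completing the square writes the weight of
    a configuration of magnetization [M] as the integral of [expR (t * M)]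
    against a normal density of mean [h] and variance [b / n]
    ([cw_mass_mixture]). Given [t] the spins are independent with tilt [t], and
    [t] itself has density proportional to [cosh t ^+ n] times the normal
    density. By symmetry everything lives on [t >= 0], where the density is,
    up to a harmless factor, the [n]-th power of
    [cosh t * expR (- (t - `|h|) ^+ 2 / (2 * b))].

    One product measure. After flipping the spins with negative coefficients,
    a ball of radius [1] is an antichain of the cube, because raising a spin
    moves the sum by at least [2]. A weighted LYM inequality ([lym]) bounds the
    probability of an antichain by that of the most likely level, hence by a
    coefficient of a product of [n] linear polynomials with parameters [p] and
    [1 - p]. A Cauchy-Schwarz argument bounds that coefficient by the middle one
    for parameters that occur equally often ([gf_coef_le]). Coefficients [v], half
    of them [1] and half of them [-1], attain this bound up to [O(1/n)], and
    they do so for all [t] at once. So [Q] lies between the averages over [t]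
    of two explicit functions ([Q_mixture]), and Wallis' estimates show that
    both are [cosh t / sqrt (pi * n / 2)], up to a relative error of order
    [1/n] times a power of [cosh t] ([bal_cosh], [bal_low_cosh]).

    Average over [t]. The logarithmic derivative of the weight is
    [tanh t - (t - `|h|) / b], which vanishes at [ts]. Integrating by parts
    against powers of [t - ts] ([stein]) and using the strict concavity of
    [tanh] gives a second moment of order [1/n], a fourth moment of order
    [1/n^2] and, if [0 < ts], a bias of order [1/n]; as [cosh] is flat at [0],
    the bias does not matter for [ts = 0]. Hence the mean of [cosh t] is
    [cosh ts + O(1/n)] ([vexp_expansion]). At the critical point the logarithm
    of the weight starts with [- t ^+ 4 / 12], so [t] lives at scale
    [n^(-1/4)] and [cosh t - 1] contributes at order [n^(-1/2)], with a
    coefficient that is a ratio of two quartic integrals ([vexp_critical]).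
    The substitution [x = s ^+ 4] and a double integral express this ratio by
    [Gamma (1 / 4)] ([Gamma_quarter], [quartic02]).

    For [beta = 0] the spins are independent with tilt [h], and the estimate of
    one product measure is enough ([Q_free]). *)

(** * Weighted antichains in the cube *)

Section Cube.
Variable R : realFieldType.
Implicit Types (n : nat).

Definition fcons n (b : bool) (s : spins n) : spins n.+1 :=
  [ffun i => if unlift ord0 i is Some j then s j else b].

Lemma fcons0 n b (s : spins n) : fcons b s ord0 = b.
Proof. by rewrite ffunE unlift_none. Qed.

Lemma fconsS n b (s : spins n) i : fcons b s (lift ord0 i) = s i.
Proof. by rewrite ffunE liftK. Qed.

Lemma fcons_inj n b c (s s' : spins n) :
  fcons b s = fcons c s' -> b = c /\ s = s'.
Proof.
move=> e; split; first by rewrite -(fcons0 b s) e fcons0.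
by apply/ffunP => i; rewrite -(fconsS b) e fconsS.
Qed.

Lemma big_spinsS (V : nmodType) n (P : pred (spins n.+1)) (F : spins n.+1 -> V) :
  \sum_(s | P s) F s =
  \sum_(s : spins n | P (fcons false s)) F (fcons false s) +
  \sum_(s : spins n | P (fcons true s)) F (fcons true s).
Proof.
pose u (s : spins n.+1) : bool * spins n := (s ord0, [ffun i => s (lift ord0 i)]).
pose w (x : bool * spins n) : spins n.+1 := fcons x.1 x.2.
have wK x : u (w x) = x.
  case: x => b s; rewrite /u /w/= fcons0; congr pair.
  by apply/ffunP => i; rewrite ffunE fconsS.
have uK s : w (u s) = s.
  apply/ffunP => i; rewrite /w /u /= ffunE.
  by case: unliftP => [j ->|->]; rewrite ?ffunE.
rewrite (reindex w)/=; last by exists u => x _; [exact: wK|exact: uK].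
rewrite big_mkcond/= -(pair_bigA _ (fun b s => if P (fcons b s) then F (fcons b s) else 0))/=.
by rewrite big_bool/= addrC -!big_mkcond.
Qed.

Definition count_up n (s : spins n) : nat := (\sum_(i < n) s i)%N.

Lemma count_up_fcons n b (s : spins n) :
  count_up (fcons b s) = (b + count_up s)%N.
Proof.
rewrite /count_up big_ord_recl fcons0; congr addn.
by apply: eq_bigr => i _; rewrite fconsS.
Qed.

Lemma count_up_le n (s : spins n) : (count_up s <= n)%N.
Proof.
rewrite /count_up -[leqRHS]card_ord -sum1_card.
by apply: leq_sum => i _; case: (s i).
Qed.

Definition weight n (p : 'I_n -> R) (s : spins n) : R :=
  \prod_(i < n) (if s i then p i else 1 - p i).

(** Generating polynomial of the number of successes in independent trials with
    success probabilities [s]. *)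
Definition gf (s : seq R) : {poly R} := \prod_(x <- s) ((1 - x)%:P + x *: 'X).

Lemma gf_cons x s : gf (x :: s) = ((1 - x)%:P + x *: 'X) * gf s.
Proof. by rewrite /gf big_cons. Qed.

Lemma coef_linM (a b : R) (P : {poly R}) k :
  ((a%:P + b *: 'X) * P)`_k = a * P`_k + b * (if k is k'.+1 then P`_k' else 0).
Proof.
rewrite mulrDl coefD mul_polyC coefZ -scalerAl coefZ coefXM; congr (_ + _ * _).
by case: k.
Qed.

Definition pseq n (p : 'I_n -> R) : seq R := [seq p i | i <- enum 'I_n].

Lemma pseqS n (p : 'I_n.+1 -> R) :
  pseq p = p ord0 :: pseq (fun i => p (lift ord0 i)).
Proof. by rewrite /pseq enum_ordSl/= -map_comp. Qed.

Lemma size_pseq n (p : 'I_n -> R) : size (pseq p) = n.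
Proof. by rewrite size_map size_enum_ord. Qed.

Lemma weight_fcons n b (p : 'I_n.+1 -> R) s :
  weight p (fcons b s) =
  (if b then p ord0 else 1 - p ord0) * weight (fun i => p (lift ord0 i)) s.
Proof.
rewrite /weight big_ord_recl fcons0; congr (_ * _).
by apply: eq_bigr => i _; rewrite fconsS.
Qed.

Lemma spins0 (s s' : spins 0) : s = s'.
Proof. by apply/ffunP => -[]. Qed.

Lemma big_spins0 (P : pred (spins 0)) (F : spins 0 -> R) s0 :
  \sum_(s | P s) F s = if P s0 then F s0 else 0.
Proof.
rewrite big_mkcond (bigD1 s0)//= big1 ?addr0// => s.
by rewrite (spins0 s s0) eqxx.
Qed.

Lemma weight_level n (p : 'I_n -> R) k :
  \sum_(s | count_up s == k) weight p s = (gf (pseq p))`_k.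
Proof.
elim: n p k => [|n ih] p k.
  rewrite (big_spins0 _ _ [ffun=> true]) /weight /gf /pseq /count_up.
  rewrite (_ : enum 'I_0 = [::]); last by apply: size0nil; rewrite size_enum_ord.
  by rewrite big_nil !big_ord0 coef1 [k == 0]eq_sym; case: (_ == _).
rewrite big_spinsS pseqS gf_cons coef_linM -ih !mulr_sumr.
congr (_ + _).
  by apply: eq_big => s; rewrite ?count_up_fcons// weight_fcons.
case: k => [|k]; first by rewrite mulr0 big_pred0// => s; rewrite count_up_fcons.
rewrite -ih mulr_sumr.
by apply: eq_big => s; rewrite ?count_up_fcons// weight_fcons.
Qed.

Lemma gf_ge0 (s : seq R) k : {in s, forall x, 0 < x < 1} -> 0 <= (gf s)`_k.
Proof.
elim: s k => [|x t ih] k t01; first by rewrite /gf big_nil coef1; case: eqP.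
have /andP[x0 x1] := t01 x (mem_head _ _).
have {}ih j : 0 <= (gf t)`_j by apply: ih => y yt; apply: t01; rewrite inE yt orbT.
rewrite gf_cons coef_linM addr_ge0// mulr_ge0// ?subr_ge0 ?(ltW x0) ?(ltW x1)//.
by case: k.
Qed.

Lemma gf_gt0 (s : seq R) k : {in s, forall x, 0 < x < 1} ->
  (k <= size s)%N -> 0 < (gf s)`_k.
Proof.
elim: s k => [|x t ih] k t01.
  by rewrite leqn0 => /eqP->; rewrite /gf big_nil coef1.
have /andP[x0 x1] := t01 x (mem_head _ _).
have t01' : {in t, forall x, 0 < x < 1}.
  by move=> y yt; apply: t01; rewrite inE yt orbT.
rewrite gf_cons coef_linM; case: k => [_|k kt].
  by rewrite mulr0 addr0 mulr_gt0 ?subr_gt0// ih.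
by rewrite ltr_wpDl ?mulr_gt0 ?ih// mulr_ge0 ?subr_ge0 ?(ltW x1)// gf_ge0.
Qed.

(** Multiplying by a linear polynomial with nonnegative coefficients keeps
    log-concavity: a minor of the new coefficients is a nonnegative combination
    of minors of the old ones. The minors with non-adjacent rows [i <= j] are
    needed for the induction to close. *)
Lemma gf_log_concave (s : seq R) i j : {in s, forall x, 0 < x < 1} ->
  (i <= j)%N -> (gf s)`_i * (gf s)`_j.+1 <= (gf s)`_i.+1 * (gf s)`_j.
Proof.
elim: s i j => [|x t ih] i j t01 ij.
  by rewrite /gf big_nil !coef1 [_.+1 == 0]/= mulr0 mul0r.
have /andP[x0 x1] := t01 x (mem_head _ _).
have t01' : {in t, forall x, 0 < x < 1}.
  by move=> y yt; apply: t01; rewrite inE yt orbT.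
have r0 k : 0 <= (gf t)`_k by exact: gf_ge0.
have {}ih i' j' : (i' <= j')%N -> _ := ih i' j' t01'.
rewrite gf_cons !coef_linM.
have xx : 0 <= (1 - x) * x by rewrite mulr_ge0 ?subr_ge0// ltW.
have y2 : 0 <= (1 - x) ^+ 2 by rewrite sqr_ge0.
have x2 : 0 <= x ^+ 2 by rewrite sqr_ge0.
rewrite -subr_ge0.
case: i j ij => [|i] [|j]// ij.
- have := ih 0 0 ij; have := r0 0; have := r0 1.
  set a := (gf t)`_0; set b := (gf t)`_1 => b0 a0 h.
  have -> : ((1 - x) * b + x * a) * ((1 - x) * a + x * 0) -
    ((1 - x) * a + x * 0) * ((1 - x) * b + x * a) = 0 by ring.
  by [].
- have h1 := ih 0 _ ij.
  set a := (gf t)`_0 in h1 *; set b := (gf t)`_1 in h1 *.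
  set c := (gf t)`_j in h1 *; set d := (gf t)`_j.+1 in h1 *.
  set e := (gf t)`_j.+2 in h1 *.
  have -> : ((1 - x) * b + x * a) * ((1 - x) * d + x * c) -
    ((1 - x) * a + x * 0) * ((1 - x) * e + x * d) =
    (1 - x) ^+ 2 * (b * d - a * e) + x ^+ 2 * (a * c) + ((1 - x) * x) * (b * c).
    ring.
  by rewrite !addr_ge0// mulr_ge0// ?subr_ge0// mulr_ge0// /a /b /c.
- have h1 := ih _ _ ij; have h2 := ih i j ij.
  have h3 : (gf t)`_i * (gf t)`_j.+2 <= (gf t)`_i.+2 * (gf t)`_j.
    move: ij; rewrite ltnS leq_eqVlt => /predU1P[->|ij].
      by rewrite mulrC.
    by apply: le_trans (ih i.+1 j ij); exact: (ih i j.+1 (leqW (ltnW ij))).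
  set a := (gf t)`_i in h1 h2 h3 *; set b := (gf t)`_i.+1 in h1 h2 h3 *.
  set c := (gf t)`_i.+2 in h1 h2 h3 *; set u := (gf t)`_j in h1 h2 h3 *.
  set v := (gf t)`_j.+1 in h1 h2 h3 *; set w := (gf t)`_j.+2 in h1 h2 h3 *.
  have -> : ((1 - x) * c + x * b) * ((1 - x) * v + x * u) -
    ((1 - x) * b + x * a) * ((1 - x) * w + x * v) =
    (1 - x) ^+ 2 * (c * v - b * w) + x ^+ 2 * (b * u - a * v)
     + ((1 - x) * x) * (c * u - a * w).
    ring.
  by rewrite !addr_ge0// mulr_ge0// subr_ge0.
Qed.

Definition antichain n (A : pred (spins n)) :=
  forall x y, A x -> A y -> (forall i, x i ==> y i) -> x = y.

Lemma fcons_le n b c (s s' : spins n) : b ==> c -> (forall i, s i ==> s' i) ->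
  forall i, fcons b s i ==> fcons c s' i.
Proof.
move=> bc ss' i; case: (unliftP ord0 i) => [j|] ->; first by rewrite !fconsS.
by rewrite !fcons0.
Qed.

Lemma count_up_eq n (x y : spins n) :
  (forall i, x i ==> y i) -> (count_up y <= count_up x)%N -> x = y.
Proof.
move=> xy; have le i : (x i <= y i)%N by have := xy i; case: (x i); case: (y i).
have /leqif_sum : forall i : 'I_n, true -> (x i <= y i ?= iff (x i == y i :> nat))%N.
  by move=> i _; split=> //; exact: le.
move=> /leqifP; rewrite -/(count_up x) -/(count_up y).
case: ifP => [/forallP h _ _|_ ]; last by rewrite ltnNge => /negP h /h.
by apply/ffunP => i; have := h i => /=; case: (x i); case: (y i).
Qed.

Lemma telescope_ge (c : nat -> R) m n : (m <= n)%N ->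
  \sum_(i < n | (m <= i)%N) (c i - c i.+1) = c m - c n.
Proof.
elim: n => [|n ih]; first by rewrite leqn0 => /eqP->; rewrite big_ord0 subrr.
rewrite leq_eqVlt => /predU1P[->|mn].
  rewrite subrr big_pred0// => i; apply/negbTE; rewrite -ltnNge.
  exact: ltn_ord.
rewrite big_mkcond big_ord_recr/= -big_mkcond/= ih//.
by rewrite -ltnS mn addrA subrK.
Qed.

Lemma telescope_le (c : nat -> R) m n : (m < n)%N ->
  \sum_(i < n | (i <= m)%N) (c i - c i.+1) = c 0 - c m.+1.
Proof.
elim: n => [|n ih] //; rewrite big_mkcond big_ord_recr/= -big_mkcond/=.
rewrite ltnS leq_eqVlt => /predU1P[->|mn]; last first.
  by rewrite ih// leqNgt mn addr0.
rewrite leqnn (eq_bigl (fun i : 'I_n => (0 <= i)%N)); last first.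
  by move=> i; rewrite ltnW.
by rewrite telescope_ge// addrA subrK.
Qed.

Lemma size_gf (s : seq R) : (size (gf s) <= (size s).+1)%N.
Proof.
elim: s => [|x s ih]; first by rewrite /gf big_nil size_poly1.
rewrite gf_cons; apply: leq_trans (size_polyMleq _ _) _.
rewrite -subn1 leq_subLR add1n.
apply: leq_trans (leq_add _ ih) _; last exact: (leqnn (2 + _)).
rewrite (leq_trans (size_polyD _ _))// geq_max.
rewrite (leq_trans (size_polyC_leq1 _))//= (leq_trans (size_scale_leq _ _))//.
by rewrite size_polyX.
Qed.

(** The Lubell-Yamamoto-Meshalkin inequality for a product measure, whose levels
    are not uniform. Induction on the coordinates: let [A0] and [A1] be the
    slices of the antichain where the first spin is down or up, and [c k] the
    conditional probability that the first spin is down given [k] ups in total.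
    The terms of [A0] and [A1] carry the factors [c k] and [1 - c k.+1] relative
    to the cube of one dimension less. By log-concavity [c] decreases from [1]
    to [0], and summation by parts turns the total into a convex combination,
    with coefficients [c i - c i.+1], of the sums over [B i], the part of [A0] at
    level at most [i] together with the part of [A1] at level at least [i]. Each
    [B i] is an antichain: no element of [A0] is below one of [A1] since [A] is
    an antichain, and conversely because of the levels. *)
Lemma lym n (p : 'I_n -> R) (A : pred (spins n)) :
  (forall i, 0 < p i < 1) -> antichain A ->
  \sum_(s | A s) weight p s / (gf (pseq p))`_(count_up s) <= 1.
Proof.
elim: n p A => [|n ih] p A p01 Aanti.
  rewrite (big_spins0 _ _ [ffun=> true]); case: ifP => // _.
  rewrite /weight /gf /pseq /count_up.
  rewrite (_ : enum 'I_0 = [::]); last by apply: size0nil; rewrite size_enum_ord.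
  by rewrite big_nil !big_ord0 coef1 divr1.
set q := fun i => p (lift ord0 i).
have q01 i : 0 < q i < 1 by exact: p01.
have qin : {in pseq q, forall x, 0 < x < 1} by move=> x /mapP[i _ ->].
set r := fun k => (gf (pseq q))`_k.
have r0 k : 0 <= r k by exact: gf_ge0.
have rgt k : (k <= n)%N -> 0 < r k by move=> kn; apply: gf_gt0 => //; rewrite size_pseq.
have /andP[x0 x1] := p01 ord0; set x := p ord0 in x0 x1.
set r' := fun k => (gf (pseq p))`_k.
have r'E k : r' k = (1 - x) * r k + x * (if k is k'.+1 then r k' else 0).
  by rewrite /r' pseqS gf_cons coef_linM.
have r'gt k : (k <= n.+1)%N -> 0 < r' k.
  by move=> kn; apply: gf_gt0; [move=> y /mapP[i _ ->]|rewrite size_pseq].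
have y0 : 0 < 1 - x by rewrite subr_gt0.
pose c k := (1 - x) * r k / r' k.
have c0 : c 0 = 1.
  rewrite /c r'E mulr0 addr0 divff// gt_eqF// mulr_gt0// rgt//.
have cn : c n.+1 = 0.
  rewrite /c /r nth_default ?mulr0 ?mul0r//.
  by rewrite (leq_trans (size_gf _))// size_pseq.
have cdec k : (k <= n)%N -> c k.+1 <= c k.
  move=> kn; rewrite /c ler_pdivrMr ?r'gt// mulrAC ler_pdivlMr ?r'gt ?(leqW kn)//.
  rewrite !r'E -subr_ge0; case: k kn => [|k] kn.
    have -> : (1 - x) * r 0 * ((1 - x) * r 1 + x * r 0) - (1 - x) * r 1 * ((1 - x) * r 0 + x * 0)
      = (1 - x) * x * (r 0) ^+ 2 by ring.
    by rewrite mulr_ge0 ?sqr_ge0// mulr_ge0// ltW.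
  have -> : (1 - x) * r k.+1 * ((1 - x) * r k.+2 + x * r k.+1) -
     (1 - x) * r k.+2 * ((1 - x) * r k.+1 + x * r k) =
     (1 - x) * x * (r k.+1 * r k.+1 - r k * r k.+2) by ring.
  rewrite mulr_ge0 ?mulr_ge0 ?(ltW x0) ?(ltW y0)// subr_ge0.
  exact: gf_log_concave.
pose u s := weight q s / r (count_up s).
pose A0 s := A (fcons false s); pose A1 s := A (fcons true s).
have A01 s s' : A0 s -> A1 s' -> (forall i, s i ==> s' i) -> False.
  move=> a0 a1 ss'.
  by have /fcons_inj[] := Aanti _ _ a0 a1 (fcons_le (isT : false ==> true) ss').
pose B (i : nat) s := A0 s && (count_up s <= i)%N || A1 s && (i <= count_up s)%N.
have Banti i : antichain (B i).
  move=> s s' /orP[]/andP[a h] /orP[]/andP[a' h'] ss'.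
  - by have /fcons_inj[] := Aanti _ _ a a' (fcons_le (isT : false ==> false) ss').
  - by have := A01 _ _ a a' ss'.
  - by apply: count_up_eq => //; exact: leq_trans h' h.
  - by have /fcons_inj[] := Aanti _ _ a a' (fcons_le (isT : true ==> true) ss').
have Bsum i : \sum_(s | B i s) u s =
   \sum_(s | A0 s && (count_up s <= i)%N) u s +
   \sum_(s | A1 s && (i <= count_up s)%N) u s.
  rewrite (bigID A0)/=; congr (_ + _); apply: eq_bigl => s; rewrite /B.
    case: (boolP (A0 s)) => a0; rewrite ?andbF ?andbT//=.
    case: (boolP (A1 s)) => a1; rewrite ?orbF//=.
    by have := A01 _ _ a0 a1 (fun i => implybb _).
  case: (boolP (A0 s)) => a0; rewrite ?andbF ?andbT//=.
  case: (boolP (A1 s)) => a1//=.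
  by have := A01 _ _ a0 a1 (fun i => implybb _).
rewrite big_spinsS.
have E0 : \sum_(s | A (fcons false s))
    weight p (fcons false s) / (gf (pseq p))`_(count_up (fcons false s)) =
  \sum_(i < n.+1) (c i - c i.+1) * \sum_(s | A0 s && (count_up s <= i)%N) u s.
  under [RHS]eq_bigr do rewrite mulr_sumr big_mkcondr/=.
  rewrite exchange_big/=; apply: eq_bigr => s _.
  rewrite -big_mkcond/= -mulr_suml telescope_ge; last first.
    exact/leqW/count_up_le.
  rewrite cn subr0 weight_fcons count_up_fcons add0n -/(r' _) /c /u.
  have r'0 : r' (count_up s) != 0 by rewrite gt_eqF// r'gt// leqW// count_up_le.
  have r00 : r (count_up s) != 0 by rewrite gt_eqF// rgt ?count_up_le.
  by rewrite -/x -/q; field; rewrite r00 r'0.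
have E1 : \sum_(s | A (fcons true s))
    weight p (fcons true s) / (gf (pseq p))`_(count_up (fcons true s)) =
  \sum_(i < n.+1) (c i - c i.+1) * \sum_(s | A1 s && (i <= count_up s)%N) u s.
  under [RHS]eq_bigr do rewrite mulr_sumr big_mkcondr/=.
  rewrite exchange_big/=; apply: eq_bigr => s _.
  rewrite -big_mkcond/= -mulr_suml telescope_le; last first.
    by rewrite ltnS count_up_le.
  rewrite c0 weight_fcons count_up_fcons add1n -/(r' _) /c /u.
  have r'0 : r' (count_up s).+1 != 0 by rewrite gt_eqF// r'gt// ltnS count_up_le.
  have r00 : r (count_up s) != 0 by rewrite gt_eqF// rgt ?count_up_le.
  have -> : 1 - (1 - x) * r (count_up s).+1 / r' (count_up s).+1 =
     x * r (count_up s) / r' (count_up s).+1.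
    apply: (mulIf r'0); rewrite mulrBl !mulfVK// mul1r.
    by rewrite r'E addrC addrA addNr add0r.
  by rewrite -/x -/q; field; rewrite r00 r'0.
rewrite E0 E1 -big_split/=.
apply: (@le_trans _ _ (\sum_(i < n.+1) (c i - c i.+1))).
  apply: ler_sum => i _; rewrite -mulrDr -Bsum ler_piMr//.
    by rewrite subr_ge0 cdec// -ltnS.
  exact: ih.
rewrite (eq_bigl (fun i : 'I_n.+1 => (0 <= i)%N))//.
by rewrite telescope_ge// c0 cn subr0.
Qed.

(** With [B] bounding every level probability, each weight is at most [B] times its
    term in [lym]. *)
Lemma antichain_weight_le n (p : 'I_n -> R) (A : pred (spins n)) B :
  (forall i, 0 < p i < 1) -> antichain A ->
  (forall k, (gf (pseq p))`_k <= B) -> \sum_(s | A s) weight p s <= B.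
Proof.
move=> p01 Aa gB.
have g0 s : 0 < (gf (pseq p))`_(@count_up n s).
  by apply: gf_gt0; [move=> x /mapP[i _ ->]|rewrite size_pseq count_up_le].
have B0 : 0 <= B.
  apply: le_trans (gB 0); apply: gf_ge0; first by move=> x /mapP[i _ ->].
apply: (@le_trans _ _ (\sum_(s | A s) B * (weight p s / (gf (pseq p))`_(count_up s)))).
  apply: ler_sum => s _; rewrite mulrCA ler_peMr//.
    by apply: prodr_ge0 => i _; have /andP[a b] := p01 i; case: ifP; rewrite ?subr_ge0 ltW.
  by rewrite ler_pdivlMr ?mul1r.
by rewrite -mulr_sumr ler_piMr// lym.
Qed.
End Cube.

(** * Coefficients of products of linear polynomials *)

Section Balanced.
Variable R : realFieldType.
Implicit Types (p a : R) (s : seq R) (m n k : nat).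

Definition central_bin (N : nat) : R := 'C(N.*2, N)%:R / 4 ^+ N.

(** Mean of the probability that [N] pairs of fair coins balance, for [N] binomial
    of parameters [m] and [a]. This is the middle coefficient of
    [pair_poly p ^+ m] for [a = 4 * p * (1 - p)] ([pair_poly_coef]), written as a
    mixture so that its asymptotics are uniform in [a]. *)
Definition bal m a : R :=
  \sum_(N < m.+1) 'C(m, N)%:R * a ^+ N * (1 - a) ^+ (m - N) * central_bin N.

Definition pair_poly p : {poly R} :=
  ((1 - p)%:P + p *: 'X) * (p%:P + (1 - p) *: 'X).

Lemma coef_1DX_exp n k : ((1 + 'X : {poly R}) ^+ n)`_k = 'C(n, k)%:R.
Proof.
rewrite exprDn coef_sum.
under eq_bigr do rewrite expr1n mul1r coefMn coefXn.
have [kn|nk] := leqP k n.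
  rewrite (bigD1 (Ordinal (kn : (k < n.+1)%N)))//= eqxx big1 ?addr0//.
  by move=> i /eqP ik; rewrite (_ : _ == _ = false) ?mul0rn//; apply/eqP => h; apply: ik; apply: val_inj.
rewrite bin_small// big1// => i _; rewrite gtn_eqF ?mul0rn//.
by rewrite (leq_ltn_trans _ nk)// -ltnS.
Qed.

(** Two trials with opposite biases give one success, apart from an event of
    probability [4 * p * (1 - p)] on which they behave as two fair coins. *)
Lemma pair_polyE p : pair_poly p =
  ((1 - 4 * p * (1 - p)) *: 'X) + (p * (1 - p)) *: (1 + 'X) ^+ 2.
Proof.
rewrite /pair_poly -!mul_polyC.
rewrite !(rmorphB, rmorphM, rmorph1, rmorph_nat).
set P := p%:P; ring.
Qed.

Lemma pair_poly_coef p m : (pair_poly p ^+ m)`_m = bal m (4 * p * (1 - p)).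
Proof.
rewrite pair_polyE exprDn coef_sum /bal; apply: eq_bigr => -[i/= im] _.
rewrite coefMn exprZn -scalerAl coefZ exprZn -scalerAr coefZ.
rewrite coefXnM ltnNge leq_subr/= subKn// -exprM mul2n coef_1DX_exp.
rewrite /central_bin -[LHS]mulr_natl.
have -> : (4 * p * (1 - p)) ^+ i = 4 ^+ i * (p * (1 - p)) ^+ i.
  by rewrite -exprMn mulrA.
by field; rewrite expf_neq0// pnatr_eq0.
Qed.

(** Exchanging successes and failures complements every parameter. *)
Lemma gf_rev s k : (k <= size s)%N ->
  (gf s)`_k = (gf [seq 1 - x | x <- s])`_(size s - k).
Proof.
elim: s k => [|x s ih] k; first by rewrite leqn0 => /eqP->.
rewrite /= !gf_cons !coef_linM subKr.
have g0 (t : seq R) j : (size t < j)%N -> (gf t)`_j = 0.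
  by move=> tj; rewrite nth_default// (leq_trans (size_gf _)).
case: k => [_|k ks] /=.
  by rewrite mulr0 addr0 ih// !subn0 (g0 _ (size s).+1) ?size_map// mulr0 add0r.
rewrite subSS -[in RHS]ih//.
move: ks; rewrite ltnS leq_eqVlt => /predU1P[->|ks].
  by rewrite subnn/= g0// !mulr0 add0r addr0.
rewrite (ih k.+1)//; have -> : (size s - k = (size s - k.+1).+1)%N.
  by rewrite -subSn// subSS.
by rewrite addrC.
Qed.

Lemma gf_cat s t : gf (s ++ t) = gf s * gf t.
Proof. by rewrite /gf big_cat. Qed.

Lemma pair_polyX p m : pair_poly p ^+ m = gf (nseq m p ++ nseq m (1 - p)).
Proof.
by rewrite gf_cat /gf !big_nseq -!Monoid.iteropE exprMn subKr.
Qed.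

Lemma pair_poly_pal p m k : (k <= m.*2)%N ->
  (pair_poly p ^+ m)`_k = (pair_poly p ^+ m)`_(m.*2 - k).
Proof.
move=> km; rewrite pair_polyX gf_rev size_cat !size_nseq addnn//.
rewrite map_cat !map_nseq subKr; congr (_`__).
by rewrite !gf_cat mulrC.
Qed.

(** One pair is split off the product; the coefficients just below and just above
    the middle agree by [pair_poly_pal]. *)
Lemma balS_coef p m : bal m.+1 (4 * p * (1 - p)) =
  2 * p * (1 - p) * (pair_poly p ^+ m)`_m.+1
  + (1 - 2 * p * (1 - p)) * (pair_poly p ^+ m)`_m.
Proof.
rewrite -pair_poly_coef exprS.
rewrite (_ : pair_poly p * _ = ((1 - p)%:P + p *: 'X) *
  ((p%:P + (1 - p) *: 'X) * pair_poly p ^+ m)); last by rewrite mulrA.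
case: m => [|m]; first by rewrite !coef_linM/= ?coef_linM/= expr0 !coef1/=; ring.
rewrite !coef_linM/= ?coef_linM/= (pair_poly_pal _ (_ : (m <= _)%N)); last first.
  by rewrite -addnn addSn leqW// leq_addr.
have -> : (m.+1.*2 - m = m.+2)%N by rewrite -addnn addSn -addnS addKn.
ring.
Qed.

Section twisted.
Variable p : R.
Hypothesis p01 : 0 < p < 1.

Let sp s := all (fun x => (x == p) || (x == 1 - p)) s.

Let sp01 s : sp s -> {in s, forall x, 0 < x < 1}.
Proof.
move: p01 => /andP[p0 p1].
by move=> /allP sps x /sps /orP[] /eqP->; rewrite ?p0// subr_gt0 p1 ltrBlDr ltrDl.
Qed.

(** If every parameter is [p] or [1 - p], each linear polynomial times its reversal
    is [pair_poly p], and the sum of squares of the coefficients is the middle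
    coefficient of the product of [gf s] and its reversal. *)
Lemma gf_sqr_sum s : sp s ->
  \sum_(i < (size s).+1) (gf s)`_i ^+ 2 = bal (size s) (4 * p * (1 - p)).
Proof.
move=> sps; rewrite -pair_poly_coef.
have <- : gf s * gf [seq 1 - x | x <- s] = pair_poly p ^+ size s.
  elim: s sps => [|x s ih]; first by rewrite /gf !big_nil mul1r.
  move=> /= /andP[xp /ih{}ih]; rewrite !gf_cons mulrACA ih exprS; congr (_ * _).
  by move: xp => /orP[] /eqP ->; rewrite /pair_poly !subKr// mulrC.
rewrite coefM; apply: eq_bigr => -[i/= is1] _.
by rewrite gf_rev// subKn// -gf_rev.
Qed.

(** Cut [s] into two halves. A coefficient of the product is a convolution, which
    [2 * x * y <= x ^+ 2 + y ^+ 2] bounds by the mean of two sums of squares; both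
    are [bal m], however [p] and [1 - p] are distributed in [s]. *)
Lemma gf_coef_le_even s m k : sp s -> size s = m.*2 ->
  (gf s)`_k <= bal m (4 * p * (1 - p)).
Proof.
move=> sps sm; have := sps; rewrite /sp -{1}(cat_take_drop m s) all_cat => /andP[].
set u := take m s; set v := drop m s => spu spv.
have su : size u = m.
  by rewrite size_take sm -addnn; case: ltngtP => //; rewrite ltnNge leq_addr.
have sv : size v = m by rewrite size_drop sm -addnn addnK.
have u0 j : 0 <= (gf u)`_j by apply/gf_ge0/sp01.
have v0 j : 0 <= (gf v)`_j by apply/gf_ge0/sp01.
have g0 (t : seq R) j : (size t <= j)%N -> (gf t)`_j.+1 = 0.
  by move=> tj; rewrite nth_default// (leq_trans (size_gf _)).
have tail (t : seq R) K : \sum_(i < K.+1) (gf t)`_i ^+ 2 <= \sum_(i < (size t).+1) (gf t)`_i ^+ 2.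
  have [Kt|tK] := leqP K (size t).
    rewrite (big_ord_widen _ (fun i => (gf t)`_i ^+ 2) (Kt : (K.+1 <= (size t).+1)%N)) big_mkcond/=.
    by apply: ler_sum => i _; case: ifP => // _; rewrite sqr_ge0.
  rewrite [leRHS](big_ord_widen _ (fun i => (gf t)`_i ^+ 2) (ltnW tK : ((size t).+1 <= K.+1)%N)).
  rewrite [leRHS]big_mkcond/=; apply: ler_sum => -[[|i]/= _] _ //.
  by case: ifPn => //; rewrite ltnS -ltnNge ltnS => ti; rewrite g0// expr0n.
have := gf_sqr_sum spu; have := gf_sqr_sum spv; rewrite su sv => Ev Eu.
have {}Eu : \sum_(i < k.+1) (gf u)`_i ^+ 2 <= bal m (4 * p * (1 - p)).
  by rewrite -Eu -su tail.
have {}Ev : \sum_(i < k.+1) (gf v)`_(k - i) ^+ 2 <= bal m (4 * p * (1 - p)).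
  rewrite (reindex_inj rev_ord_inj)/= -Ev.
  under eq_bigr => i _ do rewrite subSS subKn -1?ltnS//.
  by rewrite -sv tail.
rewrite -(cat_take_drop m s) gf_cat coefM.
apply: (@le_trans _ _ (\sum_(i < k.+1) ((gf u)`_i ^+ 2 + (gf v)`_(k - i) ^+ 2) / 2)).
  apply: ler_sum => i _; rewrite -subr_ge0.
  have -> : ((gf u)`_i ^+ 2 + (gf v)`_(k - i) ^+ 2) / 2 - (gf u)`_i * (gf v)`_(k - i)
    = ((gf u)`_i - (gf v)`_(k - i)) ^+ 2 / 2 by field.
  by rewrite divr_ge0// sqr_ge0.
by rewrite -mulr_suml big_split/=; lra.
Qed.

(** For odd size, the coefficient is a convex combination of two coefficients of the
    product without its first element. *)
Lemma gf_coef_le s k : sp s -> (gf s)`_k <= bal (size s)./2 (4 * p * (1 - p)).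
Proof.
move=> sps; case: (boolP (odd (size s))) => [|ev]; last first.
  by apply: gf_coef_le_even => //; rewrite even_halfK.
case: s sps => //= x s /andP[xp sps] os.
rewrite uphalf_half; move: os => /= /negbTE ev; rewrite ev add0n.
have h j : (gf s)`_j <= bal (size s)./2 (4 * p * (1 - p)).
  by apply: gf_coef_le_even => //; rewrite even_halfK// ev.
have b0 : 0 <= bal (size s)./2 (4 * p * (1 - p)).
  by apply: le_trans (h 0); apply/gf_ge0/sp01.
have /andP[x0 x1] : 0 < x < 1.
  by apply: (@sp01 (x :: s)); rewrite ?mem_head//= xp.
rewrite gf_cons coef_linM.
apply: (@le_trans _ _ ((1 - x) * bal (size s)./2 (4 * p * (1 - p)) +
   x * bal (size s)./2 (4 * p * (1 - p)))); last first.
  by rewrite -mulrDl subrK mul1r.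
by apply: lerD; rewrite ler_pM2l ?subr_gt0//; case: k.
Qed.

End twisted.
End Balanced.

(** * Small balls under a product measure *)

Section Tilted.
Variable R : realType.
Implicit Types (t x : R) (n : nat).

Lemma cosh_gt0 t : 0 < cosh t.
Proof. by rewrite /cosh divr_gt0// addr_gt0// expR_gt0. Qed.

Lemma twice_cosh_gt0 n t : 0 < (2 * cosh t) ^+ n.
Proof. by apply/exprn_gt0/mulr_gt0 => //; exact: cosh_gt0. Qed.

(** Probability of an up spin when the spin [e] has weight [expR (t * e)]. *)
Definition up_prob t : R := expR t / (expR t + expR (- t)).

Lemma up_prob01 t : 0 < up_prob t < 1.
Proof.
have e1 := expR_gt0 t; have e2 := expR_gt0 (- t).
rewrite /up_prob divr_gt0 ?addr_gt0//= ltr_pdivrMr ?addr_gt0// mul1r.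
by rewrite ltrDl.
Qed.

Lemma up_probC t : 1 - up_prob t = expR (- t) / (expR t + expR (- t)).
Proof.
have e0 : expR t + expR (- t) != 0 by rewrite gt_eqF// addr_gt0// expR_gt0.
by rewrite /up_prob; field.
Qed.

Lemma up_prob_var t : 4 * up_prob t * (1 - up_prob t) = (cosh t) ^- 2.
Proof.
have e0 : expR t + expR (- t) != 0 by rewrite gt_eqF// addr_gt0// expR_gt0.
have e1 : expR t * expR (- t) = 1 by rewrite -expRD subrr expR0.
rewrite up_probC /up_prob /cosh.
have -> : 4 * (expR t / (expR t + expR (- t))) * (expR (- t) / (expR t + expR (- t)))
  = 4 * (expR t * expR (- t)) / (expR t + expR (- t)) ^+ 2 by field.
by rewrite e1; field.
Qed.

Definition mag n (s : spins n) : R := \sum_(j < n) spin s j.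

(** Flips the spins at which [o] is [false]. As an involution of the cube it reduces
    signed coefficients to positive ones, at the price of mixing the parameters
    [p] and [1 - p]. *)
Definition agree n (o : 'I_n -> bool) (s : spins n) : spins n :=
  [ffun i => s i == o i].

Lemma agreeK n (o : 'I_n -> bool) : involutive (agree o).
Proof. by move=> s; apply/ffunP => i; rewrite !ffunE; case: (s i); case: (o i). Qed.

Definition oprob t n (o : 'I_n -> bool) (i : 'I_n) : R :=
  if o i then up_prob t else 1 - up_prob t.

Lemma tilt_weight t n (o : 'I_n -> bool) (s : spins n) :
  expR (t * mag s) = (2 * cosh t) ^+ n * weight (oprob t o) (agree o s).
Proof.
have e0 : expR t + expR (- t) != 0 by rewrite gt_eqF// addr_gt0// expR_gt0.
have c2 : 2 * cosh t = expR t + expR (- t) by rewrite /cosh; field.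
rewrite /mag mulr_sumr expR_sum /weight.
rewrite -[in (2 * cosh t) ^+ n](card_ord n) -prodr_const -big_split/=.
apply: eq_bigr => i _; rewrite /oprob ffunE /spin c2.
case: (s i); case: (o i); rewrite /= ?subKr ?up_probC /up_prob ?mulr1 ?mulrN1.
all: by rewrite mulrC divfK.
Qed.

Definition oriented n (v : 'I_n -> R) (i : 'I_n) : bool := 0 < v i.

Lemma oriented_sum n (v : 'I_n -> R) (s : spins n) :
  \sum_(i < n) v i * spin s i = \sum_(i < n) `|v i| * spin (agree (oriented v) s) i.
Proof.
apply: eq_bigr => i _; rewrite /spin ffunE /oriented.
by case: ltP => v0; [rewrite gtr0_norm//|rewrite ler0_norm//];
  case: (s i); rewrite /= ?mulr1 ?mulrN1 ?opprK.
Qed.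

Definition ball_set n (v : 'I_n -> R) x : {set spins n} :=
  [set s : spins n | x - 1 < \sum_(i < n) v i * spin s i < x + 1]%SET.

(** With positive coefficients at least [1], raising a spin increases the sum by at
    least [2], which is the width of the open interval. *)
Lemma ball_antichain n (v : 'I_n -> R) x : (forall i, 1 <= `|v i|) ->
  antichain (fun s => agree (oriented v) s \in ball_set v x).
Proof.
move=> v1 s s'; rewrite !inE !(oriented_sum v) !agreeK.
move=> /andP[sl sr] /andP[sl' sr'] ss'.
apply/eqP; apply: contraTT sr' => ne.
have [i ni] : exists i, s i != s' i.
  apply/existsP; apply: contraNT ne; rewrite negb_exists => /forallP h.
  by apply/eqP/ffunP => i; apply/eqP; have := h i; rewrite negbK.
have {}ni : s i = false /\ s' i = true.
  by have := ss' i; move: ni; case: (s i); case: (s' i).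
have Es : spin s i = -1 :> R by rewrite /spin ni.1.
have Es' : spin s' i = 1 :> R by rewrite /spin ni.2.
rewrite -leNgt (bigD1 i)//= Es' mulr1.
move: sl; rewrite (bigD1 i)//= Es mulrN1 => sl.
have h : \sum_(j < n | j != i) `|v j| * spin s j <=
         \sum_(j < n | j != i) `|v j| * spin s' j.
  apply: ler_sum => j _; apply: ler_wpM2l => //; rewrite /spin.
  by have := ss' j; case: (s j); case: (s' j) => //= _; lra.
by have := v1 i; lra.
Qed.

(** Unnormalized mass of [A] for independent spins of tilt [t]; the whole cube has mass
    [(2 * cosh t) ^+ n] ([tilt_setT]). *)
Definition tilt t n (A : {set spins n}) : R := \sum_(s in A) expR (t * mag s).

Lemma tilt_ball_le t n (v : 'I_n -> R) x : (forall i, 1 <= `|v i|) ->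
  tilt t (ball_set v x) <= (2 * cosh t) ^+ n * bal n./2 (cosh t ^- 2).
Proof.
move=> v1; rewrite /tilt.
under eq_bigr do rewrite (tilt_weight _ (oriented v)).
rewrite -mulr_sumr ler_pM2l ?twice_cosh_gt0//.
rewrite (reindex_inj (can_inj (agreeK (oriented v))))/=.
under eq_bigr do rewrite agreeK.
have p01 := up_prob01 t.
have sall : all (fun y => (y == up_prob t) || (y == 1 - up_prob t))
               (pseq (oprob t (oriented v))).
  by apply/allP => y /mapP[i _ ->]; rewrite /oprob; case: ifP; rewrite eqxx ?orbT.
apply: antichain_weight_le; last first.
- by move=> k; rewrite -up_prob_var; have := gf_coef_le p01 k sall; rewrite size_pseq.
- exact: ball_antichain.
- by move=> i; rewrite /oprob; case: ifP => // _; move/andP: p01 => [a b]; apply/andP; split; lra.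
Qed.

Definition half_signs n m (i : 'I_n) : R := if (i < m)%N then 1 else - 1.

Lemma half_signs1 n m i : 1 <= `|@half_signs n m i|.
Proof. by rewrite /half_signs; case: ifP; rewrite ?normrN normr1. Qed.

Lemma sum_spin n (s : spins n) : \sum_(i < n) spin s i = 2 * (count_up s)%:R - n%:R :> R.
Proof.
rewrite /count_up natr_sum mulr_sumr -[in n%:R](card_ord n) -sum1_card natr_sum.
rewrite -sumrB; apply: eq_bigr => i _; rewrite /spin.
by case: (s i); rewrite /=; lra.
Qed.

Lemma tilt_ball_ge t n m k :
  (2 * cosh t) ^+ n *
   (gf (pseq (oprob t (fun i : 'I_n => (i < m)%N))))`_k
  <= tilt t (ball_set (@half_signs n m) (2 * k%:R - n%:R)).
Proof.
set o := (fun i : 'I_n => (i < m)%N).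
have oE i : oriented (@half_signs n m) i = o i.
  by rewrite /oriented /half_signs /o; case: ifP => _; rewrite ?ltr01// oppr_gt0 ltr10.
rewrite -weight_level mulr_sumr.
rewrite (reindex_inj (can_inj (agreeK o)))/=.
under eq_bigr do rewrite -tilt_weight.
rewrite /tilt [leLHS]big_mkcond [leRHS]big_mkcond/=; apply: ler_sum => s _.
case: ifP => [/eqP sk|_]; last by case: ifP => // _; exact: expR_ge0.
rewrite inE (oriented_sum (half_signs m)).
have -> : agree (oriented (half_signs m)) s = agree o s.
  by apply/ffunP => i; rewrite !ffunE oE.
have -> : \sum_(i < n) `|half_signs m i| * spin (agree o s) i =
   \sum_(i < n) spin (agree o s) i :> R.
  apply: eq_bigr => i _; rewrite /half_signs.
  by case: ifP; rewrite ?normrN normr1 mul1r.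
by rewrite sum_spin sk ltrBlDr !ltrDl ltr01.
Qed.

Lemma pseq_half t n m : (m <= n)%N ->
  pseq (oprob t (fun i : 'I_n => (i < m)%N)) =
  nseq m (up_prob t) ++ nseq (n - m) (1 - up_prob t).
Proof.
move=> mn; apply: (@eq_from_nth _ 0).
  by rewrite size_pseq size_cat !size_nseq subnKC.
rewrite size_pseq => i ni; rewrite (nth_map (Ordinal ni)) ?size_enum_ord//.
rewrite /oprob nth_enum_ord// nth_cat size_nseq !nth_nseq; case: ifP => //.
by move=> /negbT; rewrite -leqNgt => mi; rewrite ltn_sub2r ?ni// (leq_ltn_trans mi).
Qed.

(** For odd [n], the mean of the two central coefficients when the parameters are
    balanced up to one spin; [balS_coef] expresses it by [bal] alone. *)
Definition bal_low n (a : R) : R :=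
  if odd n then bal n./2 a - (bal n./2 a - bal n./2.+1 a) / a else bal n./2 a.

(** Coefficients [1] and [-1] in equal number produce [p] and [1 - p] equally often.
    For odd [n] one spin is left over, and the two central balls have
    probabilities that are exchanged when [t] changes sign; only their mean is a
    function of [cosh t], whence two centers. *)
Lemma tilt_low n : exists v : 'I_n -> R, exists x x', (forall i, 1 <= `|v i|) /\
  forall t, 2 * ((2 * cosh t) ^+ n * bal_low n (cosh t ^- 2)) <=
   tilt t (ball_set v x) + tilt t (ball_set v x').
Proof.
set m := n./2.
exists (@half_signs n m); exists (2 * m%:R - n%:R).
exists (2 * (m + odd n)%:R - n%:R); split=> [i|t]; first exact: half_signs1.
have h1 := @tilt_ball_ge t n m m; have h2 := @tilt_ball_ge t n m (m + odd n)%N.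
apply: le_trans (lerD h1 h2) => {h1 h2}.
rewrite -mulrDr mulrCA ler_pM2l ?twice_cosh_gt0//.
have mn : (m <= n)%N by rewrite /m -{2}(odd_double_half n) -addnn addnA leq_addl.
rewrite pseq_half// /bal_low -/m.
have nE := odd_double_half n; rewrite -/m in nE.
have c0 : cosh t ^- 2 != 0 by rewrite gt_eqF// invr_gt0 exprn_gt0// cosh_gt0.
case: ifP nE => on nE.
  set p := up_prob t.
  set c := fun k => (pair_poly p ^+ m)`_k.
  have gfE k : (gf (nseq m p ++ nseq (n - m) (1 - p)))`_k =
      p * c k + (1 - p) * (if k is k'.+1 then c k' else 0).
    rewrite (_ : (n - m = m + 1)%N); last by rewrite -nE -addnn /= addnA addnK addnC.
    rewrite nseqD catA gf_cat -pair_polyX gf_cons mulrC.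
    by rewrite /gf big_nil mulr1 subKr coef_linM.
  have pal : (if m is m'.+1 then c m' else 0) = c m.+1.
    rewrite /c; case: (m) => [|k]; first by rewrite expr0 coef1.
    rewrite (pair_poly_pal _ (_ : (k <= _)%N)); last first.
      by rewrite -addnn addSn leqW// leq_addr.
    by have -> : (k.+1.*2 - k = k.+2)%N by rewrite -addnn addSn -addnS addKn.
  rewrite !gfE addn1 pal.
  have bS : bal m.+1 (4 * p * (1 - p)) =
    2 * p * (1 - p) * c m.+1 + (1 - 2 * p * (1 - p)) * c m := balS_coef p m.
  have b0 : c m = bal m (4 * p * (1 - p)) := pair_poly_coef p m.
  rewrite -up_prob_var -/p in c0 *; rewrite bS -b0.
  have p0 : p != 0 by apply: contraNneq c0 => ->; rewrite mulr0 mul0r.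
  have q0 : 1 - p != 0 by apply: contraNneq c0 => ->; rewrite mulr0.
  by rewrite le_eqVlt; apply/orP; left; apply/eqP; field; rewrite p0 q0.
rewrite addn0.
have -> : nseq (n - m) (1 - up_prob t) = nseq m (1 - up_prob t).
  by congr nseq; rewrite -nE add0n -addnn addKn.
by rewrite -pair_polyX pair_poly_coef -up_prob_var mulr2n mulrDl mul1r.
Qed.
End Tilted.

(** * Derivatives and hyperbolic functions *)

Section Calculus.
Variable R : realType.
Implicit Types (f g : R -> R) (x a b : R).

(** The structural rules below leave the derivative in a raw form; [der_eq] separates
    the differentiation from the simplification of the result. *)
Definition has_der f x a := is_derive x (1 : R) f a.

Lemma der_eq f x a b : has_der f x a -> a = b -> has_der f x b.
Proof. by move=> h <-. Qed.

Lemma der_cst c x : has_der (fun _ => c) x 0.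
Proof. exact: is_derive_cst. Qed.

Lemma der_id x : has_der (fun y => y) x 1.
Proof. exact: is_derive_id. Qed.

Lemma der_add f g x a b : has_der f x a -> has_der g x b ->
  has_der (fun y => f y + g y) x (a + b).
Proof. exact: is_deriveD. Qed.

Lemma der_opp f x a : has_der f x a -> has_der (fun y => - f y) x (- a).
Proof. exact: is_deriveN. Qed.

Lemma der_mul f g x a b : has_der f x a -> has_der g x b ->
  has_der (fun y => f y * g y) x (a * g x + f x * b).
Proof.
move=> fa gb; have : has_der (f * g) x (f x *: b + g x *: a) by exact: is_deriveM.
by move=> h; apply: der_eq h _; rewrite /GRing.scale/= addrC (mulrC a).
Qed.

Lemma der_exp n f x a : has_der f x a ->
  has_der (fun y => f y ^+ n) x (n%:R * f x ^+ n.-1 * a).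
Proof.
move=> fa; have h : has_der (f ^+ n) x ((n%:R * f x ^+ n.-1) *: a) by exact: is_deriveX.
suff -> : (fun y => f y ^+ n) = f ^+ n by [].
by apply/funext => y; elim: n {h} => [|n ih]; rewrite ?expr0// !exprS ih.
Qed.

Lemma der_comp f g x a b : has_der f x a -> has_der g (f x) b ->
  has_der (fun y => g (f y)) x (a * b).
Proof.
by move=> fa gb; rewrite mulrC; exact: (@is_derive1_comp _ g f x b a). Qed.

Lemma der_inv f x a : f x != 0 -> has_der f x a ->
  has_der (fun y => (f y)^-1) x (- a / f x ^+ 2).
Proof.
move=> fx fa; apply: der_eq (is_deriveV fx fa) _.
by rewrite /GRing.scale/= !mulNr mulrC.
Qed.

Lemma der_expR f x a : has_der f x a ->
  has_der (fun y => expR (f y)) x (a * expR (f x)).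
Proof. by move=> fa; apply: der_comp fa _; exact: is_derive_expR. Qed.

Lemma der_sin f x a : has_der f x a ->
  has_der (fun y => sin (f y)) x (a * cos (f x)).
Proof. by move=> fa; apply: der_comp fa _; exact: is_derive_sin. Qed.

Lemma der_cos f x a : has_der f x a ->
  has_der (fun y => cos (f y)) x (a * - sin (f x)).
Proof. by move=> fa; apply: der_comp fa _; exact: is_derive_cos. Qed.

Lemma der_atan f x a : has_der f x a ->
  has_der (fun y => atan (f y)) x (a * (1 + f x ^+ 2)^-1).
Proof. by move=> fa; apply: der_comp fa _; exact: is_derive1_atan. Qed.

Lemma der_ln f x a : 0 < f x -> has_der f x a ->
  has_der (fun y => ln (f y)) x (a * (f x)^-1).
Proof. by move=> fx fa; apply: der_comp fa _; exact: is_derive1_ln. Qed.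

Lemma der_cont f (df : R -> R) : (forall x, has_der f x (df x)) -> continuous f.
Proof.
by move=> h x; apply/differentiable_continuous/derivable1_diffP; case: (h x).
Qed.

Lemma der_MVT f (df : R -> R) a b : a < b -> (forall x, has_der f x (df x)) ->
  exists2 c, a < c < b & f b - f a = df c * (b - a).
Proof.
move=> ab h; have [|c + e] := @MVT R f df a b ab (fun x _ => h x).
  by apply/continuous_subspaceT/(der_cont h).
by rewrite in_itv/= => ?; exists c.
Qed.

Lemma der_ge0_le f (df : R -> R) a b : a <= b -> (forall x, has_der f x (df x)) ->
  (forall x, a < x < b -> 0 <= df x) -> f a <= f b.
Proof.
rewrite le_eqVlt => /predU1P[->//|ab] h df0; have [c cab e] := der_MVT ab h.
by rewrite -subr_ge0 e mulr_ge0 ?df0// subr_ge0 ltW.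
Qed.

End Calculus.

(* Differentiates by structural rules, the derivative being an existential variable. *)
Ltac der := repeat first
  [ exact: der_cst | exact: der_id | eassumption | eapply der_opp | eapply der_add
  | eapply der_exp | eapply der_mul | eapply der_expR | eapply der_sin
  | eapply der_cos | eapply der_atan ].

Section Hyperbolic.
Variable R : realType.
Implicit Types (f : R -> R) (x a : R).

Lemma der_sinh f x a : has_der f x a ->
  has_der (fun y => sinh (f y)) x (a * cosh (f x)).
Proof.
by move=> fa; rewrite /sinh; apply: der_eq; [der|rewrite /cosh; field].
Qed.

Lemma der_cosh f x a : has_der f x a ->
  has_der (fun y => cosh (f y)) x (a * sinh (f x)).
Proof.
by move=> fa; rewrite /cosh; apply: der_eq; [der|rewrite /sinh; field].
Qed.

Lemma cosh2_sinh2 x : cosh x ^+ 2 - sinh x ^+ 2 = 1.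
Proof.
have e1 : expR x * expR (- x) = 1 by rewrite -expRD subrr expR0.
have -> : cosh x ^+ 2 - sinh x ^+ 2 = expR x * expR (- x) by rewrite /cosh /sinh; field.
exact: e1.
Qed.

Lemma cosh_ge1 x : 1 <= cosh x.
Proof.
rewrite -(@ler_pXn2r _ 2)// ?nnegrE ?(ltW (cosh_gt0 _))// expr1n.
by rewrite -(cosh2_sinh2 x) lerBlDr lerDl sqr_ge0.
Qed.

Lemma coshN x : cosh (- x) = cosh x.
Proof. by rewrite /cosh opprK addrC. Qed.

Lemma sinh0 : sinh 0 = 0 :> R.
Proof. by rewrite /sinh oppr0 subrr mul0r. Qed.

Lemma cosh0 : cosh 0 = 1 :> R.
Proof. by rewrite /cosh oppr0 expR0 -mulr2n -mulr_natl divff. Qed.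

Lemma tanh0 : tanh 0 = 0 :> R.
Proof. by rewrite /tanh sinh0 mul0r. Qed.

Lemma sinh_ge0 x : 0 <= x -> 0 <= sinh x.
Proof.
move=> x0; rewrite /sinh divr_ge0// subr_ge0 ler_expR.
by rewrite (@le_trans _ _ 0)// oppr_le0.
Qed.

Lemma der_tanh f x a : has_der f x a ->
  has_der (fun y => tanh (f y)) x (a * (1 - tanh (f x) ^+ 2)).
Proof.
move=> fa; have c0 : cosh (f x) != 0 by rewrite gt_eqF// cosh_gt0.
rewrite /tanh; apply: der_eq.
  by apply: der_mul; [exact: der_sinh fa|apply: der_inv => //; exact: der_cosh fa].
by move: (cosh (f x)) (sinh (f x)) c0 => C S c0 /=; field.
Qed.

Lemma cosh_tanh x : (1 - tanh x ^+ 2) = cosh x ^- 2.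
Proof.
have c0 : cosh x != 0 by rewrite gt_eqF// cosh_gt0.
by rewrite /tanh expr_div_n; apply: (mulIf (expf_neq0 2 c0));
  rewrite mulVf ?expf_neq0// mulrBl mul1r divfK ?expf_neq0// cosh2_sinh2.
Qed.

Lemma tanh_ge0 x : 0 <= x -> 0 <= tanh x.
Proof. by move=> x0; rewrite divr_ge0 ?sinh_ge0// ltW// cosh_gt0. Qed.

Lemma tanh2_lt1 x : tanh x ^+ 2 < 1.
Proof. by rewrite -subr_gt0 cosh_tanh invr_gt0 exprn_gt0// cosh_gt0. Qed.

Lemma ltr_tanh : {homo @tanh R : x y / x < y}.
Proof.
move=> x y xy; have [c _ e] := der_MVT xy (fun z => der_tanh (der_id z)).
by rewrite -subr_gt0 e mul1r mulr_gt0 ?subr_gt0// tanh2_lt1.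
Qed.

Lemma ler_tanh x y : x <= y -> tanh x <= tanh y.
Proof. by rewrite le_eqVlt => /predU1P[->//|/ltr_tanh/ltW]. Qed.

End Hyperbolic.

Ltac der ::= repeat first
  [ exact: der_cst | exact: der_id | eassumption | eapply der_cosh
  | eapply der_sinh | eapply der_tanh | eapply der_opp | eapply der_add
  | eapply der_exp | eapply der_mul | eapply der_expR | eapply der_sin
  | eapply der_cos | eapply der_atan ].

Section FTC.
Variable R : realType.
Notation mu := (@lebesgue_measure R).

Lemma FTC_Rintegral (f F : R -> R) (a b : R) : a < b -> continuous f ->
  (forall x, has_der F x (f x)) ->
  \int[mu]_(x in `[a, b]) f x = F b - F a.
Proof.
move=> ab cf dF; rewrite /Rintegral.
have cF := der_cont dF.
rewrite (@continuous_FTC2 _ f F)//.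
- exact: continuous_subspaceT.
- split; first by move=> x _; case: (dF x).
  + exact/cvg_at_right_filter/cF.
  + exact/cvg_at_left_filter/cF.
- by move=> x _; rewrite derive1E; case: (dF x).
Qed.

Lemma continuous_itv_integrable (f : R -> R) (a b : R) : continuous f ->
  mu.-integrable `[a, b] (EFin \o f).
Proof.
move=> cf; apply: continuous_compact_integrable; first exact: segment_compact.
exact: continuous_subspaceT.
Qed.

End FTC.

(** * Wallis integrals and central binomial coefficients *)

Section Wallis.
Variable R : realType.
Notation mu := (@lebesgue_measure R).

Definition wallis (n : nat) : R := \int[mu]_(x in `[0, pi / 2]) sin x ^+ n.

Let pi2_gt0 : 0 < pi / 2 :> R.
Proof. by rewrite divr_gt0// pi_gt0. Qed.

Let continuous_sinX n : continuous (fun x : R => sin x ^+ n).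
Proof.
by apply: der_cont => x; der.
Qed.

(** The difference of the two sides is the integral of the derivative of
    [- (cos x * sin x ^+ n.+1)], which vanishes at both ends. *)
Lemma wallisSS n : n.+2%:R * wallis n.+2 = n.+1%:R * wallis n.
Proof.
apply/eqP; rewrite -subr_eq0; apply/eqP.
rewrite -!RintegralZl//; try exact: continuous_itv_integrable.
have cZ (k : R) m : continuous (fun x : R => k * sin x ^+ m).
  by apply: der_cont => x; der.
rewrite -RintegralB//; try exact: continuous_itv_integrable.
rewrite (@FTC_Rintegral _ _ (fun x => - (cos x * sin x ^+ n.+1)))//.
- by rewrite cos_pihalf sin0 mul0r expr0n/= mulr0 subrr.
- by apply: der_cont => x; der.
- move=> x; apply: der_eq; first by der.
  have s2 : cos x ^+ 2 = 1 - sin x ^+ 2 by rewrite -(cos2Dsin2 x) addrK.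
  transitivity (sin x * sin x ^+ n.+1 - n.+1%:R * sin x ^+ n * cos x ^+ 2).
    by rewrite /=; ring.
  by rewrite s2 !exprS -!natr1; ring.
Qed.

Lemma wallis0 : wallis 0 = pi / 2.
Proof.
rewrite /wallis (@FTC_Rintegral _ _ id) ?subr0 => //.
by move=> x; rewrite expr0; exact: der_id.
Qed.

Lemma wallis1 : wallis 1 = 1.
Proof.
rewrite /wallis (@FTC_Rintegral _ _ (fun x => - cos x)) => //.
- by rewrite cos_pihalf cos0 oppr0 opprK add0r.
- by move=> x; apply: der_eq; [der|rewrite mul1r opprK expr1].
Qed.

Lemma wallis_nincr n : wallis n.+1 <= wallis n.
Proof.
apply: le_Rintegral => //; try exact: continuous_itv_integrable.
move=> x /=; rewrite in_itv/= => /andP[x0 x1].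
have s0 : 0 <= sin x.
  by apply: sin_ge0_pi; rewrite x0/= (le_trans x1)// ler_pdivrMr// ler_peMr// ?pi_ge0// ler1n.
by rewrite exprS ler_piMl ?exprn_ge0// sin_le1.
Qed.

Lemma central_binS N : N.+1.*2%:R * central_bin R N.+1 = N.*2.+1%:R * central_bin R N.
Proof.
rewrite /central_bin.
have : (N.+1 * 'C(N.+1.*2, N.+1) = 2 * (N.*2.+1) * 'C(N.*2, N))%N.
  have h1 : (N.+1.*2 * 'C(N.*2.+1, N) = _)%N := mul_bin_diag N.+1.*2 N.
  have h2 : (N.*2.+1 * 'C(N.*2, N) = _)%N := mul_bin_diag N.*2.+1 N.
  have h3 : 'C(N.*2.+1, N) = 'C(N.*2.+1, N.+1).
    by rewrite -bin_sub -?addnn ?leqW ?leq_addr// -addnS addKn.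
  by rewrite -h1 h3 -mul2n -mulnA -h2 mulnA.
move=> h; have {}h : N.+1%:R * 'C(N.+1.*2, N.+1)%:R = 2 * N.*2.+1%:R * 'C(N.*2, N)%:R :> R.
  by rewrite -!natrM h.
have e : N.+1.*2%:R = 2 * N.+1%:R :> R by rewrite -natrM mul2n.
have f0 : (4 : R) ^+ N != 0 by rewrite expf_neq0.
rewrite e exprS [LHS](_ : _ = 2 * (N.+1%:R * 'C(N.+1.*2, N.+1)%:R) / (4 * 4 ^+ N)); last by field.
by rewrite h; field.
Qed.

Lemma wallis_even N : wallis N.*2 = pi / 2 * central_bin R N.
Proof.
elim: N => [|N ih]; first by rewrite wallis0 /central_bin bin0 expr0 divr1 mulr1.
have e : N.+1.*2%:R != 0 :> R by rewrite pnatr_eq0.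
apply: (mulfI e); rewrite doubleS wallisSS ih -doubleS mulrCA [RHS]mulrCA.
by rewrite central_binS.
Qed.

Lemma central_bin_gt0 N : 0 < central_bin R N.
Proof.
rewrite /central_bin divr_gt0// ?exprn_gt0// ltr0n bin_gt0 -addnn leq_addr//.
Qed.

Lemma wallis_odd N : N.*2.+1%:R * wallis N.*2.+1 * central_bin R N = 1.
Proof.
elim: N => [|N ih]; first by rewrite wallis1 /central_bin bin0 expr0 divr1 !mulr1.
have e : N.+1.*2%:R != 0 :> R by rewrite pnatr_eq0.
apply: (mulfI e).
rewrite mulrCA central_binS doubleS wallisSS -doubleS mulr1.
have -> : N.+1.*2%:R * wallis N.*2.+1 * (N.*2.+1%:R * central_bin R N) =
  N.+1.*2%:R * (N.*2.+1%:R * wallis N.*2.+1 * central_bin R N) by ring.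
by rewrite ih mulr1.
Qed.

(** This is [wallis N.*2.+1 <= wallis N.*2], both sides being expressed through
    [central_bin R N]. *)
Lemma central_bin_ge N : (pi * (N%:R + 1 / 2)) ^-1 <= central_bin R N ^+ 2.
Proof.
have c0 := central_bin_gt0 N.
have := wallis_nincr N.*2; rewrite wallis_even => h.
have o := wallis_odd N.
have pi0 := pi_gt0 R.
have p1 : 0 < N.*2.+1%:R :> R by rewrite ltr0n.
have E : N%:R + 1 / 2 = N.*2.+1%:R / 2 :> R by rewrite -[N.*2.+1%:R]natr1 -mul2n natrM; field.
rewrite E -div1r ler_pdivrMr ?mulr_gt0// -{1}o.
have -> : central_bin R N ^+ 2 * (pi * (N.*2.+1%:R / 2)) =
  N.*2.+1%:R * (pi / 2 * central_bin R N) * central_bin R N by field.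
by rewrite ler_pM2r// ler_pM2l.
Qed.

(** This is [wallis N.*2.+2 <= wallis N.*2.+1]. The bound is stated in [N + 1] because
    the binomial means of [1 / N.+1] and of its square have simple bounds. *)
Lemma central_bin_le N :
  central_bin R N ^+ 2 <= (1 + (N%:R + 1)^-1) ^+ 2 / (pi * (N%:R + 1)).
Proof.
have c0 := central_bin_gt0 N.
have := wallis_nincr N.*2.+1; rewrite -doubleS wallis_even => h.
have o := wallis_odd N.
have pi0 := pi_gt0 R.
have N0 : 0 <= N%:R :> R by [].
have E1 : N.*2.+1%:R = 2 * N%:R + 1 :> R by rewrite -[N.*2.+1%:R]natr1 -mul2n natrM.
have E2 : N.+1.*2%:R = 2 * (N%:R + 1) :> R by rewrite -muln2 natrM -[N.+1%:R]natr1 mulrC.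
have cS := central_binS N; rewrite E1 E2 in cS o.
set x := N%:R in N0 E1 E2 cS o *.
set c := central_bin R N in c0 cS o *; set c' := central_bin R N.+1 in cS h *.
set w := wallis _ in h o *.
clearbody x c c' w.
move: (pi : R) pi0 h => p pi0 h.
have x1 : 0 < x + 1 by lra.
have x2 : 0 < 2 * x + 1 by lra.
have c'E : c' = (2 * x + 1) * c / (2 * (x + 1)).
  by rewrite -cS mulrC mulKf// mulf_neq0// gt_eqF.
have wE : w = ((2 * x + 1) * c)^-1.
  have n0 : (2 * x + 1) * c != 0 by rewrite gt_eqF// mulr_gt0.
  by apply: (mulIf n0); rewrite mulVf// -[RHS]o; ring.
have {h}h : c ^+ 2 <= 4 * (x + 1) / (p * (2 * x + 1) ^+ 2).
  rewrite ler_pdivlMr ?mulr_gt0 ?exprn_gt0//.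
  move: h; rewrite wE c'E -[X in _ <= X]div1r ler_pdivlMr ?mulr_gt0// => h.
  have -> : c ^+ 2 * (p * (2 * x + 1) ^+ 2) = 4 * (x + 1) * (p / 2 * ((2 * x + 1) * c / (2 * (x + 1))) * ((2 * x + 1) * c)).
    by field; rewrite gt_eqF.
  by rewrite -[leRHS]mulr1 ler_pM2l ?mulr_gt0.
apply: le_trans h _.
rewrite ler_pdivrMr ?mulr_gt0 ?exprn_gt0//.
have -> : (1 + (x + 1)^-1) ^+ 2 / (p * (x + 1)) * (p * (2 * x + 1) ^+ 2) =
   ((x + 2) * (2 * x + 1)) ^+ 2 / (x + 1) ^+ 3.
  by field; rewrite (gt_eqF x1) (gt_eqF pi0).
rewrite ler_pdivlMr ?exprn_gt0//.
have -> : 4 * (x + 1) * (x + 1) ^+ 3 = (2 * (x + 1) ^+ 2) ^+ 2 by ring.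
rewrite ler_pXn2r// ?nnegrE ?mulr_ge0 ?sqr_ge0//; lra.
Qed.

End Wallis.

(** * Asymptotics of the balanced coefficient *)

Section BalancedAsymptotics.
Variable R : realType.
Implicit Types (a x y : R) (m N : nat).

Definition binw m a (N : nat) : R := 'C(m, N)%:R * a ^+ N * (1 - a) ^+ (m - N).

Lemma balE m a : bal m a = \sum_(N < m.+1) binw m a N * central_bin R N.
Proof. by []. Qed.

Lemma binw_sum1 m a : \sum_(N < m.+1) binw m a N = 1.
Proof.
have := exprDn (1 - a) a m; rewrite subrK expr1n => ->.
by apply: eq_bigr => i _; rewrite /binw -[RHS]mulr_natl; ring.
Qed.

Section a01.
Variable a : R.
Hypothesis a0 : 0 < a.
Hypothesis a1 : a <= 1.

Lemma binw_ge0 m N : 0 <= binw m a N.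
Proof. by rewrite /binw !mulr_ge0// exprn_ge0 ?subr_ge0// ltW. Qed.

Lemma binw_mulS m N : m.+1%:R * a * binw m a N = N.+1%:R * binw m.+1 a N.+1.
Proof.
have h : m.+1%:R * 'C(m, N)%:R = N.+1%:R * 'C(m.+1, N.+1)%:R :> R.
  by rewrite -!natrM (mul_bin_diag m.+1).
rewrite /binw exprS subSS.
rewrite [LHS](_ : _ = (m.+1%:R * 'C(m, N)%:R) * (a * a ^+ N * (1 - a) ^+ (m - N))); last by ring.
by rewrite h; ring.
Qed.

(** The absorption identity [binw_mulS] turns the sum into a partial sum of the
    binomial distribution of size [m.+1]. *)
Lemma binw_inv1 m : \sum_(N < m.+1) binw m a N / N.+1%:R <= (m.+1%:R * a)^-1.
Proof.
have ma : 0 < m.+1%:R * a by rewrite mulr_gt0.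
rewrite -(ler_pM2l ma) divff ?gt_eqF// mulr_sumr -[leRHS](binw_sum1 m.+1 a).
rewrite [leRHS]big_ord_recl/= ler_wpDl ?binw_ge0//; apply: ler_sum => i _.
by rewrite mulrA binw_mulS mulrC mulKf// pnatr_eq0.
Qed.

Lemma binw_mean m : \sum_(N < m.+1) binw m a N * N%:R = m%:R * a.
Proof.
case: m => [|m]; first by rewrite big_ord_recl big_ord0 mulr0 addr0 mul0r.
rewrite big_ord_recl mulr0 add0r.
rewrite -[RHS]mulr1 -[X in _ = _ * X](binw_sum1 m a) mulr_sumr; apply: eq_bigr => i _.
by rewrite binw_mulS mulrC.
Qed.

Lemma binw_inv2 m : (0 < m)%N ->
  \sum_(N < m.+1) binw m a N / N.+1%:R ^+ 2 <= 2 / (m%:R * a) ^+ 2.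
Proof.
move=> m0.
apply: (@le_trans _ _ (2 * (\sum_(N < m.+1) binw m a N / (N.+1%:R * N.+2%:R)))).
  rewrite mulr_sumr; apply: ler_sum => N _; rewrite mulrCA ler_wpM2l ?binw_ge0//.
  rewrite ler_pdivlMr ?mulr_gt0// mulrC ler_pdivrMr ?exprn_gt0// expr2 mulrCA ler_pM2l//.
  by rewrite -natrM ler_nat mul2n -addnn addSnnS leq_addl.
rewrite ler_pM2l//.
have ma : 0 < m.+1%:R * a by rewrite mulr_gt0.
have ma' : 0 < m.+2%:R * a by rewrite mulr_gt0.
apply: (@le_trans _ _ ((m.+1%:R * a) * (m.+2%:R * a))^-1).
  rewrite -(ler_pM2l (mulr_gt0 ma ma')) divff ?gt_eqF ?mulr_gt0// mulr_sumr.
  rewrite -[leRHS](binw_sum1 m.+2 a).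
  rewrite [leRHS]big_ord_recl ler_wpDl ?binw_ge0//.
  rewrite [leRHS]big_ord_recl ler_wpDl ?binw_ge0//.
  apply: ler_sum => i _.
  have -> : m.+1%:R * a * (m.+2%:R * a) * (binw m a i / (i.+1%:R * i.+2%:R))
    = m.+2%:R * a * (m.+1%:R * a * binw m a i) / (i.+1%:R * i.+2%:R) by ring.
  have i1 : i.+1%:R != 0 :> R by rewrite pnatr_eq0.
  have i2 : i.+2%:R != 0 :> R by rewrite pnatr_eq0.
  rewrite binw_mulS.
  have -> : m.+2%:R * a * (i.+1%:R * binw m.+1 a i.+1) / (i.+1%:R * i.+2%:R) =
    m.+2%:R * a * binw m.+1 a i.+1 / i.+2%:R.
    by move: (i.+1%:R : R) (i.+2%:R : R) i1 i2 => u v i1 i2; field; rewrite i1 i2.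
  by rewrite binw_mulS mulrC mulKf.
have m0' : 0 < m%:R :> R by rewrite ltr0n.
rewrite lef_pV2 ?posrE ?exprn_gt0 ?mulr_gt0//.
rewrite expr2 ler_pM ?mulr_ge0 ?ler0n ?(ltW a0)// ler_pM2r// ler_nat//.
exact: (leqW (leqnSn m)).
Qed.

(** The arithmetic-geometric inequality for [1] and [y / x]; it trades the inverse
    square root for an inverse, whose binomial mean is known. *)
Lemma isqrt_le x y : 0 < x -> 0 < y ->
  (Num.sqrt x)^-1 <= (Num.sqrt y)^-1 * (1 + y / x) / 2.
Proof.
move=> x0 y0.
rewrite -[in y / x](sqr_sqrtr (ltW x0)) -[in y / _](sqr_sqrtr (ltW y0)).
have : 0 < Num.sqrt x by rewrite sqrtr_gt0.
have : 0 < Num.sqrt y by rewrite sqrtr_gt0.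
move: (Num.sqrt x) (Num.sqrt y) => u w w0 u0.
rewrite -subr_ge0.
have -> : w^-1 * (1 + w ^+ 2 / u ^+ 2) / 2 - u^-1 = (u - w) ^+ 2 / (2 * w * u ^+ 2).
  by field; rewrite !gt_eqF.
by rewrite divr_ge0 ?sqr_ge0// !mulr_ge0 ?sqr_ge0// ltW.
Qed.

(** The tangent at [y] to the convex function [x ^ (-1/2)]. *)
Lemma isqrt_ge x y : 0 < x -> 0 < y ->
  (Num.sqrt y)^-1 * (3 / 2 - x / (2 * y)) <= (Num.sqrt x)^-1.
Proof.
move=> x0 y0.
rewrite -[in x / _](sqr_sqrtr (ltW x0)) -[in _ / (2 * y)](sqr_sqrtr (ltW y0)).
have : 0 < Num.sqrt x by rewrite sqrtr_gt0.
have : 0 < Num.sqrt y by rewrite sqrtr_gt0.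
move: (Num.sqrt x) (Num.sqrt y) => u w w0 u0.
rewrite -subr_ge0.
have -> : u^-1 - w^-1 * (3 / 2 - u ^+ 2 / (2 * w ^+ 2)) =
  (w - u) ^+ 2 * (2 * w + u) / (2 * u * w ^+ 3).
  by field; rewrite !gt_eqF.
apply: divr_ge0; apply: mulr_ge0; rewrite ?sqr_ge0//; try lra.
by apply: exprn_ge0; lra.
Qed.

Lemma central_bin_lower N :
  (Num.sqrt (pi * (N%:R + 1 / 2)))^-1 <= central_bin R N.
Proof.
have h := @central_bin_ge R N; have c0 := @central_bin_gt0 R N.
have x0 : 0 < pi * (N%:R + 1 / 2) :> R by rewrite mulr_gt0 ?pi_gt0// ltr_wpDl.
rewrite -(@ler_pXn2r _ 2)// ?nnegrE ?invr_ge0 ?sqrtr_ge0 ?(ltW c0)//.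
by rewrite exprVn sqr_sqrtr ?(ltW x0).
Qed.

Lemma central_bin_upper N :
  central_bin R N <= (1 + (N.+1%:R)^-1) / Num.sqrt (pi * N.+1%:R).
Proof.
have h := @central_bin_le R N; have c0 := @central_bin_gt0 R N.
rewrite natr1 in h.
have x0 : 0 < pi * N.+1%:R :> R by rewrite mulr_gt0 ?pi_gt0.
rewrite -(@ler_pXn2r _ 2)// ?nnegrE ?divr_ge0 ?sqrtr_ge0 ?(ltW c0)//.
  by rewrite [leRHS]expr_div_n sqr_sqrtr ?(ltW x0).
Qed.

(** Jensen's inequality for [x ^ (-1/2)], with the tangent taken at the mean of
    [N + 1 / 2]. *)
Lemma bal_lower m : (Num.sqrt (pi * (m%:R * a + 1 / 2)))^-1 <= bal m a.
Proof.
have y0 : 0 < m%:R * a + 1 / 2 by rewrite ltr_wpDl// mulr_ge0// ltW.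
rewrite balE sqrtrM ?pi_ge0// invfM.
set y := m%:R * a + 1 / 2 in y0 *.
apply: (@le_trans _ _ (\sum_(N < m.+1) binw m a N *
   ((Num.sqrt pi)^-1 * ((Num.sqrt y)^-1 * (3 / 2 - (N%:R + 1 / 2) / (2 * y)))))).
  have -> : \sum_(N < m.+1) binw m a N *
   ((Num.sqrt pi)^-1 * ((Num.sqrt y)^-1 * (3 / 2 - (N%:R + 1 / 2) / (2 * y)))) =
   (Num.sqrt pi)^-1 * (Num.sqrt y)^-1 * ((3 / 2 - 1 / 2 / (2 * y)) * \sum_(N < m.+1) binw m a N
     - (2 * y)^-1 * \sum_(N < m.+1) binw m a N * N%:R).
    rewrite !mulr_sumr -sumrB mulr_sumr; apply: eq_bigr => N _.
    have aux (B n u w z : R) : z != 0 ->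
        B * (u * (w * (3 / 2 - (n + 1 / 2) / (2 * z)))) =
        u * w * ((3 / 2 - 1 / 2 / (2 * z)) * B - (2 * z)^-1 * (B * n)).
      by move=> z0; field.
    by apply: aux; rewrite gt_eqF.
  rewrite binw_sum1 binw_mean.
  have -> : (3 / 2 - 1 / 2 / (2 * y)) * 1 - (2 * y)^-1 * (m%:R * a) = 1.
    rewrite (_ : m%:R * a = y - 1 / 2); last by rewrite /y addrK.
    by clearbody y; field; rewrite gt_eqF.
  by rewrite mulr1.
apply: ler_sum => N _; rewrite ler_wpM2l ?binw_ge0//.
apply: le_trans (central_bin_lower N).
rewrite sqrtrM ?pi_ge0// [leRHS]invfM ler_wpM2l ?invr_ge0 ?sqrtr_ge0//.
by apply: isqrt_ge => //; rewrite ltr_wpDl.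
Qed.

(** Same idea from above: [isqrt_le] around the mean and the inverse moments
    [binw_inv1] and [binw_inv2]. *)
Lemma bal_upper m : (0 < m)%N ->
  bal m a <= (1 + 2 / (m%:R * a)) / Num.sqrt (pi * (m%:R * a)).
Proof.
move=> m0; have m0' : 0 < m%:R :> R by rewrite ltr0n.
have y0 : 0 < m%:R * a by rewrite mulr_gt0.
set y := m%:R * a in y0 *.
rewrite balE sqrtrM ?pi_ge0// [X in _ <= _ * X]invfM.
have p0 : 0 < (Num.sqrt pi)^-1 :> R by rewrite invr_gt0 sqrtr_gt0 pi_gt0.
have q0 : 0 < (Num.sqrt y)^-1 by rewrite invr_gt0 sqrtr_gt0.
apply: (@le_trans _ _ (\sum_(N < m.+1) binw m a N *
   ((1 + (N.+1%:R)^-1) * ((Num.sqrt pi)^-1 * ((Num.sqrt y)^-1 * (1 + y / N.+1%:R) / 2))))).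
  apply: ler_sum => N _; rewrite ler_wpM2l ?binw_ge0//.
  apply: le_trans (central_bin_upper N) _.
  rewrite ler_wpM2l ?addr_ge0 ?invr_ge0// sqrtrM ?pi_ge0// [X in X <= _]invfM ler_pM2l//.
  exact: isqrt_le.
have -> : \sum_(N < m.+1) binw m a N *
   ((1 + (N.+1%:R)^-1) * ((Num.sqrt pi)^-1 * ((Num.sqrt y)^-1 * (1 + y / N.+1%:R) / 2))) =
  ((Num.sqrt pi)^-1 * (Num.sqrt y)^-1) * ((\sum_(N < m.+1) binw m a N
    + (1 + y) * (\sum_(N < m.+1) binw m a N / N.+1%:R)
    + y * (\sum_(N < m.+1) binw m a N / N.+1%:R ^+ 2)) / 2).
  rewrite !mulr_sumr -!big_split/= mulr_suml mulr_sumr; apply: eq_bigr => N _.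
  have n0 : N.+1%:R != 0 :> R by rewrite pnatr_eq0.
  move: (N.+1%:R : R) ((Num.sqrt pi)^-1 : R) ((Num.sqrt y)^-1 : R) n0 => M u w n0.
  by field.
rewrite mulrC ler_pM2r ?mulr_gt0// ler_pdivrMr// binw_sum1.
have h1 : \sum_(N < m.+1) binw m a N / N.+1%:R <= y^-1.
  apply: le_trans (binw_inv1 m) _.
  by rewrite lef_pV2 ?posrE ?mulr_gt0// ler_pM2r// ler_nat.
have h2 := binw_inv2 m0; rewrite -/y in h2.
have h1' : (1 + y) * \sum_(N < m.+1) binw m a N / N.+1%:R <= (1 + y) / y.
  by rewrite ler_pM2l// ltr_wpDl.
have h2' : y * (\sum_(N < m.+1) binw m a N / N.+1%:R ^+ 2) <= y * (2 / y ^+ 2).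
  by rewrite ler_pM2l.
apply: le_trans (lerD (lerD (lexx _) h1') h2') _.
rewrite -subr_ge0.
have -> : (1 + 2 / y) * 2 - (1 + (1 + y) / y + y * (2 / y ^+ 2)) = y^-1.
  by clearbody y; field; rewrite gt_eqF.
by rewrite invr_ge0 ltW.
Qed.

Lemma bal_ge0 m : 0 <= bal m a.
Proof.
by rewrite balE sumr_ge0// => N _; rewrite mulr_ge0 ?binw_ge0// ltW// central_bin_gt0.
Qed.

Lemma central_bin_le1 N : central_bin R N <= 1.
Proof.
elim: N => [|N ih]; first by rewrite /central_bin bin0 expr0 divr1.
rewrite -(ler_pM2l (_ : 0 < N.+1.*2%:R)) ?ltr0n// central_binS mulr1.
apply: le_trans (_ : N.*2.+1%:R <= _); first by rewrite ler_piMr.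
by rewrite ler_nat doubleS.
Qed.

Lemma bal_le1 m : bal m a <= 1.
Proof.
rewrite balE -[leRHS](binw_sum1 m a) ler_sum// => N _.
by rewrite ler_piMr ?binw_ge0// central_bin_le1.
Qed.

End a01.

Lemma cosh_inv2 (t : R) : (0 < cosh t ^- 2) /\ (cosh t ^- 2 <= 1).
Proof.
have c0 := cosh_gt0 t; have c1 := cosh_ge1 t; split.
  by rewrite invr_gt0 exprn_gt0.
by rewrite invf_le1 ?exprn_gt0// exprn_ege1.
Qed.

Lemma bal_cosh m (t : R) : (0 < m)%N ->
  `|Num.sqrt (pi * m%:R) * bal m (cosh t ^- 2) - cosh t| <= 2 * cosh t ^+ 3 / m%:R.
Proof.
move=> m0; have m0' : 0 < m%:R :> R by rewrite ltr0n.
have [a0 a1] := cosh_inv2 t.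
have c0 := cosh_gt0 t; have c1 := cosh_ge1 t.
have := bal_upper a0 a1 m0; have := bal_lower a0 a1 m.
set b := bal _ _; set C := cosh t in a0 a1 c0 c1 *.
have y0 : 0 < m%:R * C ^- 2 by rewrite mulr_gt0.
have sE : Num.sqrt (pi * (m%:R * C ^- 2)) = Num.sqrt (pi * m%:R) / C.
  by rewrite mulrA sqrtrM ?mulr_ge0 ?pi_ge0// -exprVn sqrtr_sqr gtr0_norm// invr_gt0.
have s0 : 0 < Num.sqrt (pi * m%:R) :> R by rewrite sqrtr_gt0 mulr_gt0// pi_gt0.
move=> lo; rewrite sE => up.
have {}lo : C / Num.sqrt (pi * m%:R) * (1 - C ^+ 2 / (4 * m%:R)) <= b.
  apply: le_trans lo.
  have x0 : 0 < pi * (m%:R * C ^- 2 + 1 / 2) by rewrite mulr_gt0 ?pi_gt0// addr_gt0.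
  have z0 : 0 < pi * (m%:R * C ^- 2) by rewrite mulr_gt0 ?pi_gt0.
  apply: le_trans (isqrt_ge x0 z0); rewrite sE invf_div ler_pM2l; last exact: divr_gt0.
  rewrite le_eqVlt; apply/orP; left; apply/eqP.
  have := pi_gt0 R; move: (pi : R) => p p0.
  by field; rewrite !gt_eqF.
clearbody b C; move: (Num.sqrt (pi * m%:R)) s0 lo up => s s0 lo up.
rewrite ler_norml; apply/andP; split.
  rewrite -(ler_pM2l s0) in lo.
  apply: le_trans (lerB lo (lexx C)).
  have -> : s * (C / s * (1 - C ^+ 2 / (4 * m%:R))) - C = - (C ^+ 3 / m%:R / 4).
    by field; rewrite !gt_eqF.
  have u0 : 0 <= C ^+ 3 / m%:R by rewrite divr_ge0 ?exprn_ge0 ?ltW.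
  by rewrite lerN2 -[leRHS]mulrA; lra.
rewrite -(ler_pM2l s0) in up; apply: le_trans (lerB up (lexx C)) _.
rewrite le_eqVlt; apply/orP; left; apply/eqP.
by field; rewrite !gt_eqF.
Qed.

(** In the odd case the correction is a difference of two quantities with the same
    leading term, so that dividing it by [cosh t ^- 2] costs only two powers of
    [cosh t]. *)
Lemma bal_low_cosh n (t : R) : (1 < n)%N ->
  `|Num.sqrt (pi * n./2%:R) * bal_low n (cosh t ^- 2) - cosh t|
  <= 7 * cosh t ^+ 5 / n./2%:R.
Proof.
move=> n1; have m0 : (0 < n./2)%N by rewrite half_gt0.
have c1 := cosh_ge1 t; have c0 := cosh_gt0 t.
rewrite /bal_low; set m := n./2 in m0 *.
have m0' : 0 < m%:R :> R by rewrite ltr0n.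
have h := bal_cosh t m0; have h' := bal_cosh t (ltn0Sn m).
set b := bal m _ in h *; set b' := bal m.+1 _ in h' *; set C := cosh t in c0 c1 h h' *.
case: ifP => _; last first.
  apply: le_trans h _; rewrite ler_pM2r ?invr_gt0// ler_pM ?exprn_ge0 ?(ltW c0)//.
    by rewrite ler_nat.
  by rewrite ler_weXn2l.
have C35 : C ^+ 3 <= C ^+ 5 by rewrite ler_weXn2l.
(* [bal m.+1] comes normalized by [sqrt (pi * m.+1)]; [r] restores [sqrt (pi * m)]. *)
pose r : R := Num.sqrt (m%:R / m.+1%:R).
have r0 : 0 <= r by rewrite sqrtr_ge0.
have m1' : 0 < m.+1%:R :> R by rewrite ltr0n.
have r2 : r ^+ 2 = 1 - m.+1%:R^-1.
  by rewrite sqr_sqrtr ?divr_ge0// -(natr1 m); field; rewrite natr1 gt_eqF.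
have r1 : r <= 1.
  by rewrite -(@ler_pXn2r _ 2)// ?nnegrE// r2 expr1n gerBl invr_ge0.
have sE : Num.sqrt (pi * m%:R) = r * Num.sqrt (pi * m.+1%:R).
  rewrite /r -sqrtrM ?divr_ge0//; congr Num.sqrt.
  by rewrite mulrCA divfK ?gt_eqF.
rewrite invrK.
set s := Num.sqrt (pi * m%:R) in h sE *; set s' := Num.sqrt _ in h' sE.
have e : s * (b - (b - b') * C ^+ 2) - C =
   (s * b - C) - C ^+ 2 * (s * b - C) + C ^+ 2 * (s * b' - C) by ring.
have k : `|s * b' - C| <= 3 * C ^+ 3 / m%:R.
  have -> : s * b' - C = r * (s' * b' - C) - C * (1 - r) by rewrite sE; ring.
  apply: le_trans (ler_normB _ _) _.
  have p0 : 0 <= C * (1 - r) by rewrite mulr_ge0 ?(ltW c0)// subr_ge0.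
  rewrite normrM (ger0_norm r0) (ger0_norm p0).
  have k1 : r * `|s' * b' - C| <= 2 * C ^+ 3 / m%:R.
    apply: le_trans (ler_wpM2l r0 h') _.
    apply: le_trans (ler_piMl _ r1) _.
      by rewrite divr_ge0// mulr_ge0// exprn_ge0// ltW.
    rewrite ler_wpM2l//; first by rewrite mulr_ge0// exprn_ge0// ltW.
    by rewrite lef_pV2 ?posrE// ler_nat leqnSn.
  have k2 : C * (1 - r) <= C ^+ 3 / m%:R.
    apply: ler_pM; rewrite ?subr_ge0// ?(ltW c0)//.
      by rewrite ler_eXnr.
    apply: (@le_trans _ _ (1 - r ^+ 2)).
      by rewrite lerB// expr2 ler_piMl.
    by rewrite r2 opprB addrC subrK lef_pV2 ?posrE// ler_nat leqnSn.
  apply: le_trans (lerD k1 k2) _.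
  by rewrite le_eqVlt; apply/orP; left; apply/eqP; ring.
rewrite e; apply: le_trans (ler_normD _ _) _.
apply: le_trans (lerD (ler_normB _ _) (lexx _)) _.
have C2 : 0 <= C ^+ 2 by rewrite sqr_ge0.
rewrite ![`|C ^+ 2 * _|]normrM (ger0_norm C2).
apply: le_trans (lerD (lerD h (ler_wpM2l C2 h)) (ler_wpM2l C2 k)) _.
rewrite -subr_ge0.
have -> : 7 * C ^+ 5 / m%:R - (2 * C ^+ 3 / m%:R + C ^+ 2 * (2 * C ^+ 3 / m%:R) +
   C ^+ 2 * (3 * C ^+ 3 / m%:R)) = 2 * (C ^+ 5 - C ^+ 3) / m%:R by ring.
by rewrite divr_ge0// mulr_ge0// subr_ge0.
Qed.

(** [bal_low] is a mean of two coefficients, each of which is at most the balanced one. *)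
Lemma bal_low_bounds n (t : R) :
  0 <= bal_low n (cosh t ^- 2) <= bal n./2 (cosh t ^- 2).
Proof.
have [a0 a1] := cosh_inv2 t.
rewrite /bal_low; case: ifP => _; last by rewrite bal_ge0/=.
set m := n./2; have p01 := up_prob01 t.
rewrite -up_prob_var in a0 a1 *; set p := up_prob t in a0 a1 p01 *.
have b0 := pair_poly_coef p m; have bS := balS_coef p m.
have in01 : {in nseq m p ++ nseq m (1 - p), forall x, 0 < x < 1}.
  move=> x; rewrite mem_cat !mem_nseq => /orP[] /andP[_ /eqP->]//.
  by move/andP: p01 => [u v]; apply/andP; split; lra.
have c0 k : 0 <= (pair_poly p ^+ m)`_k by rewrite pair_polyX gf_ge0.
have c1 k : (pair_poly p ^+ m)`_k <= bal m (4 * p * (1 - p)).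
  rewrite pair_polyX; apply: gf_coef_le_even => //.
    by apply/allP => x; rewrite mem_cat !mem_nseq => /orP[] /andP[_ ->]; rewrite ?orbT.
  by rewrite size_cat !size_nseq addnn.
rewrite bS -b0.
have := c0 m; have := c0 m.+1; have := c1 m.+1; rewrite -b0.
set x := (_)`_m; set y := (_)`_m.+1 => yx y0 x0.
have [p0 q0] : p != 0 /\ 1 - p != 0.
  by move/andP: p01 => [u v]; rewrite gt_eqF// gt_eqF ?subr_gt0.
have -> : x - (x - (2 * p * (1 - p) * y + (1 - 2 * p * (1 - p)) * x)) / (4 * p * (1 - p))
   = (x + y) / 2 by clearbody p x y; field; rewrite p0 q0.
by apply/andP; split; lra.
Qed.

End BalancedAsymptotics.

(** * Integrals over the half-line *)

Section HalfLine.
Variable R : realType.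
Notation mu := (@lebesgue_measure R).
Implicit Types (f g F : R -> R).

Definition hl f : R := \int[mu]_(x in `[0%R, +oo[) f x.

(** An exponential envelope makes the integral over the half-line finite, so that [hl]
    is linear and monotone on such functions. *)
Definition edom f := measurable_fun [set: R] f /\
  exists A, forall t, 0 <= t -> `|f t| <= A * expR (- t).

Let mD : measurable (`[0%R, +oo[%classic : set R).
Proof. exact: measurable_itv. Qed.

Let cvg_expN : expR (- x) @[x --> +oo%R] --> (0 : R).
Proof. exact: cvgr_expR. Qed.

Lemma hl_FTC_ge0 f F : (forall t, 0 <= t -> 0 <= f t) -> continuous f ->
  (forall x, has_der F x (f x)) -> F x @[x --> +oo%R] --> (0 : R) ->
  (\int[mu]_(x in `[0%R, +oo[) (f x)%:E = (- F 0)%:E)%E.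
Proof.
move=> f0 cf dF F0; rewrite (ge0_continuous_FTC2y f0 _ F0) ?sub0e//.
- exact: continuous_subspaceT.
- by move=> x _; case: (dF x).
- exact/cvg_at_right_filter/(der_cont dF).
- by move=> x _; rewrite derive1E; case: (dF x).
Qed.

Lemma integral_expN : (\int[mu]_(x in `[0%R, +oo[) (expR (- x))%:E = 1%:E)%E.
Proof.
rewrite (@hl_FTC_ge0 _ (fun x => - expR (- x))).
- by rewrite oppr0 expR0 opprK.
- by move=> t _; exact: expR_ge0.
- by apply: der_cont => x; der.
- by move=> x; apply: der_eq; [der|rewrite mulN1r opprK].
- by rewrite -oppr0; apply: cvgN.
Qed.

Lemma mfun_expN : measurable_fun [set: R] (fun x : R => expR (- x)).
Proof. by apply: continuous_measurable_fun; apply: der_cont => x; der. Qed.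

Lemma integrable_expN : mu.-integrable `[0%R, +oo[ (EFin \o (fun x => expR (- x))).
Proof.
apply/integrableP; split.
  by apply/measurable_EFinP; apply: measurable_funTS; exact: mfun_expN.
under eq_integral do rewrite /= ger0_norm ?expR_ge0//.
by rewrite integral_expN ltry.
Qed.

Lemma edom_int f : edom f -> mu.-integrable `[0%R, +oo[ (EFin \o f).
Proof.
move=> [mf [A fA]].
apply: (@le_integrable _ _ _ mu _ mD _ (fun x => (A%:E * (expR (- x))%:E)%E)) => //.
- by apply/measurable_EFinP; apply: measurable_funTS.
- move=> x /=; rewrite in_itv/= andbT => x0; rewrite lee_fin.
  by apply: le_trans (fA _ x0) _; exact: ler_norm.
- by apply: integrableZl => //; exact: integrable_expN.
Qed.

Lemma edomZ c f : edom f -> edom (fun t => c * f t).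
Proof.
move=> [mf [A fA]]; split; first exact: measurable_funM.
by exists (`|c| * A) => t t0; rewrite normrM -mulrA ler_wpM2l// fA.
Qed.

Lemma hlD f g : edom f -> edom g -> hl (fun t => f t + g t) = hl f + hl g.
Proof. by move=> ef eg; apply: RintegralD => //; exact: edom_int. Qed.

Lemma hlZ c f : edom f -> hl (fun t => c * f t) = c * hl f.
Proof. by move=> ef; apply: RintegralZl => //; exact: edom_int. Qed.

Lemma hl_le f g : edom f -> edom g -> (forall t, 0 <= t -> f t <= g t) ->
  hl f <= hl g.
Proof.
move=> ef eg fg; apply: le_Rintegral; rewrite ?edom_int//; try exact: edom_int.
by move=> x /=; rewrite in_itv/= andbT => /fg.
Qed.

Lemma eq_hl f g : (forall t, 0 <= t -> f t = g t) -> hl f = hl g.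
Proof.
move=> fg; apply: eq_Rintegral => x; rewrite inE/= in_itv/= andbT; exact: fg.
Qed.

(** Adding [A * expR (- t)] makes the integrand nonnegative, which is the case of
    [hl_FTC_ge0]. *)
Lemma hl_FTC f F : continuous f -> (forall x, has_der F x (f x)) ->
  edom f -> edom F -> hl f = - F 0.
Proof.
move=> cf dF ef [_ [B FB]]; have [mf [A fA]] := ef.
have e0 : edom (fun t => A * expR (- t)).
  apply: edomZ; split; first exact: mfun_expN.
  by exists 1 => t _; rewrite mul1r ger0_norm// expR_ge0.
have E : (\int[mu]_(x in `[0%R, +oo[) (f x + A * expR (- x))%:E = (- F 0 + A)%:E)%E.
  rewrite (@hl_FTC_ge0 _ (fun x => F x + A * - expR (- x))).
  - by rewrite oppr0 expR0 mulrN1 opprB addrC.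
  - move=> t t0; have := fA _ t0; rewrite ler_norml => /andP[+ _].
    by rewrite -subr_ge0 opprK.
  - have c2 : continuous (fun x : R => A * expR (- x)).
      by apply: der_cont => y; der.
    by move=> x; apply: cvgD; [exact: cf|exact: c2].
  - move=> x; apply: der_eq; first by apply: der_add; [exact: dF|der].
    by rewrite mul0r add0r mulN1r opprK.
  - rewrite -[X in _ --> X]addr0; apply: cvgD.
      apply/norm_cvg0P.
      apply: (@squeeze_cvgr _ _ _ _ (cst 0) (fun t => B * expR (- t))).
      + near=> t; rewrite normr_ge0/= FB//; near: t; exact: nbhs_pinfty_ge.
      + exact: cvg_cst.
      + by rewrite -(mulr0 B); apply: cvgM => //; exact: cvg_cst.
    by rewrite -(mulr0 A) -oppr0; apply: cvgM; [exact: cvg_cst|apply: cvgN].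
have : hl (fun t => f t + A * expR (- t)) = - F 0 + A by rewrite /hl /Rintegral E.
rewrite hlD// hlZ//; last first.
  split; first exact: mfun_expN.
  by exists 1 => t _; rewrite mul1r ger0_norm// expR_ge0.
by rewrite {2}/hl /Rintegral integral_expN/= mulr1 => /addIr.
Unshelve. all: by end_near. Qed.

Lemma hl_indic_itv (a b : R) : 0 <= a -> a <= b -> hl (\1_(`[a, b]%classic)) = b - a.
Proof.
move=> a0 ab; rewrite /hl /Rintegral integral_indic//.
rewrite (_ : `[a, b]%classic `&` _ = `[a, b]%classic); last first.
  apply/seteqP; split=> x /=; first by case.
  rewrite !in_itv/= => /andP[ax xb]; rewrite ax xb andbT; split => //.
  by rewrite (le_trans a0 ax).
rewrite /= lebesgue_measure_itv/= lte_fin.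
by move: ab; rewrite le_eqVlt => /predU1P[->|->//]; rewrite ltxx subrr.
Qed.

Lemma edom_indic (a b : R) : edom (\1_(`[a, b]%classic) : R -> R).
Proof.
split; first exact: measurable_indic.
exists (expR b) => t t0; rewrite -expRD indicE.
case: (boolP (t \in _)) => [|_]; last by rewrite normr0 expR_ge0.
rewrite inE/= in_itv/= => /andP[_ tb]; rewrite normr1 -expR0 ler_expR.
by rewrite subr_ge0.
Qed.

End HalfLine.

(** * Moments by integration by parts *)

Section Tame.
Variable R : realType.
Implicit Types (f g phi psi : R -> R) (t : R).

(** At most exponential growth: the Gaussian decay of the weight [cwW] below absorbs
    it, so that a tame function times a power of the weight is in [edom]. *)
Definition tame f := measurable_fun [set: R] f /\
  exists C K, [/\ 0 <= C, 0 <= K & forall t, 0 <= t -> `|f t| <= C * expR (K * t)].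

Lemma tame_bounded f C : measurable_fun [set: R] f ->
  (forall t, 0 <= t -> `|f t| <= C) -> tame f.
Proof.
move=> mf fC; split=> //; exists C, 0; split=> // [|t t0].
  by apply: le_trans (fC 0 (lexx _)).
by rewrite mul0r expR0 mulr1 fC.
Qed.

Lemma tame_cst c : tame (fun _ => c).
Proof. by apply: (@tame_bounded _ `|c|). Qed.

Lemma tame_id : tame (fun t => t).
Proof.
split; first exact: measurable_id.
exists 1, 1; split=> // t t0; rewrite !mul1r ger0_norm//.
by apply: le_trans (expR_ge1Dx t); rewrite lerDr.
Qed.

Lemma tameD f g : tame f -> tame g -> tame (fun t => f t + g t).
Proof.
move=> [mf [C [K [C0 K0 fC]]]] [mg [C' [K' [C0' K0' gC]]]]; split.
  exact: measurable_funD.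
exists (C + C'), (K + K'); split; rewrite ?addr_ge0// => t t0.
apply: le_trans (ler_normD _ _) _; rewrite mulrDl lerD//.
  apply: le_trans (fC _ t0) _; rewrite ler_wpM2l// ler_expR ler_wpM2r//.
  by rewrite lerDl.
apply: le_trans (gC _ t0) _; rewrite ler_wpM2l// ler_expR ler_wpM2r//.
by rewrite lerDr.
Qed.

Lemma tameM f g : tame f -> tame g -> tame (fun t => f t * g t).
Proof.
move=> [mf [C [K [C0 K0 fC]]]] [mg [C' [K' [C0' K0' gC]]]]; split.
  exact: measurable_funM.
exists (C * C'), (K + K'); split; rewrite ?addr_ge0 ?mulr_ge0// => t t0.
by rewrite normrM mulrDl expRD mulrACA ler_pM ?fC ?gC.
Qed.

Lemma tameN f : tame f -> tame (fun t => - f t).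
Proof.
move=> tf; have := tameM (tame_cst (-1)) tf.
by rewrite (_ : (fun t => - f t) = (fun t => -1 * f t))//; apply/funext => t; rewrite mulN1r.
Qed.

Lemma tameX n f : tame f -> tame (fun t => f t ^+ n).
Proof.
move=> tf; elim: n => [|n ih]; first exact: tame_cst.
rewrite (_ : (fun t => f t ^+ n.+1) = (fun t => f t * f t ^+ n)).
  exact: tameM.
by apply/funext => t; rewrite exprS.
Qed.

End Tame.

Ltac tame := repeat first
  [ assumption | apply: tame_cst | apply: tame_id | apply: tameN | apply: tameD
  | apply: tameX | apply: tameM ].

Section Weighted.
Variable R : realType.
Variables (b k : R).
Hypothesis b0 : 0 < b.
Implicit Types (f phi psi : R -> R) (t : R) (n : nat).

(** For [k = `|h|], the [n]-th power of this weight is, up to a constant, the density of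
    the mixing measure folded to [t >= 0], with the contribution of [- t] left to
    [fold_weight]. *)
Definition cwW t : R := cosh t * expR (- (t - k) ^+ 2 / (2 * b)).
(** The logarithmic derivative of [cwW], called the drift. Its zeros correspond to the
    solutions [tanh t] of the mean-field equation. *)
Definition cwg t : R := tanh t - (t - k) / b.

Lemma cwW_gt0 t : 0 < cwW t.
Proof. by rewrite mulr_gt0 ?cosh_gt0 ?expR_gt0. Qed.

Lemma der_cwW t : has_der cwW t (cwW t * cwg t).
Proof.
apply: der_eq; first by rewrite /cwW; der.
have c0 : cosh t != 0 by rewrite gt_eqF// cosh_gt0.
rewrite /cwW /cwg /tanh /=.
by move: (cosh t) (sinh t) (expR _) c0 => C S E c0; field; rewrite c0 gt_eqF.
Qed.

Lemma der_cwWX n t : has_der (fun t => cwW t ^+ n) t (n%:R * cwg t * cwW t ^+ n).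
Proof.
apply: der_eq; first exact: der_exp (der_cwW t).
by case: n => [|n]; rewrite ?mul0r//= exprS; ring.
Qed.

Lemma continuous_cwWX n : continuous (fun t => cwW t ^+ n).
Proof. exact: der_cont (der_cwWX n). Qed.

Lemma continuous_cwg : continuous cwg.
Proof. by rewrite /cwg; apply: der_cont => t; der. Qed.

Lemma tame_tanh : tame (@tanh R).
Proof.
apply: (@tame_bounded _ _ 1).
  by apply: continuous_measurable_fun; apply: der_cont => t; der.
move=> t _; rewrite -(@ler_pXn2r _ 2)// ?nnegrE// expr1n.
by rewrite -normrX ger0_norm ?sqr_ge0// ltW// tanh2_lt1.
Qed.

Lemma tame_cwg : tame cwg.
Proof. by have h := tame_tanh; rewrite /cwg; tame. Qed.

Lemma tame_edom n phi : (0 < n)%N -> tame phi -> edom (fun t => phi t * cwW t ^+ n).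
Proof.
move=> n0 [mphi [C [K [C0 K0 fC]]]]; split.
  apply: measurable_funM => //; apply: continuous_measurable_fun.
  exact: continuous_cwWX.
have n0' : 0 < n%:R :> R by rewrite ltr0n.
pose L := K + n%:R + 1; pose a := n%:R / (2 * b).
have a0 : 0 < a by rewrite divr_gt0// mulr_gt0.
exists (C * expR (L * k + L ^+ 2 / (4 * a))) => t t0.
rewrite normrM (ger0_norm (exprn_ge0 _ (ltW (cwW_gt0 _)))).
apply: (@le_trans _ _ (C * expR (K * t) * (expR (t - (t - k) ^+ 2 / (2 * b))) ^+ n)).
  rewrite ler_pM ?exprn_ge0 ?(ltW (cwW_gt0 _)) ?fC//.
  rewrite lerXn2r ?nnegrE ?expR_ge0 ?(ltW (cwW_gt0 _))//.
  rewrite expRD /cwW mulNr ler_wpM2r ?expR_ge0// /cosh ler_pdivrMr//.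
  rewrite mulr_natr mulr2n lerD2l ler_expR.
  by rewrite (@le_trans _ _ 0)// oppr_le0.
rewrite -[leLHS]mulrA -[leRHS]mulrA ler_wpM2l// -expRM_natl -!expRD ler_expR -subr_ge0.
have -> : L * k + L ^+ 2 / (4 * a) + - t - (K * t + n%:R * (t - (t - k) ^+ 2 / (2 * b)))
   = (L / 2 - a * (t - k)) ^+ 2 / a.
  rewrite /L /a; field.
  by rewrite (gt_eqF b0) (gt_eqF n0').
by rewrite divr_ge0 ?sqr_ge0// ltW.
Qed.

Definition wint n phi : R := hl (fun t => phi t * cwW t ^+ n).

Lemma wintD n phi psi : (0 < n)%N -> tame phi -> tame psi ->
  wint n (fun t => phi t + psi t) = wint n phi + wint n psi.
Proof.
move=> n0 h1 h2; rewrite /wint -hlD; try exact: tame_edom.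
by apply: eq_hl => t _; rewrite mulrDl.
Qed.

Lemma wintZ n c phi : (0 < n)%N -> tame phi ->
  wint n (fun t => c * phi t) = c * wint n phi.
Proof.
move=> n0 h1; rewrite /wint -hlZ; last exact: tame_edom.
by apply: eq_hl => t _; rewrite mulrA.
Qed.

Lemma eq_wint n phi psi : (forall t, 0 <= t -> phi t = psi t) ->
  wint n phi = wint n psi.
Proof. by move=> h; apply: eq_hl => t t0; rewrite h. Qed.

Lemma wintN n phi : (0 < n)%N -> tame phi ->
  wint n (fun t => - phi t) = - wint n phi.
Proof.
move=> n0 h; rewrite -mulN1r -wintZ//.
by apply: eq_wint => t _; rewrite mulN1r.
Qed.

Lemma wint_le n phi psi : (0 < n)%N -> tame phi -> tame psi ->
  (forall t, 0 <= t -> phi t <= psi t) -> wint n phi <= wint n psi.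
Proof.
move=> n0 h1 h2 h; apply: hl_le; try exact: tame_edom.
by move=> t t0; rewrite ler_wpM2r ?h// exprn_ge0// ltW// cwW_gt0.
Qed.

Lemma wint_ge0 n phi : (0 < n)%N -> tame phi ->
  (forall t, 0 <= t -> 0 <= phi t) -> 0 <= wint n phi.
Proof.
move=> n0 tp p0; have w0 : wint n (fun _ => 0) = 0.
  apply: (addrI (wint n (fun _ => 0))); rewrite addr0 -wintD//; try by tame.
  by apply: eq_wint => t _; rewrite addr0.
by rewrite -w0; apply: wint_le => //; tame.
Qed.

Lemma wint_norm_le n phi psi : (0 < n)%N -> tame phi -> tame psi ->
  (forall t, 0 <= t -> `|phi t| <= psi t) -> `|wint n phi| <= wint n psi.
Proof.
move=> n0 h1 h2 h; rewrite ler_norml -wintN//.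
apply/andP; split; apply: wint_le => //; try by tame.
  by move=> t t0; have := h t t0; rewrite ler_norml => /andP[].
by move=> t t0; have := h t t0; rewrite ler_norml => /andP[].
Qed.

Definition wmass n : R := wint n (fun _ => 1).

Lemma wmass_ge n (x y w : R) : (0 < n)%N -> 0 <= x -> x <= y -> 0 <= w ->
  (forall t, x <= t <= y -> w <= cwW t) -> (y - x) * w ^+ n <= wmass n.
Proof.
move=> n0 x0 xy w0 h; rewrite mulrC -(hl_indic_itv x0 xy) -hlZ; last exact: edom_indic.
apply: hl_le; [exact/edomZ/edom_indic|exact/tame_edom/tame_cst|].
move=> t t0; rewrite mul1r indicE; case: (boolP (t \in _)) => [|_].
  rewrite inE/= in_itv/= => /h wt; rewrite mulr1 lerXn2r// nnegrE//.
  by rewrite ltW// cwW_gt0.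
by rewrite mulr0 exprn_ge0// ltW// cwW_gt0.
Qed.

Lemma wmass_gt0 n : (0 < n)%N -> 0 < wmass n.
Proof.
move=> n0; have [w w0 h] : exists2 w : R, 0 < w & forall t, 0 <= t <= 1 -> w <= cwW t.
  exists (expR (- (1 + `|k|) ^+ 2 / (2 * b))); first exact: expR_gt0.
  move=> t /andP[t0 t1]; rewrite /cwW; apply: le_trans (ler_peMl _ (cosh_ge1 t)).
    rewrite ler_expR !mulNr lerN2 ler_pM2r ?invr_gt0 ?mulr_gt0//.
    rewrite -[(t - k) ^+ 2]real_normK ?num_real// lerXn2r ?nnegrE ?addr_ge0//.
    by apply: le_trans (ler_normB _ _) _; rewrite lerD2r ger0_norm.
  exact: expR_ge0.
apply: lt_le_trans (wmass_ge n0 (lexx 0) ler01 (ltW w0) h).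
by rewrite subr0 mul1r exprn_gt0.
Qed.

(** The integral over the half-line of the derivative of [psi * cwW ^+ n]. *)
Lemma stein n psi psi' : (0 < n)%N -> (forall t, has_der psi t (psi' t)) ->
  continuous psi' -> tame psi -> tame psi' ->
  wint n (fun t => psi' t + n%:R * (cwg t * psi t)) = - (psi 0 * cwW 0 ^+ n).
Proof.
move=> n0 dpsi cpsi' tpsi tpsi'.
have tg := tame_cwg.
rewrite /wint (@hl_FTC _ _ (fun t => psi t * cwW t ^+ n))//.
- have cpsi := der_cont dpsi.
  move=> t; apply: cvgM; last exact: continuous_cwWX.
  apply: cvgD; first exact: cpsi'.
  apply: cvgM; first exact: cvg_cst.
  by apply: cvgM; [exact: continuous_cwg|exact: cpsi].
- move=> t; apply: der_eq; first by apply: der_mul; [exact: dpsi|exact: der_cwWX].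
  by rewrite /=; ring.
- by apply: tame_edom => //; tame.
- exact: tame_edom.
Qed.

Lemma tame_indic x : tame (\1_(`[0, x]%classic) : R -> R).
Proof.
apply: (@tame_bounded _ _ 1); first exact: measurable_indic.
by move=> t _; rewrite indicE; case: (_ \in _); rewrite ?normr1 ?normr0.
Qed.

(** The drift pulls towards [s], with strength at least [c] beyond [delta]. Closer to [0]
    it may degenerate, but there the mass is negligible. *)
Section Moments.
Variables (s c delta r : R).
Hypothesis s0 : 0 <= s.
Hypothesis c0 : 0 < c.
Hypothesis ds : delta <= s.
Hypothesis d0 : 0 <= delta.
Hypothesis r0 : 0 <= r.
Hypothesis drift : forall t, 0 <= t -> (t - s) * cwg t <= 0.
Hypothesis drift_far : forall t, delta <= t -> c * (t - s) ^+ 2 <= - ((t - s) * cwg t).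
Hypothesis near0 : forall n, (0 < n)%N ->
  wint n (\1_(`[0, delta]%classic)) <= r / n%:R ^+ 2 * wmass n.

Let chi : R -> R := \1_(`[0, delta]%classic).

Let chi_ge0 t : 0 <= chi t.
Proof. by rewrite /chi indicE. Qed.

Let tchi : tame chi. Proof. exact: tame_indic. Qed.

Let tX : tame (fun t => t - s).
Proof. by tame. Qed.

Let quad t : 0 <= t ->
  (t - s) ^+ 2 <= c^-1 * (- ((t - s) * cwg t)) + s ^+ 2 * chi t.
Proof.
move=> t0; have [dt|td] := leP delta t.
  apply: (@le_trans _ _ (c^-1 * (- ((t - s) * cwg t)))).
    by rewrite -(ler_pM2l c0) mulVKf ?gt_eqF// drift_far.
  by rewrite lerDl mulr_ge0// sqr_ge0.
have -> : chi t = 1 by rewrite /chi indicE mem_set//= in_itv/= t0 ltW.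
rewrite mulr1 ler_wpDl//.
  by rewrite mulr_ge0 ?invr_ge0 ?(ltW c0)// oppr_ge0 drift.
rewrite -[(t - s) ^+ 2]real_normK ?num_real// lerXn2r ?nnegrE// ler_norml.
by apply/andP; split; move: t0 td ds s0 d0; lra.
Qed.

(** For an odd power of [t - s] the boundary term at [0] has the favourable sign. *)
Lemma stein_odd n j : (0 < n)%N ->
  n%:R * wint n (fun t => - ((t - s) ^+ (j.*2.+1) * cwg t))
  <= j.*2.+1%:R * wint n (fun t => (t - s) ^+ j.*2).
Proof.
move=> n0; have tg := tame_cwg.
pose psi t := (t - s) ^+ j.*2.+1.
pose psi' t := j.*2.+1%:R * (t - s) ^+ j.*2.
have dpsi t : has_der psi t (psi' t).
  by apply: der_eq; [rewrite /psi; der|rewrite /psi'/= addr0 mulr1].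
have cpsi' : continuous psi' by rewrite /psi'; apply: der_cont => t; der.
have tpsi : tame psi by rewrite /psi; tame.
have tpsi' : tame psi' by rewrite /psi'; tame.
have := stein n0 dpsi cpsi' tpsi tpsi'.
rewrite wintD//; last by tame.
rewrite /psi' wintZ//; last by tame.
rewrite wintZ//; last by tame.
rewrite (@eq_wint n (fun t => cwg t * psi t) (fun t => - (- ((t - s) ^+ j.*2.+1 * cwg t)))); last first.
  by move=> t _; rewrite opprK mulrC.
rewrite wintN//; last by tame.
rewrite mulrN => e; rewrite -subr_ge0 e.
rewrite oppr_ge0 /psi sub0r -[j.*2.+1]addn1 exprD expr1 mulrN mulNr oppr_le0.
rewrite -mul2n exprM sqrrN -exprM mulr_ge0 ?mulr_ge0 ?exprn_ge0//.
exact: ltW (cwW_gt0 _).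
Qed.

(** Beyond [delta] the square of [t - s] is dominated by the drift, and [stein_odd]
    applies; below [delta] the power is at most [s ^+ j.*2.+2]. *)
Lemma even_moment n j : (0 < n)%N ->
  wint n (fun t => (t - s) ^+ j.*2.+2) <=
  c^-1 * (j.*2.+1%:R * wint n (fun t => (t - s) ^+ j.*2) / n%:R)
  + s ^+ j.*2.+2 * (r / n%:R ^+ 2 * wmass n).
Proof.
move=> n0; have n0' : 0 < n%:R :> R by rewrite ltr0n.
have tg := tame_cwg.
apply: (@le_trans _ _ (wint n (fun t =>
    c^-1 * (- ((t - s) ^+ j.*2.+1 * cwg t)) + s ^+ j.*2.+2 * chi t))).
  apply: wint_le => //; [by tame|by tame|] => t t0.
  have q0 : 0 <= (t - s) ^+ j.*2 by rewrite -mul2n exprM exprn_ge0// sqr_ge0.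
  have qs : chi t * (t - s) ^+ j.*2 <= chi t * s ^+ j.*2.
    have := chi_ge0 t; rewrite le_eqVlt => /predU1P[<-|x0]; first by rewrite !mul0r.
    rewrite ler_pM2l//; move: x0; rewrite /chi indicE.
    case: (boolP (t \in _)); rewrite ?ltxx// inE/= in_itv/= => /andP[_ td] _.
    rewrite -!mul2n !exprM; apply: lerXn2r; rewrite ?nnegrE ?sqr_ge0//.
    rewrite -[(t - s) ^+ 2]real_normK ?num_real// lerXn2r ?nnegrE// ler_norml.
    by apply/andP; split; move: t0 td ds s0 d0; lra.
  have := ler_wpM2r q0 (quad t0); rewrite -exprD add2n => /le_trans; apply.
  rewrite mulrDl lerD//.
    by rewrite -mulrA ler_pM2l ?invr_gt0// exprS !mulNr mulrAC.
  by rewrite -mulrA -[in leRHS]add2n exprD -[leRHS]mulrA ler_wpM2l ?sqr_ge0// [leRHS]mulrC.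
rewrite wintD//; [|by tame|by tame].
rewrite !wintZ//; last by tame.
rewrite lerD//.
  rewrite ler_pM2l ?invr_gt0// ler_pdivlMr// mulrC; exact: stein_odd.
rewrite ler_wpM2l ?near0//.
by rewrite exprn_ge0.
Qed.

Lemma second_moment n : (0 < n)%N ->
  wint n (fun t => (t - s) ^+ 2) <= (c^-1 + s ^+ 2 * r) / n%:R * wmass n.
Proof.
move=> n0; have n0' : 0 < n%:R :> R by rewrite ltr0n.
have Z0 := wmass_gt0 n0.
have := @even_moment n 0 n0; rewrite double0 expr2 => /le_trans; apply.
rewrite (@eq_wint _ _ (fun _ => 1)); last by move=> t _; rewrite expr0.
rewrite -/(wmass n) mul1r [_ / n%:R]mulrDl [leRHS]mulrDl lerD//.
  by rewrite -mulrA [_ / n%:R]mulrC.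
have -> : s * s * r / n%:R * wmass n = s * s * (r * (n%:R^-1 * wmass n)) by ring.
rewrite ler_wpM2l ?mulr_ge0// -mulrA ler_wpM2l// ler_pM2r// lef_pV2 ?posrE ?exprn_gt0//.
by rewrite ler_eXnr// ler1n.
Qed.

Definition fourth_const := 3 * c^-1 * (c^-1 + s ^+ 2 * r) + s ^+ 4 * r.

Lemma fourth_moment n : (0 < n)%N ->
  wint n (fun t => (t - s) ^+ 4) <= fourth_const / n%:R ^+ 2 * wmass n.
Proof.
move=> n0; have n0' : 0 < n%:R :> R by rewrite ltr0n.
have Z0 := wmass_gt0 n0.
have := @even_moment n 1 n0 => /le_trans; apply.
have h := second_moment n0.
rewrite /fourth_const [_ / n%:R ^+ 2]mulrDl [leRHS]mulrDl lerD//; last by rewrite -!mulrA.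
have -> : 3 * c^-1 * (c^-1 + s ^+ 2 * r) / n%:R ^+ 2 * wmass n =
  c^-1 * (3 * ((c^-1 + s ^+ 2 * r) / n%:R * wmass n) / n%:R).
  by field; rewrite (gt_eqF n0') (gt_eqF c0).
by rewrite ler_pM2l ?invr_gt0// ler_pM2r ?invr_gt0// ler_pM2l.
Qed.

Section first.
Variables (kappa C2 : R).
Hypothesis kappa0 : 0 < kappa.
Hypothesis C20 : 0 <= C2.
Hypothesis s_gt0 : 0 < s.
Hypothesis lin : forall t, 0 <= t -> `|cwg t + kappa * (t - s)| <= C2 * (t - s) ^+ 2.
Hypothesis W0_le : forall t, 0 <= t <= s -> cwW 0 <= cwW t.

(** With [psi = 1], [stein] computes the mean of the drift, which is linear in [t - s] up
    to an error controlled by the second moment. The boundary term is at most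
    [wmass n / (s * n)], since the weight on [0, s] is at least its value at [0]. *)
Lemma first_moment n : (0 < n)%N ->
  `|wint n (fun t => t - s)| <= kappa^-1 * (s^-1 + C2 * (c^-1 + s ^+ 2 * r)) / n%:R * wmass n.
Proof.
move=> n0; have n0' : 0 < n%:R :> R by rewrite ltr0n.
have Z0 := wmass_gt0 n0; have tg := tame_cwg.
have hW : cwW 0 ^+ n <= s^-1 * wmass n.
  rewrite -(ler_pM2l s_gt0) mulVKf ?gt_eqF// -[s in leLHS]subr0.
  by apply: wmass_ge => //; exact: ltW (cwW_gt0 _).
have e : wint n cwg = - (cwW 0 ^+ n / n%:R).
  have := @stein n (fun _ => 1) (fun _ => 0) n0 (fun t => der_cst 1 t)
    (fun t => cvg_cst _) (tame_cst 1) (tame_cst 0).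
  rewrite mul1r => h.
  have nz : n%:R != 0 :> R by rewrite gt_eqF.
  apply: (mulfI nz); rewrite mulrN mulrCA divff// mulr1 -h -wintZ//.
  by apply: eq_wint => t _; rewrite add0r mulr1.
have tl : tame (fun t => cwg t + kappa * (t - s)) by tame.
have M2 := second_moment n0.
have hl1 : `|wint n (fun t => cwg t + kappa * (t - s))| <= C2 * wint n (fun t => (t - s) ^+ 2).
  by rewrite -wintZ//; [apply: wint_norm_le => //; tame|tame].
rewrite wintD// in hl1; last by tame.
rewrite wintZ// in hl1.
rewrite -(ler_pM2l kappa0) -{1}(gtr0_norm kappa0) -normrM.
have -> : kappa * wint n (fun t => t - s) =
  (wint n cwg + kappa * wint n (fun t => t - s)) - wint n cwg by rewrite addrC addKr.
apply: le_trans (ler_normB _ _) _.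
have -> : kappa * (kappa^-1 * (s^-1 + C2 * (c^-1 + s ^+ 2 * r)) / n%:R * wmass n) =
  C2 * ((c^-1 + s ^+ 2 * r) / n%:R * wmass n) + s^-1 * wmass n / n%:R.
  by field; rewrite (gt_eqF n0') (gt_eqF c0) (gt_eqF kappa0) (gt_eqF s_gt0).
apply: lerD.
  by apply: le_trans hl1 _; rewrite ler_wpM2l.
rewrite e normrN ger0_norm ?divr_ge0 ?exprn_ge0// ?(ltW (cwW_gt0 _))//.
by rewrite ler_pM2r ?invr_gt0.
Qed.
End first.
End Moments.
End Weighted.

(** * The drift of the mean-field weight *)

Section TanhBounds.
Variable R : realType.
Implicit Types (t x y z : R).

Lemma der_tanh_id t : has_der (@tanh R) t (1 - tanh t ^+ 2).
Proof. by apply: der_eq; [exact: der_tanh (der_id t)|rewrite mul1r]. Qed.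

Lemma tanh_le t : 0 <= t -> tanh t <= t.
Proof.
move=> t0; rewrite -subr_ge0.
have := @der_ge0_le R (fun x => x - tanh x) (fun x => tanh x ^+ 2) 0 t t0.
rewrite tanh0 subrr; apply.
  by move=> x; apply: der_eq; [der|rewrite /= mul1r opprB addrCA subrr addr0].
by move=> x _; rewrite sqr_ge0.
Qed.

Lemma tanh_sub_le t : 0 <= t -> t - tanh t <= t ^+ 3 / 3.
Proof.
move=> t0; rewrite -subr_ge0.
have := @der_ge0_le R (fun x => x ^+ 3 / 3 - (x - tanh x))
  (fun x => x ^+ 2 - tanh x ^+ 2) 0 t t0.
rewrite tanh0 subrr expr0n/= mul0r subrr; apply.
  by move=> x; apply: der_eq; [der|rewrite /=; field].
move=> x /andP[x0 _]; rewrite subr_ge0 lerXn2r// ?nnegrE ?tanh_ge0 ?(ltW x0)//.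
exact/tanh_le/ltW.
Qed.

Lemma tanh_sub_ge t : 0 <= t -> t ^+ 3 / 3 - 2 * t ^+ 5 / 15 <= t - tanh t.
Proof.
move=> t0; rewrite -subr_ge0.
have := @der_ge0_le R (fun x => (x - tanh x) - (x ^+ 3 / 3 - 2 * x ^+ 5 / 15))
  (fun x => tanh x ^+ 2 - (x ^+ 2 - 2 * x ^+ 4 / 3)) 0 t t0.
rewrite tanh0 subrr !expr0n/= mulr0 !mul0r !subr0; apply.
  by move=> x; apply: der_eq; [der|rewrite /=; field].
move=> x /andP[x0 _]; have xx := ltW x0.
have h := tanh_sub_le xx; have h1 := tanh_ge0 xx; have h2 := tanh_le xx.
have [h3|h3] := leP (x - x ^+ 3 / 3) 0.
  have x4 : x ^+ 2 - 2 * x ^+ 4 / 3 <= 0.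
    have -> : x ^+ 2 - 2 * x ^+ 4 / 3 = x * (2 * (x - x ^+ 3 / 3) - x) by field.
    by rewrite mulr_ge0_le0//; lra.
  by rewrite subr_ge0 (le_trans x4)// sqr_ge0.
have : (x - x ^+ 3 / 3) ^+ 2 <= tanh x ^+ 2.
  by rewrite lerXn2r// ?nnegrE ?(ltW h3)//; lra.
rewrite -subr_ge0 => h4; apply: le_trans h4 _.
rewrite lerD2l lerN2 -subr_ge0.
have -> : (x - x ^+ 3 / 3) ^+ 2 - (x ^+ 2 - 2 * x ^+ 4 / 3) = (x ^+ 3 / 3) ^+ 2 by field.
exact: sqr_ge0.
Qed.

(** Strict concavity on the half-line, by the mean value theorem on both intervals. *)
Lemma tanh_slope x y z : 0 <= x -> x < y -> y < z ->
  (tanh z - tanh y) * (y - x) < (tanh y - tanh x) * (z - y).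
Proof.
move=> x0 xy yz.
have [u /andP[xu uy] ->] := der_MVT xy der_tanh_id.
have [v /andP[yv vz] ->] := der_MVT yz der_tanh_id.
rewrite mulrAC ltr_pM2r ?subr_gt0// ltr_pM2r ?subr_gt0//.
rewrite ltrD2l ltrN2.
have u0 : 0 <= u by rewrite ltW// (le_lt_trans x0).
have uv : u < v by exact: lt_trans uy yv.
have v0 : 0 <= v by rewrite ltW// (le_lt_trans u0).
by rewrite ltr_pXn2r// ?nnegrE ?tanh_ge0// ltr_tanh.
Qed.

Lemma tanh_taylor s t :
  `|tanh t - tanh s - (1 - tanh s ^+ 2) * (t - s)| <= 2 * (t - s) ^+ 2.
Proof.
have B x : `|tanh x| <= 1.
  rewrite -(@ler_pXn2r _ 2)// ?nnegrE// expr1n -normrX ger0_norm ?sqr_ge0//.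
  by rewrite ltW// tanh2_lt1.
have L x y : `|tanh x - tanh y| <= `|x - y|.
  wlog xy : x y / y <= x.
    move=> h; have [/h//|/ltW/h] := leP y x.
    by rewrite distrC (distrC y).
  move: xy; rewrite le_eqVlt => /predU1P[->|yx]; first by rewrite !subrr.
  have [c _ ->] := der_MVT yx der_tanh_id.
  rewrite normrM ler_piMl// ger0_norm; last by rewrite subr_ge0 ltW// tanh2_lt1.
  by rewrite gerBl sqr_ge0.
have M x y : exists2 c, `|c - y| <= `|x - y| & tanh x - tanh y = (1 - tanh c ^+ 2) * (x - y).
  have [xy|yx|->] := ltgtP x y.
  - have [c /andP[xc cy] e] := der_MVT xy der_tanh_id; exists c.
      by rewrite !ltr0_norm ?subr_lt0// lerN2 lerD2r ltW.
    by rewrite -opprB e -mulrN opprB.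
  - have [c /andP[xc cy] e] := der_MVT yx der_tanh_id; exists c => //.
    by rewrite !gtr0_norm ?subr_gt0// lerD2r ltW.
  - by exists y; rewrite ?subrr ?mulr0.
have [c cs ->] := M t s.
have -> : (1 - tanh c ^+ 2) * (t - s) - (1 - tanh s ^+ 2) * (t - s) =
  (tanh s - tanh c) * (tanh s + tanh c) * (t - s) by ring.
rewrite !normrM -[(t - s) ^+ 2]real_normK ?num_real// expr2 mulrA ler_wpM2r//.
rewrite mulrC ler_pM//.
  by apply: le_trans (ler_normD _ _) _; rewrite (le_trans (lerD (B s) (B c))).
by apply: le_trans (L _ _) _; rewrite distrC.
Qed.

End TanhBounds.

Section Drift.
Variable R : realType.
Variables (b k s : R).
Hypothesis b0 : 0 < b.
Hypothesis k0 : 0 <= k.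
Hypothesis s0 : 0 < s.
Hypothesis gs : cwg b k s = 0.
Implicit Types (t x y z : R).

Let g := cwg b k.

Let gs' : g s = 0.
Proof. exact: gs. Qed.

Lemma cwg_slope x y z : 0 <= x -> x < y -> y < z ->
  (g z - g y) * (y - x) < (g y - g x) * (z - y).
Proof.
move=> x0 xy yz; have := tanh_slope x0 xy yz; rewrite /g /cwg -subr_gt0 => h.
rewrite -subr_gt0; apply: lt_le_trans h _; rewrite le_eqVlt; apply/orP; left.
by apply/eqP; move: (tanh x) (tanh y) (tanh z) => u v w; field; rewrite gt_eqF.
Qed.

Lemma cwg0_ge0 : 0 <= g 0.
Proof. by rewrite /g /cwg tanh0 !sub0r mulNr opprK divr_ge0// ltW. Qed.

Lemma cwg_gt0 t : 0 < t -> t < s -> 0 < g t.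
Proof.
move=> t0 ts; have := cwg_slope (lexx 0) t0 ts; rewrite gs' subr0 sub0r.
have g0 := cwg0_ge0; rewrite -subr_gt0.
have -> : (g t - g 0) * (s - t) - - g t * t = g t * s - g 0 * (s - t) by ring.
rewrite subr_gt0 => h; rewrite -(pmulr_lgt0 _ s0); apply: le_lt_trans h.
by rewrite mulr_ge0// subr_ge0 ltW.
Qed.

Lemma cwg_lt0 t : s < t -> g t < 0.
Proof.
move=> st; have := cwg_slope (lexx 0) s0 st; rewrite gs' !subr0 sub0r => h.
have g0 := cwg0_ge0.
rewrite -(pmulr_llt0 _ s0); apply: lt_le_trans h _.
by rewrite mulNr oppr_le0 mulr_ge0// subr_ge0 ltW.
Qed.

Lemma drift_le0 t : 0 <= t -> (t - s) * g t <= 0.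
Proof.
move=> t0; have [ts|st|->] := ltgtP t s; last by rewrite subrr mul0r.
  move: t0; rewrite le_eqVlt => /predU1P[<-|t0].
    by rewrite sub0r mulNr oppr_le0 mulr_ge0 ?(ltW s0)// cwg0_ge0.
  by rewrite mulr_le0_ge0 ?subr_le0 ?ltW// cwg_gt0.
by rewrite mulr_ge0_le0 ?subr_ge0 ?ltW// cwg_lt0.
Qed.

(** Cut-off below which the lower bound on the drift is not claimed: for [k = 0] the drift
    vanishes at [0]. *)
Definition pit := s / 4.
Definition drift_rate := g pit / (s - pit).

Let pit0 : 0 < pit. Proof. by rewrite divr_gt0. Qed.
Let pits : pit < s. Proof. by rewrite /pit; move: s0; lra. Qed.

Lemma drift_rate_gt0 : 0 < drift_rate.
Proof. by rewrite divr_gt0 ?cwg_gt0// subr_gt0. Qed.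

(** The drift is concave and vanishes at [s], so beyond [pit] its slope seen from [s] is
    at least that of the chord from [pit] to [s]. *)
Lemma drift_ge t : pit <= t -> drift_rate * (t - s) ^+ 2 <= - ((t - s) * g t).
Proof.
have sp : 0 < s - pit by rewrite subr_gt0.
rewrite le_eqVlt => /predU1P[<-|pt].
  rewrite /drift_rate le_eqVlt; apply/orP; left; apply/eqP.
  by move: (g pit) => G; move: (pit) sp => p sp; field; rewrite gt_eqF.
have [ts|st|->] := ltgtP t s; last by rewrite subrr mul0r expr0n/= mulr0 oppr0.
- have := cwg_slope (ltW pit0) pt ts; rewrite gs' sub0r => h.
  rewrite -mulNr opprB -subr_ge0.
  have -> : (s - t) * g t - drift_rate * (t - s) ^+ 2 =
    (s - t) / (s - pit) * ((g t - g pit) * (s - t) - - g t * (t - pit)).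
    rewrite /drift_rate; move: (g pit) (g t) => G H.
    by move: (pit) sp => p sp; field; rewrite gt_eqF.
  rewrite mulr_ge0// ?divr_ge0 ?(ltW sp) ?subr_ge0 ?(ltW ts)//.
  exact: ltW.
- have := cwg_slope (ltW pit0) pits st; rewrite gs' subr0 sub0r => h.
  rewrite -subr_ge0.
  have -> : - ((t - s) * g t) - drift_rate * (t - s) ^+ 2 =
    (t - s) / (s - pit) * (- g pit * (t - s) - g t * (s - pit)).
    rewrite /drift_rate; move: (g pit) (g t) => G H.
    by move: (pit) sp => p sp; field; rewrite gt_eqF.
  rewrite mulr_ge0// ?divr_ge0 ?(ltW sp) ?subr_ge0 ?(ltW st)//.
  exact: ltW.
Qed.

Lemma cwW_incr x y : 0 <= x -> x <= y -> y <= s -> cwW b k x <= cwW b k y.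
Proof.
move=> x0 xy ys; apply: (der_ge0_le xy (der_cwW k b0)) => t /andP[xt ty].
rewrite mulr_ge0 ?(ltW (cwW_gt0 _ _ _))// ltW// cwg_gt0//.
  exact: le_lt_trans xt.
exact: lt_le_trans ys.
Qed.

Lemma cwW_pit_lt : cwW b k pit < cwW b k (2 * pit).
Proof.
have p2 : pit < 2 * pit by move: pit0; lra.
have [c /andP[pc c2] e] := der_MVT p2 (der_cwW k b0).
rewrite -subr_gt0 e mulr_gt0 ?subr_gt0// mulr_gt0 ?cwW_gt0// cwg_gt0//.
  exact: lt_trans pc.
by apply: lt_trans c2 _; rewrite /pit; move: s0; lra.
Qed.

Lemma wint_indic_le n w : (0 < n)%N -> (forall t, 0 <= t <= pit -> cwW b k t <= w) ->
  wint b k n (\1_(`[0, pit]%classic)) <= pit * w ^+ n.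
Proof.
move=> n0 h; rewrite -[X in X * _](subr0 pit) mulrC.
rewrite -(hl_indic_itv (lexx 0) (ltW pit0)) -hlZ; last exact: edom_indic.
apply: hl_le; [apply: tame_edom => //; exact: tame_indic|exact/edomZ/edom_indic|].
move=> t t0; rewrite indicE; case: (boolP (t \in _)) => [|_]; last by rewrite mul0r mulr0.
rewrite inE/= in_itv/= => /h wt; rewrite mulr1 mul1r lerXn2r// nnegrE.
  exact: ltW (cwW_gt0 _ _ _).
exact: le_trans (ltW (cwW_gt0 _ _ _)) wt.
Qed.

(** From [x ^+ 2 / 2 <= expR x] at [x = n * l]. *)
Lemma expX_le (l : R) n : 0 < l -> (0 < n)%N -> expR (- l) ^+ n <= 2 / l ^+ 2 / n%:R ^+ 2.
Proof.
move=> l0 n0; have n0' : 0 < n%:R :> R by rewrite ltr0n.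
rewrite -expRM_natl mulrN expRN -[leRHS]invrK lef_pV2 ?posrE ?expR_gt0//; last first.
  by rewrite invr_gt0 !divr_gt0 ?exprn_gt0.
have := @expR_ge1Dxn R (n%:R * l) 1; rewrite mulr_ge0 ?(ltW l0)// => /(_ isT).
apply: le_trans; rewrite ler_wpDl//.
rewrite le_eqVlt; apply/orP; left; apply/eqP.
rewrite (_ : 2`!%:R = 2 :> R)//.
by move: (n%:R : R) n0' => x x0; field; rewrite (gt_eqF x0) (gt_eqF l0).
Qed.

Definition near_const := 2 / (ln (cwW b k (2 * pit) / cwW b k pit)) ^+ 2.

(** The weight increases on [0, s]: the interval [0, pit] is compared with
    [2 * pit, 3 * pit], of the same length, where the weight is larger by a
    constant factor to the power [n]. *)
Lemma pit_mass n : (0 < n)%N ->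
  wint b k n (\1_(`[0, pit]%classic)) <= near_const / n%:R ^+ 2 * wmass b k n.
Proof.
move=> n0; have Z0 := wmass_gt0 k b0 n0.
have w1 := cwW_gt0 b k pit; have w2 := cwW_gt0 b k (2 * pit).
have p3 : 3 * pit <= s by rewrite /pit; move: s0; lra.
apply: (@le_trans _ _ (pit * cwW b k pit ^+ n)).
  apply: wint_indic_le => // t /andP[t0 tp]; apply: cwW_incr => //; exact: ltW.
have ratio : 1 < cwW b k (2 * pit) / cwW b k pit.
  by rewrite ltr_pdivlMr// mul1r cwW_pit_lt.
have l0 := ln_gt0 ratio.
have := expX_le l0 n0; rewrite -/near_const expRN lnK ?posrE ?divr_gt0// => h.
have m : pit * cwW b k (2 * pit) ^+ n <= wmass b k n.
  rewrite -[X in X * _](_ : 3 * pit - 2 * pit = pit); last by ring.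
  apply: wmass_ge => //.
  - by rewrite mulr_ge0// ltW.
  - by move: pit0; lra.
  - exact: ltW.
  - move=> t /andP[t2 t3]; apply: cwW_incr => //; first by rewrite mulr_ge0// ltW.
    exact: le_trans p3.
have -> : pit * cwW b k pit ^+ n =
  (cwW b k (2 * pit) / cwW b k pit)^-1 ^+ n * (pit * cwW b k (2 * pit) ^+ n).
  rewrite mulrCA -exprMn; congr (_ * _ ^+ _).
  by rewrite invf_div divfK// gt_eqF.
apply: ler_pM => //; first by rewrite exprn_ge0// invr_ge0 divr_ge0// ltW.
by rewrite mulr_ge0 ?exprn_ge0 ?(ltW w2)// ltW.
Qed.

Definition drift_slope := b^-1 - (1 - tanh s ^+ 2).

Lemma cwg_lin t : `|g t + drift_slope * (t - s)| <= 2 * (t - s) ^+ 2.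
Proof.
have -> : g t + drift_slope * (t - s) =
    tanh t - tanh s - (1 - tanh s ^+ 2) * (t - s).
  rewrite /drift_slope /g /cwg.
  have -> : tanh s = (s - k) / b by apply/eqP; rewrite -subr_eq0; apply/eqP.
  by rewrite -[X in X + _](subrK ((s - k) / b)); ring.
exact: tanh_taylor.
Qed.

(** Otherwise, just above [s], the quadratic error in [cwg_lin] would contradict the
    linear lower bound of [drift_ge]. *)
Lemma drift_slope_gt0 : 0 < drift_slope.
Proof.
have c0 := drift_rate_gt0; set c := drift_rate in c0.
(* Small enough for [2 * x ^+ 2], the error of [cwg_lin], to be below [c * x]. *)
pose x := c / 4; have x0 : 0 < x by rewrite divr_gt0.
have pt : pit <= s + x by rewrite (le_trans (ltW pits))// lerDl ltW.
have := drift_ge pt; have := cwg_lin (s + x).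
rewrite -/c (_ : s + x - s = x); last by ring.
rewrite ler_norml => /andP[h1 _] h2.
have {}h2 : c * x <= - g (s + x).
  by rewrite -(ler_pM2l x0) mulrN mulrCA -expr2.
have : 0 < x * drift_slope.
  have xc : 0 < x * (c - 2 * x) by rewrite mulr_gt0// /x; move: c0; lra.
  by apply: lt_le_trans xc _; move: h1 h2; rewrite expr2; lra.
by rewrite pmulr_rgt0.
Qed.

(** Ratio between the densities of the mixing measure at [- t] and at [t]. *)
Definition fold_weight n t : R := expR (- (2 * n%:R * k / b * t)).

(** Beyond [pit] the ratio is at most [expR (- l) ^+ n], and [0, pit] has negligible mass. *)
Lemma fold_mass n : (0 < n)%N -> 0 < k ->
  wint b k n (fold_weight n) <=
  (near_const + 2 / (2 * k / b * pit) ^+ 2) / n%:R ^+ 2 * wmass b k n.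
Proof.
move=> n0 kp.
pose l := 2 * k / b * pit.
have l0 : 0 < l by rewrite mulr_gt0// divr_gt0// mulr_gt0.
have tf : tame (fold_weight n).
  apply: (@tame_bounded _ _ 1).
    by apply: continuous_measurable_fun; rewrite /fold_weight; apply: der_cont => t; der.
  move=> t t0; rewrite /fold_weight ger0_norm ?expR_ge0// -expR0 ler_expR oppr_le0.
  by rewrite mulr_ge0// divr_ge0 ?(ltW b0)// !mulr_ge0.
have tchi : tame (\1_(`[0, pit]%classic) : R -> R) by exact: tame_indic.
apply: (@le_trans _ _ (wint b k n (fun t => \1_(`[0, pit]%classic) t + expR (- l) ^+ n))).
  apply: wint_le => //; first by apply: tameD => //; exact: tame_cst.
  move=> t t0; have [tp|pt] := leP t pit.
    rewrite indicE mem_set/= ?in_itv/= ?t0//.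
    rewrite ler_wpDr ?exprn_ge0 ?expR_ge0//.
    rewrite /fold_weight -expR0 ler_expR oppr_le0.
    by rewrite mulr_ge0// divr_ge0 ?(ltW b0)// !mulr_ge0.
  apply: (@le_trans _ _ (expR (- l) ^+ n)); last by rewrite lerDr indicE.
  rewrite -expRM_natl ler_expR mulrN lerN2.
  have -> : n%:R * l = 2 * n%:R * k / b * pit by rewrite /l; ring.
  by rewrite ler_wpM2l ?(ltW pt)// divr_ge0 ?(ltW b0)// !mulr_ge0.
rewrite wintD//; last exact: tame_cst.
rewrite mulrDl [leRHS]mulrDl lerD ?pit_mass//.
rewrite (@eq_wint _ _ _ n (fun _ => expR (- l) ^+ n) (fun _ => expR (- l) ^+ n * 1)); last first.
  by move=> t _; rewrite mulr1.
rewrite wintZ//; last exact: tame_cst.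
by rewrite ler_wpM2r ?expX_le// ltW// wmass_gt0.
Qed.

End Drift.

(** * Expansion of local probabilities in the tilt *)

Section CoshBounds.
Variable R : realType.
Implicit Types (s t x : R).

(** The bounds from here to [cosh_le4] follow from one another by integration. *)
Lemma cosh_le3 x : 0 <= x <= 1 -> cosh x <= 3.
Proof.
move=> /andP[x0 x1].
have h : expR (1 / 2) <= 2 :> R.
  have := expR_ge1Dx (- (1 / 2) : R); rewrite expRN => h.
  have e0 : 0 < expR (1 / 2) :> R by exact: expR_gt0.
  have h2 : 1 / 2 <= (expR (1 / 2))^-1 :> R by apply: le_trans h; lra.
  by rewrite -lef_pV2 ?posrE//; apply: le_trans h2; rewrite div1r.
have h4 : expR x <= 4.
  apply: (@le_trans _ _ (expR 1)); first by rewrite ler_expR.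
  rewrite [X in expR X](_ : 1 = 1 / 2 + 1 / 2 :> R); last by field.
  rewrite expRD (_ : 4 = 2 * 2 :> R); last by ring.
  by rewrite ler_pM ?expR_ge0.
have h1 : expR (- x) <= 1 by rewrite -expR0 ler_expR oppr_le0.
by rewrite /cosh ler_pdivrMr//; move: h4 h1; lra.
Qed.

Lemma sinh_le x : 0 <= x <= 1 -> x <= sinh x <= 3 * x.
Proof.
move=> /andP[x0 x1]; apply/andP; split.
  have := @der_ge0_le R (fun y => sinh y - y) (fun y => cosh y - 1) 0 x x0.
  rewrite sinh0 subrr subr_ge0; apply.
    by move=> y; apply: der_eq; [der|rewrite mul1r].
  by move=> y _; rewrite subr_ge0 cosh_ge1.
have := @der_ge0_le R (fun y => 3 * y - sinh y) (fun y => 3 - cosh y) 0 x x0.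
rewrite sinh0 mulr0 subrr subr_ge0; apply.
  by move=> y; apply: der_eq; [der|rewrite mul1r mul0r add0r mulr1].
move=> y /andP[y0 yx]; rewrite subr_ge0 cosh_le3// (ltW y0)/=.
by rewrite (le_trans (ltW yx)).
Qed.

Lemma cosh_le2 x : 0 <= x <= 1 -> x ^+ 2 / 2 <= cosh x - 1 <= 3 / 2 * x ^+ 2.
Proof.
move=> /andP[x0 x1]; apply/andP; split.
  have := @der_ge0_le R (fun y => cosh y - 1 - y ^+ 2 / 2) (fun y => sinh y - y) 0 x x0.
  rewrite cosh0 subrr expr0n/= mul0r subrr subr_ge0; apply.
    by move=> y; apply: der_eq; [der|rewrite /=; field].
  move=> y /andP[y0 yx]; rewrite subr_ge0.
  have y01 : 0 <= y <= 1 by rewrite (ltW y0) (le_trans (ltW yx)).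
  by have /andP[] := sinh_le y01.
have := @der_ge0_le R (fun y => 3 / 2 * y ^+ 2 - (cosh y - 1)) (fun y => 3 * y - sinh y) 0 x x0.
rewrite cosh0 subrr expr0n/= mulr0 subrr subr_ge0; apply.
  by move=> y; apply: der_eq; [der|rewrite /=; field].
move=> y /andP[y0 yx]; rewrite subr_ge0.
have y01 : 0 <= y <= 1 by rewrite (ltW y0) (le_trans (ltW yx)).
  by have /andP[] := sinh_le y01.
Qed.

Lemma sinh_le3 x : 0 <= x <= 1 -> sinh x - x <= x ^+ 3 / 2.
Proof.
move=> /andP[x0 x1].
have := @der_ge0_le R (fun y => y ^+ 3 / 2 - (sinh y - y))
  (fun y => 3 / 2 * y ^+ 2 - (cosh y - 1)) 0 x x0.
rewrite sinh0 subrr expr0n/= mul0r subrr subr_ge0; apply.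
  by move=> y; apply: der_eq; [der|rewrite /=; field].
move=> y /andP[y0 yx]; rewrite subr_ge0.
have y01 : 0 <= y <= 1 by rewrite (ltW y0) (le_trans (ltW yx)).
  by have /andP[] := cosh_le2 y01.
Qed.

Lemma cosh_le4 x : 0 <= x <= 1 -> cosh x - 1 - x ^+ 2 / 2 <= x ^+ 4 / 8.
Proof.
move=> /andP[x0 x1].
have := @der_ge0_le R (fun y => y ^+ 4 / 8 - (cosh y - 1 - y ^+ 2 / 2))
  (fun y => y ^+ 3 / 2 - (sinh y - y)) 0 x x0.
rewrite cosh0 subrr !expr0n/= !mul0r !subrr subr_ge0; apply.
  by move=> y; apply: der_eq; [der|rewrite /=; field].
move=> y /andP[y0 yx]; rewrite subr_ge0 sinh_le3// (ltW y0)/=.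
by rewrite (le_trans (ltW yx)).
Qed.

Lemma sinhN x : sinh (- x) = - sinh x.
Proof. by rewrite /sinh opprK -mulNr opprB. Qed.

Lemma cosh_near0 x : `|x| <= 1 -> `|cosh x - 1| <= 3 / 2 * x ^+ 2 /\ `|sinh x - x| <= x ^+ 2.
Proof.
wlog x0 : x / 0 <= x.
  move=> h x1; have [/h|/ltW x0] := leP 0 x; first exact.
  have := h (- x); rewrite oppr_ge0 => /(_ x0); rewrite normrN => /(_ x1).
  by rewrite coshN sinhN sqrrN -opprD normrN.
rewrite ger0_norm// => x1; have x01 : 0 <= x <= 1 by rewrite x0.
have /andP[h1 h2] := cosh_le2 x01; have h3 := sinh_le3 x01.
have /andP[h4 _] := sinh_le x01.
rewrite !ger0_norm ?subr_ge0 ?cosh_ge1//; split=> //.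
apply: le_trans h3 _; rewrite exprS ler_pdivrMr// mulrC ler_wpM2l ?sqr_ge0//.
by rewrite (le_trans x1)// ler1n.
Qed.

Lemma coshD s x : cosh (s + x) = cosh s * cosh x + sinh s * sinh x.
Proof.
rewrite /cosh /sinh opprD !expRD.
by move: (expR s) (expR (- s)) (expR x) (expR (- x)) => a b c d; field.
Qed.

Lemma cosh_le_expR s : 0 <= s -> cosh s <= expR s.
Proof.
move=> s0; rewrite /cosh ler_pdivrMr// mulr_natr mulr2n lerD2l ler_expR.
by rewrite (@le_trans _ _ 0)// oppr_le0.
Qed.

Lemma sinh_le_expR s : 0 <= s -> 0 <= sinh s <= expR s.
Proof.
move=> s0; rewrite sinh_ge0//= /sinh ler_pdivrMr// mulr_natr mulr2n lerD2l.
by rewrite (@le_trans _ _ 0) ?expR_ge0// oppr_le0 expR_ge0.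
Qed.

Let sqrt_pi m : (0 < m)%N -> Num.sqrt (pi * m%:R) <= 2 * Num.sqrt m%:R :> R.
Proof.
move=> m0; rewrite sqrtrM ?pi_ge0// ler_wpM2r ?sqrtr_ge0//.
rewrite -(@ler_pXn2r _ 2)// ?nnegrE ?sqrtr_ge0// sqr_sqrtr ?pi_ge0//.
by have := pihalf_lt2 R; rewrite expr2; lra.
Qed.

Let sqrt_ge1 m : (0 < m)%N -> 1 <= Num.sqrt m%:R :> R.
Proof. by move=> m0; rewrite -[X in X <= _]sqrtr1 ler_wsqrtr// ler1n. Qed.

(** For [`|t - s| <= 1] this is Taylor's formula. Farther away only [F <= sqrt (pi * m)]
    is known; [sqrt m * (t - s) ^+ 4] dominates it and still has a small mean. *)
Lemma pointwise_expansion s : 0 <= s -> exists2 C, 0 <= C &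
  forall m t F, (0 < m)%N -> 0 <= F <= Num.sqrt (pi * m%:R) ->
  `|F - cosh t| <= 7 * cosh t ^+ 5 / m%:R ->
  `|F - (cosh s + sinh s * (t - s))| <=
  C * (m%:R^-1 + (t - s) ^+ 2 + Num.sqrt m%:R * (t - s) ^+ 4).
Proof.
move=> s0; pose K := 5 * expR s.
have e1 : 1 <= expR s by rewrite -expR0 ler_expR.
have K1 : 1 <= K by rewrite /K; lra.
have cs := cosh_le_expR s0; have /andP[ss0 ss] := sinh_le_expR s0.
have cs0 := cosh_gt0 s.
have K5 : 0 <= K ^+ 5 by rewrite exprn_ge0//; lra.
exists (7 * K ^+ 5 + K + 2); first by lra.
move=> m t F m0 /andP[F0 F1] hF.
have m0' : 0 < m%:R :> R by rewrite ltr0n.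
have sm := sqrt_pi m0; have sm1 := sqrt_ge1 m0.
set x := t - s; have tE : t = s + x by rewrite /x addrC subrK.
have mi : 0 < m%:R^-1 :> R by rewrite invr_gt0.
have x2 : 0 <= x ^+ 2 by exact: sqr_ge0.
have x4 : 0 <= x ^+ 4 by rewrite (exprM x 2 2) sqr_ge0.
have sx4 : 0 <= Num.sqrt m%:R * x ^+ 4 by rewrite mulr_ge0 ?sqrtr_ge0.
have [x1|x1] := leP `|x| 1.
  have [h1 h2] := cosh_near0 x1.
  have x21 : x ^+ 2 <= 1 by rewrite -[x ^+ 2]real_normK ?num_real// expr_le1.
  have ct : cosh t <= K.
    rewrite tE coshD; move: h1 h2; rewrite !ler_norml => /andP[_ h1] /andP[_ h2].
    have hx : x <= 1 by apply: le_trans x1; exact: ler_norm.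
    have a1 : cosh s * cosh x <= expR s * 3.
      by rewrite ler_pM// ?(ltW cs0) ?(ltW (cosh_gt0 _))//; lra.
    have a2 : sinh s * sinh x <= expR s * 2.
      apply: (@le_trans _ _ (sinh s * 2)); last by rewrite ler_wpM2r.
      by rewrite ler_wpM2l//; lra.
    by rewrite /K; lra.
  have hE : `|cosh t - (cosh s + sinh s * x)| <= K * x ^+ 2.
    have -> : cosh t - (cosh s + sinh s * x) =
       cosh s * (cosh x - 1) + sinh s * (sinh x - x) by rewrite tE coshD; ring.
    apply: le_trans (ler_normD _ _) _; rewrite [`|cosh s * _|]normrM [`|sinh s * _|]normrM.
    rewrite (gtr0_norm cs0) (ger0_norm ss0).
    have a1 : cosh s * `|cosh x - 1| <= expR s * (3 / 2 * x ^+ 2).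
      by rewrite ler_pM// ltW.
    have a2 : sinh s * `|sinh x - x| <= expR s * x ^+ 2 by rewrite ler_pM.
    have a3 : 0 <= expR s * x ^+ 2 by rewrite mulr_ge0// expR_ge0.
    by apply: le_trans (lerD a1 a2) _; rewrite /K; lra.
  have -> : F - (cosh s + sinh s * x) =
    (F - cosh t) + (cosh t - (cosh s + sinh s * x)) by rewrite addrA subrK.
  apply: le_trans (ler_normD _ _) _.
  have hF' : `|F - cosh t| <= 7 * K ^+ 5 * m%:R^-1.
    apply: le_trans hF _; rewrite ler_pM2r// ler_pM2l//.
    by rewrite lerXn2r// ?nnegrE ?(ltW (cosh_gt0 _))//; lra.
  apply: le_trans (lerD hF' hE) _.
  set a := m%:R^-1 in mi *; set d := Num.sqrt _ * _ in sx4 *.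
  set K' := K ^+ 5 in K5 *.
  rewrite -subr_ge0.
  have -> : (7 * K' + K + 2) * (a + x ^+ 2 + d) - (7 * K' * a + K * x ^+ 2) =
    (K + 2) * a + (7 * K' + 2) * x ^+ 2 + (7 * K' + K + 2) * d by ring.
  by rewrite !addr_ge0// mulr_ge0//; lra.
have ax : 1 <= `|x| by exact: ltW.
have x4' : `|x| <= x ^+ 4.
  have -> : x ^+ 4 = `|x| ^+ 4 by rewrite -normrX ger0_norm.
  by rewrite ler_eXnr.
have x41 : 1 <= x ^+ 4 by exact: le_trans x4'.
have b1 : F <= 2 * (Num.sqrt m%:R * x ^+ 4).
  by apply: (le_trans F1); apply: (le_trans sm); rewrite ler_pM2l// ler_peMr ?sqrtr_ge0.
have sx : x ^+ 4 <= Num.sqrt m%:R * x ^+ 4 by rewrite ler_peMl.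
have b2 : `|cosh s + sinh s * x| <= K * (Num.sqrt m%:R * x ^+ 4).
  apply: le_trans (ler_normD _ _) _; rewrite [`|sinh s * _|]normrM.
  rewrite (gtr0_norm cs0) (ger0_norm ss0).
  apply: (@le_trans _ _ (expR s * (2 * x ^+ 4))).
    have a1 : cosh s <= expR s * x ^+ 4 by rewrite (le_trans cs)// ler_peMr// expR_ge0.
    have a2 : sinh s * `|x| <= expR s * x ^+ 4 by rewrite ler_pM.
    by apply: le_trans (lerD a1 a2) _; lra.
  have a3 : expR s * x ^+ 4 <= expR s * (Num.sqrt m%:R * x ^+ 4).
    by rewrite ler_wpM2l ?expR_ge0.
  have a4 : 0 <= expR s * (Num.sqrt m%:R * x ^+ 4) by rewrite mulr_ge0// expR_ge0.
  by rewrite /K; lra.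
apply: le_trans (ler_normB _ _) _; rewrite (ger0_norm F0).
apply: le_trans (lerD b1 b2) _.
set d := Num.sqrt _ * _ in sx4 *; set a := m%:R^-1 in mi *; set K' := K ^+ 5 in K5 *.
rewrite -subr_ge0.
have -> : (7 * K' + K + 2) * (a + x ^+ 2 + d) - (2 * d + K * d) =
  (7 * K' + K + 2) * (a + x ^+ 2) + 7 * K' * d by ring.
by rewrite !addr_ge0// mulr_ge0// ?addr_ge0// ?(ltW mi)//; lra.
Qed.

(** Second-order version around [0] for the critical point, where [t] is of order
    [n ^ (-1/4)]; there the crude bound has to be absorbed by an eighth power. *)
Lemma pointwise_expansion0 : exists2 C, 0 <= C &
  forall m t F, (0 < m)%N -> 0 <= F <= Num.sqrt (pi * m%:R) ->
  `|F - cosh t| <= 7 * cosh t ^+ 5 / m%:R ->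
  `|F - (1 + t ^+ 2 / 2)| <= C * (m%:R^-1 + t ^+ 4 + Num.sqrt m%:R * t ^+ 8).
Proof.
pose K : R := 7 * 3 ^+ 5 + 4.
have K0 : 0 <= K by rewrite /K; lra.
exists K => // m t F m0 /andP[F0 F1] hF.
have m0' : 0 < m%:R :> R by rewrite ltr0n.
have sm := sqrt_pi m0; have sm1 := sqrt_ge1 m0.
have mi : 0 < m%:R^-1 :> R by rewrite invr_gt0.
have x2 : 0 <= t ^+ 2 by exact: sqr_ge0.
have x4 : 0 <= t ^+ 4 by rewrite (exprM t 2 2) sqr_ge0.
have x8 : 0 <= t ^+ 8 by rewrite (exprM t 4 2) sqr_ge0.
have sx8 : 0 <= Num.sqrt m%:R * t ^+ 8 by rewrite mulr_ge0 ?sqrtr_ge0.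
have tn : cosh t = cosh `|t| by case: ger0P => // _; rewrite coshN.
have [x1|x1] := leP `|t| 1.
  have t01 : 0 <= `|t| <= 1 by rewrite normr_ge0.
  have c3 := cosh_le3 t01; have c4 := cosh_le4 t01.
  have /andP[c2 _] := cosh_le2 t01.
  rewrite -tn in c2 c3 c4; rewrite -!normrX !ger0_norm// in c2 c4.
  have -> : F - (1 + t ^+ 2 / 2) = (F - cosh t) + (cosh t - 1 - t ^+ 2 / 2) by ring.
  apply: le_trans (ler_normD _ _) _; rewrite [X in _ + X]ger0_norm ?subr_ge0//.
  have hF' : `|F - cosh t| <= 7 * 3 ^+ 5 * m%:R^-1.
    apply: le_trans hF _; rewrite ler_pM2r// ler_pM2l//.
    by rewrite lerXn2r// ?nnegrE ?(ltW (cosh_gt0 _)).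
  apply: le_trans (lerD hF' c4) _; rewrite /K.
  by move: (m%:R^-1) (Num.sqrt _ * _) (t ^+ 4) mi sx8 x4 => a d e; lra.
have ax : 1 <= `|t| by exact: ltW.
have x28 : t ^+ 2 <= t ^+ 8.
  rewrite -(ger0_norm x2) -(ger0_norm x8) !normrX.
  by rewrite ler_weXn2l.
have x81 : 1 <= t ^+ 8 by rewrite -(ger0_norm x8) normrX exprn_ege1.
have b1 : F <= 2 * (Num.sqrt m%:R * t ^+ 8).
  by apply: (le_trans F1); apply: (le_trans sm); rewrite ler_pM2l// ler_peMr ?sqrtr_ge0.
have sx : t ^+ 8 <= Num.sqrt m%:R * t ^+ 8 by rewrite ler_peMl.
apply: le_trans (ler_normB _ _) _; rewrite (ger0_norm F0) ger0_norm; last by lra.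
rewrite /K; move: (m%:R^-1) (Num.sqrt _ * _) (t ^+ 4) mi sx8 x4 b1 sx => a d e mi sx8' x4' b1 sx.
by lra.
Qed.

End CoshBounds.

(** * Concentration of the mixing measure *)

Section Concentration.
Variable R : realType.
Implicit Types (b k s t : R) (f : R -> R) (n : nat).

(** Concentration of the mixing measure around [s] at scale [n ^ (-1/2)], with a bias of
    order [1 / n]. The factor [sinh s] drops the bias at [s = 0], where the mean on
    the half-line is really of order [n ^ (-1/2)]. The last bound makes the folded
    half negligible. *)
Definition concentrated b k s := exists2 C : R, 0 <= C & forall n, (0 < n)%N ->
  [/\ wint b k n (fun t => (t - s) ^+ 2) <= C / n%:R * wmass b k n,
      wint b k n (fun t => (t - s) ^+ 4) <= C / n%:R ^+ 2 * wmass b k n,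
      `|sinh s * wint b k n (fun t => t - s)| <= C / n%:R * wmass b k n &
      0 < k -> wint b k n (fold_weight b k n) <= C / n%:R ^+ 2 * wmass b k n].

(** For [b < 1] the inequality [tanh t <= t] gives a linear drift towards [0] on the whole
    half-line, and the cut-off can be [0]. *)
Lemma concentrated_sub b : 0 < b -> b < 1 -> concentrated b 0 0.
Proof.
move=> b0 b1; pose c := b^-1 - 1.
have c0 : 0 < c by rewrite subr_gt0 invf_gt1.
have drift t : 0 <= t -> c * (t - 0) ^+ 2 <= - ((t - 0) * cwg b 0 t).
  move=> t0; rewrite /cwg !subr0 -subr_ge0.
  have -> : - (t * (tanh t - t / b)) - c * t ^+ 2 = t * (t - tanh t) by rewrite /c; ring.
  by rewrite mulr_ge0// subr_ge0 tanh_le.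
have drift0 t : 0 <= t -> (t - 0) * cwg b 0 t <= 0.
  by move=> t0; rewrite -oppr_ge0; apply: le_trans (drift t t0); rewrite mulr_ge0 ?sqr_ge0// ltW.
(* The cut-off interval is the single point [0], of measure zero. *)
have near0 n : (0 < n)%N -> wint b 0 n (\1_(`[0, 0]%classic)) <= 0 / n%:R ^+ 2 * wmass b 0 n.
  move=> n0; rewrite !mul0r.
  pose w := cwW b 0 0.
  apply: (@le_trans _ _ (hl (fun t => w ^+ n * \1_(`[0 : R, 0]%classic) t))).
    apply: hl_le; [by apply: tame_edom => //; exact: tame_indic|exact/edomZ/edom_indic|].
    move=> t t0; rewrite indicE; case: (boolP (t \in _)) => [|_]; last by rewrite mul0r mulr0.
    by rewrite inE/= in_itv/= -eq_le => /eqP <-; rewrite mul1r mulr1.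
  by rewrite hlZ ?hl_indic_itv// ?subrr ?mulr0//; exact: edom_indic.
pose C := c^-1 + fourth_const 0 c 0.
have C40 : 0 <= fourth_const 0 c 0.
  by rewrite /fourth_const !expr0n/= !mul0r !addr0 !mulr_ge0 ?invr_ge0 ?(ltW c0).
have C0 : 0 <= C by rewrite addr_ge0// invr_ge0 ltW.
exists C => // n n0; have Z0 := wmass_gt0 0 b0 n0; have n0' : 0 < n%:R :> R by rewrite ltr0n.
split.
- apply: le_trans (@second_moment R b 0 b0 0 c 0 0 _ _ _ _ _ _ _ _ n n0) _ => //.
  by rewrite ler_pM2r// ler_pM2r ?invr_gt0// expr0n/= mul0r addr0 /C lerDl.
- apply: le_trans (@fourth_moment R b 0 b0 0 c 0 0 _ _ _ _ _ _ _ _ n n0) _ => //.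
  by rewrite ler_pM2r// ler_pM2r ?invr_gt0 ?exprn_gt0// /C lerDr invr_ge0 ltW.
- by rewrite sinh0 mul0r normr0 mulr_ge0 ?(ltW Z0)// divr_ge0.
- by rewrite ltxx.
Qed.

Lemma concentrated_super b k s : 0 < b -> 0 <= k -> 0 < s -> cwg b k s = 0 ->
  concentrated b k s.
Proof.
move=> b0 k0 s0 gs.
have c0 := drift_rate_gt0 b0 k0 s0 gs; set c := drift_rate b k s in c0.
set r := near_const b k s.
have r0 : 0 <= r by rewrite /r /near_const divr_ge0// sqr_ge0.
have p0 : 0 <= pit s by rewrite /pit divr_ge0// ltW.
have ps : pit s <= s by rewrite /pit; lra.
have K0 := drift_slope_gt0 b0 k0 s0 gs.
have h1 t : 0 <= t -> (t - s) * cwg b k t <= 0 by exact: drift_le0.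
have h2 t : pit s <= t -> c * (t - s) ^+ 2 <= - ((t - s) * cwg b k t) by exact: drift_ge.
have h3 n : (0 < n)%N -> wint b k n (\1_(`[0, pit s]%classic)) <= r / n%:R ^+ 2 * wmass b k n.
  by move=> n0; exact: (pit_mass b0 k0 s0 gs).
pose A := c^-1 + s ^+ 2 * r.
have A0 : 0 <= A by rewrite addr_ge0 ?invr_ge0 ?(ltW c0)// mulr_ge0// sqr_ge0.
pose B := fourth_const s c r.
have B0 : 0 <= B.
  rewrite /B /fourth_const -/A addr_ge0//; first by rewrite !mulr_ge0// invr_ge0 ltW.
  by rewrite mulr_ge0// exprn_ge0// ltW.
pose D := sinh s * ((drift_slope b s)^-1 * (s^-1 + 2 * A)).
have D0 : 0 <= D.
  rewrite /D mulr_ge0 ?sinh_ge0 ?(ltW s0)// mulr_ge0 ?invr_ge0 ?(ltW K0)//.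
  by rewrite addr_ge0 ?invr_ge0 ?(ltW s0)// mulr_ge0.
pose E := r + 2 / (2 * k / b * pit s) ^+ 2.
have E0 : 0 <= E by rewrite addr_ge0// divr_ge0// sqr_ge0.
pose F : R := A + B + D + E.
exists F; first by apply: addr_ge0 => //; apply: addr_ge0 => //; exact: addr_ge0.
rewrite /F => n n0; have Z0 := wmass_gt0 k b0 n0; have n0' : 0 < n%:R :> R by rewrite ltr0n.
split.
- apply: le_trans (second_moment b0 (ltW s0) c0 ps p0 r0 h1 h2 h3 n0) _.
  by rewrite ler_pM2r// ler_pM2r ?invr_gt0// -/A; lra.
- apply: le_trans (fourth_moment b0 (ltW s0) c0 ps p0 r0 h1 h2 h3 n0) _.
  by rewrite ler_pM2r// ler_pM2r ?invr_gt0 ?exprn_gt0// -/B; lra.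
- rewrite normrM ger0_norm ?sinh_ge0 ?(ltW s0)//.
  have lin t : 0 <= t -> `|cwg b k t + drift_slope b s * (t - s)| <= 2 * (t - s) ^+ 2.
    by move=> _; exact: cwg_lin.
  have W0 t : 0 <= t <= s -> cwW b k 0 <= cwW b k t.
    by move=> /andP[t0 ts]; apply: (cwW_incr b0 k0 s0 gs).
  have := first_moment b0 (ltW s0) c0 ps p0 r0 h1 h2 h3 K0 (ler0n _ 2) s0 lin W0 n0.
  move=> h; apply: le_trans (ler_wpM2l (sinh_ge0 (ltW s0)) h) _.
  rewrite mulrA ler_pM2r// mulrA ler_pM2r ?invr_gt0// -/A -/D; lra.
- move=> kp; apply: le_trans (fold_mass b0 k0 s0 gs n0 kp) _.
  by rewrite ler_pM2r// ler_pM2r ?invr_gt0 ?exprn_gt0// -/r -/E; lra.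
Qed.

(** What the upper and lower bounds [bal n./2] and [bal_low n] have in common, as
    functions of the tilt. *)
Definition local_prob n f := [/\ tame f, forall t, 0 <= f t <= 1 &
  forall t, `|Num.sqrt (pi * n./2%:R) * f t - cosh t| <= 7 * cosh t ^+ 5 / n./2%:R].

Lemma half_bounds n : (1 < n)%N -> [/\ (0 < n./2)%N, (n./2%:R)^-1 <= 3 / n%:R :> R
   & n./2%:R <= n%:R :> R].
Proof.
move=> n1; have m0 : (0 < n./2)%N by rewrite half_gt0.
have n0' : 0 < n%:R :> R by rewrite ltr0n ltnW.
have m0' : 0 < n./2%:R :> R by rewrite ltr0n.
have nE := odd_double_half n; split=> //.
  rewrite ler_pdivlMr// mulrC ler_pdivrMr// -natrM ler_nat -{1}nE -mul2n.
  by rewrite (_ : 3 * n./2 = n./2 + 2 * n./2)%N ?leq_add2r; [case: (odd n)|rewrite -mulSn].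
by rewrite ler_nat -{2}nE -addnn addnA leq_addl.
Qed.

Lemma wint_expansion b k s : 0 < b -> 0 <= s -> concentrated b k s ->
  exists2 C, 0 <= C & forall n f, (1 < n)%N -> local_prob n f ->
  `|Num.sqrt (pi * n./2%:R) * wint b k n f - cosh s * wmass b k n|
    <= C / n%:R * wmass b k n.
Proof.
move=> b0 s0 [C C0 hC]; have [D D0 hD] := pointwise_expansion s0.
exists (D * (3 + 2 * C) + C); first by rewrite addr_ge0// mulr_ge0// addr_ge0// mulr_ge0.
move=> n f n1 [tf f01 hf]; have [m0 mn mn'] := half_bounds n1.
set m := n./2 in hf m0 mn mn' *.
have n0 : (0 < n)%N by exact: ltnW.
have n0' : 0 < n%:R :> R by rewrite ltr0n.
have Z0 := wmass_gt0 k b0 n0.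
have [M2 M4 M1 _] := hC n n0.
set Z := wmass b k n in Z0 M1 M2 M4 *.
pose sq := Num.sqrt (pi * m%:R) : R.
have sq0 : 0 <= sq by rewrite sqrtr_ge0.
have tX : tame (fun t => t - s) by tame.
have hF t : 0 <= t -> `|sq * f t - (cosh s + sinh s * (t - s))| <=
   D * (m%:R^-1 + (t - s) ^+ 2 + Num.sqrt m%:R * (t - s) ^+ 4).
  move=> t0; apply: hD => //.
  by have /andP[a1 a2] := f01 t; rewrite mulr_ge0//= ler_piMr.
have tE : tame (fun t => D * (m%:R^-1 + (t - s) ^+ 2 + Num.sqrt m%:R * (t - s) ^+ 4)) by tame.
have tL : tame (fun t => sq * f t + - (cosh s + sinh s * (t - s))) by tame.
have hI : `|wint b k n (fun t => sq * f t + - (cosh s + sinh s * (t - s)))| <=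
  wint b k n (fun t => D * (m%:R^-1 + (t - s) ^+ 2 + Num.sqrt m%:R * (t - s) ^+ 4)).
  by apply: wint_norm_le.
move: hI; rewrite wintD//; try by tame.
rewrite wintZ// wintN//; try by tame.
rewrite wintD//; try by tame.
rewrite [wint b k n (fun _ => cosh s)](_ : _ = cosh s * Z); last first.
  rewrite /Z /wmass -wintZ//; try by tame.
  by apply: eq_wint => t _; rewrite mulr1.
rewrite [wint b k n (fun t => sinh s * _)]wintZ//.
rewrite [X in _ <= X -> _]wintZ//; try by tame.
rewrite [X in _ <= D * X]wintD//; try by tame.
rewrite [X in _ <= D * (X + _)]wintD//; try by tame.
rewrite [wint b k n (fun _ => _^-1)](_ : _ = m%:R^-1 * Z); last first.
  rewrite /Z /wmass -wintZ//; try by tame.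
  by apply: eq_wint => t _; rewrite mulr1.
rewrite [wint b k n (fun t => _ * (t - s) ^+ 4)]wintZ//; try by tame.
move=> hI.
have -> : sq * wint b k n f - cosh s * Z =
  (sq * wint b k n f - (cosh s * Z + sinh s * wint b k n (fun t => t - s)))
  + sinh s * wint b k n (fun t => t - s) by ring.
apply: le_trans (ler_normD _ _) _; apply: le_trans (lerD hI M1) _.
rewrite mulrDl mulrDl lerD//.
rewrite -!mulrA ler_wpM2l//.
have a1 : m%:R^-1 * Z <= 3 / n%:R * Z by rewrite ler_pM2r.
have a3 : Num.sqrt m%:R * wint b k n (fun t => (t - s) ^+ 4) <= C / n%:R * Z.
  have sm : Num.sqrt m%:R <= n%:R :> R.
    apply: le_trans mn'.
    rewrite -(@ler_pXn2r _ 2)// ?nnegrE ?sqrtr_ge0// sqr_sqrtr// -natrX ler_nat.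
    by rewrite -mulnn leq_pmulr.
  apply: (@le_trans _ _ (n%:R * (C / n%:R ^+ 2 * Z))).
    apply: ler_pM => //.
    by apply: wint_ge0 => //; [tame|move=> t _; rewrite (exprM _ 2 2) sqr_ge0].
  rewrite le_eqVlt; apply/orP; left; apply/eqP.
  by field; rewrite gt_eqF.
apply: le_trans (lerD (lerD a1 M2) a3) _.
by rewrite le_eqVlt; apply/orP; left; apply/eqP; ring.
Qed.

End Concentration.

(** * Averages over the folded mixing measure *)

Section Fold.
Variable R : realType.
Implicit Types (b k s t : R) (f : R -> R) (n : nat).

Lemma tame_fold b k n : 0 < b -> 0 <= k -> tame (fold_weight b k n).
Proof.
move=> b0 k0; apply: (@tame_bounded _ _ 1).
  by apply: continuous_measurable_fun; rewrite /fold_weight; apply: der_cont => t; der.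
move=> t t0; rewrite /fold_weight ger0_norm ?expR_ge0// -expR0 ler_expR oppr_le0.
by rewrite mulr_ge0// divr_ge0 ?(ltW b0)// !mulr_ge0.
Qed.

(** The summand [fold_weight] accounts for the half-line [t <= 0], for an even [f]. *)
Definition vint b k n f : R := wint b k n (fun t => f t * (1 + fold_weight b k n t)).

Definition vexp b k n f : R := vint b k n f / vint b k n (fun _ => 1).

Lemma vintE b k n f : 0 < b -> 0 <= k -> (0 < n)%N -> tame f ->
  vint b k n f = wint b k n f + wint b k n (fun t => f t * fold_weight b k n t).
Proof.
move=> b0 k0 n0 tf; have tw := tame_fold n b0 k0.
rewrite -wintD//; last by tame.
by apply: eq_wint => t _; rewrite mulrDr mulr1.
Qed.

Lemma vmass_gt0 b k n : 0 < b -> 0 <= k -> (0 < n)%N -> 0 < vint b k n (fun _ => 1).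
Proof.
move=> b0 k0 n0; have tw := tame_fold n b0 k0.
rewrite vintE//; last exact: tame_cst.
rewrite ltr_wpDr ?wmass_gt0// wint_ge0//; first by tame.
by move=> t _; rewrite mul1r expR_ge0.
Qed.

(** The folded half changes both integrals of the ratio by at most its own mass. *)
Lemma vexp_sub_le b k n f : 0 < b -> 0 <= k -> (0 < n)%N -> tame f ->
  (forall t, 0 <= f t <= 1) ->
  `|vexp b k n f - wint b k n f / wmass b k n| <=
  wint b k n (fold_weight b k n) / wmass b k n.
Proof.
move=> b0 k0 n0 tf f01; have tw := tame_fold n b0 k0.
have Z0 := wmass_gt0 k b0 n0; have V0 := vmass_gt0 b0 k0 n0.
have w0 t : 0 <= fold_weight b k n t by exact: expR_ge0.
have f0 t : 0 <= f t by case/andP: (f01 t).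
have f1 t : f t <= 1 by case/andP: (f01 t).
rewrite /vexp; move: V0; rewrite !vintE//; try by tame.
rewrite (@eq_wint _ _ _ n (fun t => 1 * _) (fold_weight b k n)); last first.
  by move=> t _; rewrite mul1r.
rewrite -/(wmass b k n).
set Z := wmass _ _ _ in Z0 *; set E := wint b k n (fold_weight b k n).
set A := wint b k n f; set B := wint b k n (fun t => f t * _) => V0.
have E0 : 0 <= E by apply: wint_ge0 => //; tame.
have A0 : 0 <= A by apply: wint_ge0 => //; tame.
have B0 : 0 <= B by apply: wint_ge0 => //; [tame|move=> t _; rewrite mulr_ge0].
have A1 : A <= Z by apply: wint_le => //; tame.
have B1 : B <= E.
  by apply: wint_le => //; [tame|move=> t _; rewrite ler_piMl].
have -> : (A + B) / (Z + E) - A / Z = (Z * B - A * E) / (Z * (Z + E)).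
  by clearbody A B Z E; field; rewrite !gt_eqF.
rewrite normrM normfV (gtr0_norm (mulr_gt0 Z0 V0)).
apply: (@le_trans _ _ (Z * E / (Z * (Z + E)))).
  rewrite ler_pM2r ?invr_gt0 ?(mulr_gt0 Z0 V0)//.
  have h1 : 0 <= Z * B by rewrite mulr_ge0// ltW.
  have h2 : 0 <= A * E by rewrite mulr_ge0.
  have h3 : Z * B <= Z * E by rewrite ler_wpM2l// ltW.
  have h4 : A * E <= Z * E by rewrite ler_wpM2r.
  by rewrite ler_norml; apply/andP; split; lra.
have -> : Z * E / (Z * (Z + E)) = E / (Z + E).
  by clearbody A B Z E; field; rewrite !gt_eqF.
by rewrite ler_wpM2l// lef_pV2 ?posrE// lerDl.
Qed.

Lemma vexp_symmetric b n f : 0 < b -> (0 < n)%N -> tame f ->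
  vexp b 0 n f = wint b 0 n f / wmass b 0 n.
Proof.
move=> b0 n0 tf; have t2 : 2 != 0 :> R by [].
have fw : fold_weight b 0 n = (fun _ => 1).
  by apply/funext => t; rewrite /fold_weight mulr0 mul0r mul0r oppr0 expR0.
have v2 g : tame g -> vint b 0 n g = 2 * wint b 0 n g.
  move=> tg; rewrite /vint fw -wintZ//.
  by apply: eq_wint => t _; rewrite mulrC.
rewrite /vexp !v2//; last exact: tame_cst.
by rewrite -mulf_div divff// mul1r.
Qed.

(** For [k = 0] the fold is a constant factor and cancels. For [k > 0] it has mass
    [O(n ^- 2)], while the normalization [sqrt (pi * n./2)] costs only [sqrt n]. *)
Lemma vexp_expansion b k s : 0 < b -> 0 <= k -> 0 <= s -> concentrated b k s ->
  exists2 C, 0 <= C & forall n f, (1 < n)%N -> local_prob n f ->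
  `|Num.sqrt (pi * n./2%:R) * vexp b k n f - cosh s| <= C / n%:R.
Proof.
move=> b0 k0 s0 cc; have [C C0 hC] := wint_expansion b0 s0 cc.
have [D D0 hD] := cc.
exists (C + 2 * D); first by rewrite addr_ge0// mulr_ge0.
move=> n f n1 lf; have [tf f01 _] := lf; have [m0 _ mn] := half_bounds R n1.
have n0 : (0 < n)%N by exact: ltnW.
have n0' : 0 < n%:R :> R by rewrite ltr0n.
have Z0 := wmass_gt0 k b0 n0.
have := hC n f n1 lf; set sq := Num.sqrt _ => h.
have {}h : `|sq * (wint b k n f / wmass b k n) - cosh s| <= C / n%:R.
  have -> : sq * (wint b k n f / wmass b k n) - cosh s =
      (sq * wint b k n f - cosh s * wmass b k n) / wmass b k n.
    by rewrite mulrBl mulfK ?gt_eqF// mulrA.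
  by rewrite normrM normfV (gtr0_norm Z0) ler_pdivrMr.
have sq0 : 0 <= sq by rewrite sqrtr_ge0.
suff h2 : `|vexp b k n f - wint b k n f / wmass b k n| <= D / n%:R ^+ 2.
  have -> : sq * vexp b k n f - cosh s = (sq * (wint b k n f / wmass b k n) - cosh s)
     + sq * (vexp b k n f - wint b k n f / wmass b k n) by ring.
  apply: le_trans (ler_normD _ _) _; rewrite mulrDl lerD//.
  rewrite normrM (ger0_norm sq0).
  have sqn : sq <= 2 * n%:R.
    rewrite -(@ler_pXn2r _ 2)// ?nnegrE ?mulr_ge0// sqr_sqrtr ?mulr_ge0 ?pi_ge0//.
    have p4 : pi <= 4 :> R by have := pihalf_lt2 R; lra.
    apply: (@le_trans _ _ (4 * n%:R)); first by rewrite ler_pM ?pi_ge0.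
    by rewrite exprMn -natrX ler_pM2l// expr2 ler_peMr// ler1n.
  apply: le_trans (ler_pM sq0 (normr_ge0 _) sqn h2) _.
  by rewrite le_eqVlt; apply/orP; left; apply/eqP; field; rewrite gt_eqF.
move: k0; rewrite le_eqVlt => /predU1P[k0|k0].
  by rewrite -k0 vexp_symmetric// subrr normr0 divr_ge0// exprn_ge0// ltW.
apply: le_trans (vexp_sub_le b0 (ltW k0) n0 tf f01) _.
rewrite ler_pdivrMr//.
by have [_ _ _ /(_ k0)] := hD n n0.
Qed.

End Fold.

Section LocalProb.
Variable R : realType.

Lemma continuous_bal m : continuous (@bal R m).
Proof.
suff h N F : (forall i : 'I_N, continuous (F i)) ->
    continuous (fun a : R => \sum_(i < N) F i a : R).
  apply: h => i; apply: der_cont => a.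
  by apply: der_mul; [apply: der_mul; [der|]|der]; last first; der.
elim: N F => [|N ih] F cF.
  under eq_fun do rewrite big_ord0.
  by move=> a; exact: cvg_cst.
under eq_fun do rewrite big_ord_recr/=.
by move=> a; apply: cvgD; [apply: ih => i; exact: cF|exact: cF].
Qed.

Let cinv2 : continuous (fun t : R => cosh t ^- 2).
Proof.
apply: (@der_cont _ _ (fun t => - (2%:R * cosh t ^+ 2.-1 * (1 * sinh t)) / (cosh t ^+ 2) ^+ 2)) => t.
apply: der_inv; first by rewrite expf_neq0// gt_eqF// cosh_gt0.
by der.
Qed.

Lemma continuous_bal_cosh m : continuous (fun t : R => bal m (cosh t ^- 2)).
Proof. by move=> t; exact: (continuous_comp (@cinv2 t) (@continuous_bal m _)). Qed.

Lemma continuous_bal_low_cosh n : continuous (fun t : R => bal_low n (cosh t ^- 2)).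
Proof.
rewrite /bal_low; case: (odd n); last exact: continuous_bal_cosh.
have c2 : continuous (fun t : R => cosh t ^+ 2) by apply: der_cont => t; der.
move=> t; apply: cvgB; first exact: continuous_bal_cosh.
apply: cvgM.
  by apply: cvgB; exact: continuous_bal_cosh.
under eq_fun do rewrite invrK.
by rewrite invrK; exact: c2.
Qed.

Lemma bal_local n : (1 < n)%N -> local_prob n (fun t : R => bal n./2 (cosh t ^- 2)).
Proof.
move=> n1; have [m0 _ _] := half_bounds R n1.
have m0' : 0 < n./2%:R :> R by rewrite ltr0n.
have h (t : R) : 0 <= bal n./2 (cosh t ^- 2) <= 1.
  by have [a0 a1] := cosh_inv2 t; rewrite bal_ge0// bal_le1.
split=> // [|t].
  apply: (@tame_bounded _ _ 1).
    by apply: continuous_measurable_fun; exact: continuous_bal_cosh.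
  by move=> t _; have /andP[u v] := h t; rewrite ger0_norm.
apply: le_trans (bal_cosh t m0) _; rewrite ler_pM2r ?invr_gt0//.
by apply: ler_pM; rewrite ?exprn_ge0 ?(ltW (cosh_gt0 _)) ?ler_nat// ler_weXn2l// cosh_ge1.
Qed.

Lemma bal_low_local n : (1 < n)%N -> local_prob n (fun t : R => bal_low n (cosh t ^- 2)).
Proof.
move=> n1.
have h (t : R) : 0 <= bal_low n (cosh t ^- 2) <= 1.
  have [a0 a1] := cosh_inv2 t; have /andP[-> /le_trans->//] := bal_low_bounds n t.
  by rewrite bal_le1.
split=> // [|t]; last exact: bal_low_cosh.
apply: (@tame_bounded _ _ 1).
  by apply: continuous_measurable_fun; exact: continuous_bal_low_cosh.
by move=> t _; have /andP[u v] := h t; rewrite ger0_norm.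
Qed.

End LocalProb.

(** * The model as a mixture of product measures *)

Section Mixture.
Variable R : realType.
Notation mu := (@lebesgue_measure R).
Implicit Types (t x : R).

Lemma line_fold (F : R -> R) : continuous F -> (forall x, 0 <= F x) ->
  (\int[mu]_x (F x)%:E =
   \int[mu]_(x in `[0%R, +oo[) (F x)%:E + \int[mu]_(x in `[0%R, +oo[) (F (- x))%:E)%E.
Proof.
move=> cF F0; have mF : measurable_fun [set: R] F by exact: continuous_measurable_fun.
have mp : measurable [set x : R | 0 <= x]%R by rewrite -set_itvcy.
rewrite -{1}(setUv [set x : R | 0 <= x]%R) ge0_integral_setU//= ; last 4 first.
- exact: measurableC.
- by apply/measurable_EFinP; rewrite setUv.
- by move=> x _; rewrite lee_fin.
- exact/disj_setPCl.
rewrite -set_itvcy setCitvr; congr (_ + _)%E.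
rewrite integral_itv_bndo_bndc; last exact/measurable_EFinP/measurable_funTS.
rewrite -{1}oppr0 ge0_integration_by_substitutionNy//.
exact: continuous_subspaceT.
Qed.

Section fixed.
Variables (d : nat) (beta h : R) (n : nat).
Hypothesis d1 : (1 <= d)%N.
Hypothesis beta0 : 0 < beta.
Hypothesis n0 : (0 < n)%N.

Definition coupling : R := 2 * d%:R * beta.
Let b := coupling.

Lemma coupling_gt0 : 0 < coupling.
Proof. by rewrite !mulr_gt0// ltr0n. Qed.
Let b0 : 0 < b.
Proof. exact: coupling_gt0. Qed.

Let n0' : 0 < n%:R :> R.
Proof. by rewrite ltr0n. Qed.

Let sigma := Num.sqrt (b / n%:R).

Let sigma0 : 0 < sigma.
Proof. by rewrite sqrtr_gt0 divr_gt0. Qed.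

Let pdf (m : R) := normal_pdf m sigma.

Let peak : R := normal_peak sigma.

Lemma pdfE m t : pdf m t = peak * expR (- (t - m) ^+ 2 / (2 * b)) ^+ n.
Proof.
rewrite /pdf normal_pdfE ?gt_eqF// /normal_fun -expRM_natl; congr (_ * expR _).
rewrite -mulr_natl sqr_sqrtr ?divr_ge0 ?(ltW b0)//.
by move: (b) b0 (n%:R : R) n0' => c c0 N N0; field; rewrite (gt_eqF c0) (gt_eqF N0).
Qed.

(** Completing the square: the exponential tilt of a normal density is a shifted one. *)
Lemma pdf_tilt m M t : pdf m t * expR (t * M) =
  expR (m * M + b / (2 * n%:R) * M ^+ 2) * pdf (m + b / n%:R * M) t.
Proof.
rewrite !pdfE -[LHS]mulrA [RHS]mulrCA; congr (_ * _).
rewrite -!expRM_natl -!expRD; congr expR.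
by move: (b) b0 (n%:R : R) n0' => c c0 N N0; field; rewrite (gt_eqF c0) (gt_eqF N0).
Qed.

(** The Hubbard-Stratonovich transform: the Gaussian integral linearizes the square of
    the magnetization. *)
Lemma cw_weight_mixture (s : spins n) :
  (\int[mu]_t (pdf h t * expR (t * mag R s))%:E = (cw_weight d beta h s)%:E)%E.
Proof.
under eq_integral do rewrite pdf_tilt EFinM.
rewrite ge0_integralZl//; last 2 first.
- by apply/measurable_EFinP; exact: measurable_normal_pdf.
- by move=> t _; rewrite lee_fin normal_pdf_ge0.
rewrite integral_normal_pdf mule1 /cw_weight -/(mag R s); congr (expR _)%:E.
rewrite addrC; congr (_ + _); congr (_ * _).
by rewrite /b /coupling; field; rewrite (gt_eqF n0').
Qed.

Lemma cw_mass_mixture (A : {set spins n}) :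
  ((\sum_(s in A) cw_weight d beta h s)%:E = \int[mu]_t (pdf h t * tilt t A)%:E)%E.
Proof.
rewrite -sumEFin -big_enum/=.
under [RHS]eq_integral do rewrite /tilt mulr_sumr -sumEFin -big_enum/=.
rewrite ge0_integral_sum//; last 2 first.
- move=> s; apply/measurable_EFinP; apply: measurable_funM.
    exact: measurable_normal_pdf.
  by apply: continuous_measurable_fun; apply: der_cont => t; der.
- by move=> s t _; rewrite lee_fin mulr_ge0 ?normal_pdf_ge0 ?expR_ge0.
by apply: eq_bigr => s _; rewrite -cw_weight_mixture.
Qed.

Definition fold_const : R := peak * 2 ^+ n.

Lemma pdf_even_integral f : continuous f -> tame f -> (forall t, 0 <= f t) ->
  (forall t, f (- t) = f t) ->
  (\int[mu]_t (pdf h t * ((2 * cosh t) ^+ n * f t))%:E =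
   (fold_const * vint b `|h| n f)%:E)%E.
Proof.
move=> cf tf f0 fN.
have cF : continuous (fun t => pdf h t * ((2 * cosh t) ^+ n * f t)).
  move=> t; apply: cvgM; first by apply: continuous_normal_pdf; rewrite gt_eqF.
  apply: cvgM; last exact: cf.
  by apply: (@der_cont _ (fun t : R => (2 * cosh t) ^+ n)) => u; der.
have F0 t : 0 <= pdf h t * ((2 * cosh t) ^+ n * f t).
  by rewrite mulr_ge0 ?normal_pdf_ge0// mulr_ge0// exprn_ge0// mulr_ge0// ltW// cosh_gt0.
have cFN : continuous ((fun t => pdf h t * ((2 * cosh t) ^+ n * f t)) \o -%R).
  by move=> t; apply: continuous_comp; [exact: opp_continuous|exact: cF].
rewrite (line_fold cF)// -ge0_integralD//; last 4 first.
- by move=> t _; rewrite lee_fin.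
- by apply/measurable_EFinP; apply: measurable_funTS; exact: continuous_measurable_fun.
- by move=> t _; rewrite lee_fin.
- apply/measurable_EFinP; apply: measurable_funTS; apply: continuous_measurable_fun.
  exact: cFN.
have tw := tame_fold n b0 (normr_ge0 h).
have te : tame (fun t => f t * (1 + fold_weight b `|h| n t)) by tame.
have ei := edom_int (edomZ fold_const (tame_edom `|h| b0 n0 te)).
rewrite /vint /wint -hlZ; last exact: tame_edom.
rewrite /hl /Rintegral fineK; last exact: integrable_fin_num.
apply: eq_integral => t _; rewrite -EFinD; congr EFin.
rewrite coshN fN -mulrDl !pdfE.
rewrite /fold_const /cwW.
have sg : expR (- (t - h) ^+ 2 / (2 * b)) ^+ n + expR (- (- t - h) ^+ 2 / (2 * b)) ^+ n
   = expR (- (t - `|h|) ^+ 2 / (2 * b)) ^+ n * (1 + fold_weight b `|h| n t).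
  have E k : expR (- (t - k) ^+ 2 / (2 * b)) ^+ n + expR (- (- t - k) ^+ 2 / (2 * b)) ^+ n
    = expR (- (t - k) ^+ 2 / (2 * b)) ^+ n * (1 + fold_weight b k n t).
    rewrite mulrDr mulr1 /fold_weight -!expRM_natl -expRD; congr (_ + expR _).
    by field; rewrite (gt_eqF b0).
  case: (ger0P h) => _; rewrite -E//.
  have a1 : (t - h) ^+ 2 = (- t - - h) ^+ 2 by ring.
  have a2 : (- t - h) ^+ 2 = (t - - h) ^+ 2 by ring.
  by rewrite a1 a2 addrC.
rewrite -mulrDr sg [(2 * cosh t) ^+ n]exprMn [(cosh t * _) ^+ n]exprMn.
by ring.
Qed.

End fixed.
End Mixture.

(** * Two mixtures enclosing the concentration function *)

Section Sandwich.
Variable R : realType.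
Notation mu := (@lebesgue_measure R).
Implicit Types (t x : R).

Lemma sum_weight n (p : 'I_n -> R) : \sum_(s : spins n) weight p s = 1.
Proof.
elim: n p => [|n ih] p.
  by rewrite (big_spins0 _ _ [ffun=> true]) /weight big_ord0.
rewrite big_spinsS/=.
under eq_bigr do rewrite weight_fcons.
under [X in _ + X]eq_bigr do rewrite weight_fcons.
by rewrite -!mulr_sumr !ih !mulr1 subrK.
Qed.

Lemma tilt_setT t n : tilt t [set: spins n]%SET = (2 * cosh t) ^+ n.
Proof.
rewrite /tilt (eq_bigl xpredT); last by move=> s; rewrite finset.in_setT.
under eq_bigr do rewrite (tilt_weight _ (fun _ => true)).
rewrite -mulr_sumr (reindex_inj (can_inj (agreeK (fun _ => true))))/=.
by under eq_bigr do rewrite agreeK; rewrite sum_weight mulr1.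
Qed.

Section general.
Variables (d : nat) (beta h : R) (n : nat).

Lemma small_ballE (v : 'I_n -> R) x : small_ball d beta h v x =
  (\sum_(s in ball_set v x) cw_weight d beta h s) / cw_Z d beta h n.
Proof. by rewrite /small_ball /cw_prob -mulr_suml. Qed.

Variable U : R.
Hypothesis ball_le : forall (v : 'I_n -> R) x, (forall i, 1 <= `|v i|) ->
  small_ball d beta h v x <= U.

Let inner x := [set small_ball d beta h v x
               | v in [set v : 'I_n -> R | forall i, 1 <= `|v i|]].

Let inner_ub x : ubound (inner x) U.
Proof. by move=> _ [v v1 <-]; exact: ball_le. Qed.

Let inner0 x : inner x !=set0.
Proof.
exists (small_ball d beta h (fun _ : 'I_n => 1) x), (fun _ => 1) => // i.
by rewrite normr1.
Qed.

Lemma Q_le : Q d beta h n <= U.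
Proof.
apply: ge_sup; first by exists (sup (inner 0)), 0.
by move=> _ [x _ <-]; exact: (ge_sup (inner0 x) (@inner_ub x)).
Qed.

Lemma Q_ge (v : 'I_n -> R) x : (forall i, 1 <= `|v i|) ->
  small_ball d beta h v x <= Q d beta h n.
Proof.
move=> v1; apply: (@le_trans _ _ (sup (inner x))).
  apply: ub_le_sup; first by exists U; exact: inner_ub.
  by exists v.
apply: ub_le_sup; last by exists x.
by exists U => _ [y _ <-]; exact: (ge_sup (inner0 y) (@inner_ub y)).
Qed.

End general.

Section positive.
Variables (d : nat) (beta h : R) (n : nat).
Hypothesis d1 : (1 <= d)%N.
Hypothesis beta0 : 0 < beta.
Hypothesis n1 : (1 < n)%N.

Let n0 : (0 < n)%N.
Proof. exact: ltnW. Qed.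

Let b : R := coupling d beta.
Let b0 : 0 < b := coupling_gt0 d1 beta0.
Let c : R := fold_const d beta n.

Let sigma : R := Num.sqrt (b / n%:R).

Let c0 : 0 < c.
Proof.
rewrite /c /fold_const mulr_gt0 ?exprn_gt0// normal_peak_gt0// gt_eqF//.
by rewrite sqrtr_gt0 divr_gt0// ltr0n.
Qed.

Let V (f : R -> R) := vint b `|h| n f.

Let mtilt A : measurable_fun [set: R] (fun t => (normal_pdf h sigma t * @tilt R t n A)%:E).
Proof.
apply/measurable_EFinP; apply: measurable_funM; first exact: measurable_normal_pdf.
under eq_fun do rewrite /tilt -big_enum/=.
apply: measurable_sum => s; apply: continuous_measurable_fun.
by apply: der_cont => t; der.
Qed.

Let tilt_ge0 t (A : {set spins n}) : 0 <= tilt t A.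
Proof. by rewrite sumr_ge0// => s _; exact: expR_ge0. Qed.

Let mF (f : R -> R) : continuous f ->
  measurable_fun [set: R] (fun t => (normal_pdf h sigma t * ((2 * cosh t) ^+ n * f t))%:E).
Proof.
move=> cf; apply/measurable_EFinP; apply: measurable_funM.
  exact: measurable_normal_pdf.
apply: measurable_funM; last exact: continuous_measurable_fun.
by apply: continuous_measurable_fun; apply: der_cont => t; der.
Qed.

Lemma cw_mass_le (A : {set spins n}) (f : R -> R) : continuous f -> tame f -> (forall t, 0 <= f t) ->
  (forall t, f (- t) = f t) -> (forall t, tilt t A <= (2 * cosh t) ^+ n * f t) ->
  \sum_(s in A) cw_weight d beta h s <= c * V f.
Proof.
move=> cf tf f0 fN le; rewrite -lee_fin (cw_mass_mixture _ d1 beta0 n0).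
rewrite -(pdf_even_integral h d1 beta0 n0 cf tf f0 fN).
apply: ge0_le_integral => //.
- by move=> t _; rewrite lee_fin mulr_ge0 ?normal_pdf_ge0.
- exact: mtilt.
- exact: mF.
- by move=> t _; rewrite lee_fin ler_wpM2l ?normal_pdf_ge0.
Qed.

Lemma cw_mass_ge (A A' : {set spins n}) (f : R -> R) : continuous f -> tame f -> (forall t, 0 <= f t) ->
  (forall t, f (- t) = f t) ->
  (forall t, 2 * ((2 * cosh t) ^+ n * f t) <= tilt t A + tilt t A') ->
  2 * (c * V f) <= \sum_(s in A) cw_weight d beta h s + \sum_(s in A') cw_weight d beta h s.
Proof.
move=> cf tf f0 fN le; rewrite -lee_fin EFinD EFinM.
rewrite !(cw_mass_mixture _ d1 beta0 n0).
rewrite -(pdf_even_integral h d1 beta0 n0 cf tf f0 fN).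
rewrite -ge0_integralZl_EFin//; last 2 first.
- by move=> t _; rewrite lee_fin mulr_ge0 ?normal_pdf_ge0// mulr_ge0// ltW// twice_cosh_gt0.
- exact: mF.
rewrite -ge0_integralD//; last 4 first.
- by move=> t _; rewrite lee_fin mulr_ge0 ?normal_pdf_ge0.
- exact: mtilt.
- by move=> t _; rewrite lee_fin mulr_ge0 ?normal_pdf_ge0.
- exact: mtilt.
apply: ge0_le_integral => //.
- move=> t _; rewrite -EFinM lee_fin mulr_ge0// mulr_ge0 ?normal_pdf_ge0// mulr_ge0//.
  by rewrite ltW// twice_cosh_gt0.
- by apply: measurable_funeM; exact: mF.
- by apply: emeasurable_funD; exact: mtilt.
- move=> t _; rewrite -EFinM -EFinD lee_fin -mulrDr mulrCA ler_wpM2l ?normal_pdf_ge0//.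
Qed.

Lemma cw_Z_mixture : cw_Z d beta h n = c * V (fun _ => 1).
Proof.
apply/eqP; rewrite eq_le; have c1 : continuous (fun _ : R => 1 : R) by move=> t; exact: cvg_cst.
have E : cw_Z d beta h n = \sum_(s in [set: spins n]%SET) cw_weight d beta h s.
  by apply: eq_bigl => s; rewrite finset.in_setT.
have t1 : tame (fun _ : R => 1 : R) by exact: tame_cst.
apply/andP; split.
  by rewrite E; apply: cw_mass_le => // t; rewrite tilt_setT mulr1.
have := @cw_mass_ge [set: spins n]%SET [set: spins n]%SET _ c1 t1 (fun _ => ler01) (fun _ => erefl).
rewrite -E => h1.
have {h1} : 2 * (c * V (fun _ => 1)) <= cw_Z d beta h n + cw_Z d beta h n.
  by apply: h1 => t; rewrite tilt_setT mulr1; lra.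
by lra.
Qed.

(** The upper bound holds ball by ball. For the lower bound, one vector of coefficients
    serves all [t], and the larger of two balls has at least their mean
    probability. *)
Lemma Q_mixture :
  vexp b `|h| n (fun t => bal_low n (cosh t ^- 2)) <= Q d beta h n <=
  vexp b `|h| n (fun t => bal n./2 (cosh t ^- 2)).
Proof.
have V0 : 0 < V (fun _ => 1) by exact: vmass_gt0.
have [tu u01 _] := @bal_local R n n1; have [tl l01 _] := @bal_low_local R n n1.
have up (v : 'I_n -> R) x : (forall i, 1 <= `|v i|) ->
    small_ball d beta h v x <= vexp b `|h| n (fun t => bal n./2 (cosh t ^- 2)).
  move=> v1; rewrite small_ballE cw_Z_mixture /vexp -/(V _) -/(V _).
  have e y : y / V (fun _ => 1) = (c * y) / (c * V (fun _ => 1)).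
    by rewrite -mulf_div divff ?mul1r// gt_eqF.
  rewrite e ler_pM2r ?invr_gt0 ?(mulr_gt0 c0 V0)//; apply: cw_mass_le => //.
  - exact: continuous_bal_cosh.
  - by move=> t; have /andP[] := u01 t.
  - by move=> t; rewrite coshN.
  - by move=> t; exact: tilt_ball_le.
apply/andP; split; last exact: Q_le up.
have [v [x [x' [v1 vle]]]] := @tilt_low R n.
have g1 := @Q_ge d beta h n _ up v x v1; have g2 := @Q_ge d beta h n _ up v x' v1.
rewrite !small_ballE in g1 g2.
suff : 2 * vexp b `|h| n (fun t => bal_low n (cosh t ^- 2)) <= Q d beta h n + Q d beta h n.
  by lra.
apply: le_trans (lerD g1 g2); rewrite -mulrDl cw_Z_mixture ler_pdivlMr ?(mulr_gt0 c0 V0)//.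
rewrite /vexp -/(V _) -/(V _).
have -> : 2 * (V (fun t => bal_low n (cosh t ^- 2)) / V (fun _ => 1)) * (c * V (fun _ => 1))
   = 2 * (c * V (fun t => bal_low n (cosh t ^- 2))).
  have V1 : V (fun _ => 1) != 0 by rewrite gt_eqF.
  have aux (X Y C : R) : Y != 0 -> 2 * (X / Y) * (C * Y) = 2 * (C * X).
    by move=> Y0; field.
  exact: aux.
apply: cw_mass_ge => //.
- exact: continuous_bal_low_cosh.
- by move=> t; have /andP[] := l01 t.
- by move=> t; rewrite coshN.
Qed.

End positive.
End Sandwich.

(** * Critical scaling of the mixing measure *)

Section Critical.
Variable R : realType.
Notation mu := (@lebesgue_measure R).
Implicit Types (t u x : R) (n j : nat).

(** Minus the logarithm of the weight for [b = 1] and [k = 0]. Its expansion at [0] starts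
    with [t ^+ 4 / 12]; the quartic bound near [0] and the quadratic one farther out
    give an integrable envelope for the rescaled weights. *)
Definition crit_rate t : R := t ^+ 2 / 2 - ln (cosh t).

Let der_rate t : has_der crit_rate t (t - tanh t).
Proof.
have c0 := cosh_gt0 t.
apply: der_eq.
  rewrite /crit_rate; apply: der_add; first by der.
  by apply: der_opp; apply: der_ln; [exact: c0|der].
by rewrite /tanh /=; move: (cosh t) (sinh t) c0 => C S c0; field; rewrite gt_eqF.
Qed.

Let rate0 : crit_rate 0 = 0.
Proof. by rewrite /crit_rate cosh0 ln1 expr0n/= mul0r subr0. Qed.

Lemma crit_W t : cwW 1 0 t = expR (- crit_rate t).
Proof.
rewrite /cwW /crit_rate opprB expRD lnK ?posrE ?cosh_gt0//.
by rewrite subr0 mulr1 mulNr.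
Qed.

Lemma crit_rate_le t : 0 <= t -> crit_rate t <= t ^+ 4 / 12.
Proof.
move=> t0; rewrite -subr_ge0.
have := @der_ge0_le R (fun y => y ^+ 4 / 12 - crit_rate y)
  (fun y => y ^+ 3 / 3 - (y - tanh y)) 0 t t0.
rewrite rate0 expr0n/= mul0r subrr; apply.
  move=> y; apply: der_eq.
    by apply: der_add; [der|apply: der_opp; exact: der_rate].
  by rewrite /=; field.
by move=> y /andP[y0 _]; rewrite subr_ge0 tanh_sub_le// ltW.
Qed.

Lemma crit_rate_ge t : 0 <= t -> t ^+ 4 / 12 - t ^+ 6 / 45 <= crit_rate t.
Proof.
move=> t0; rewrite -subr_ge0.
have := @der_ge0_le R (fun y => crit_rate y - (y ^+ 4 / 12 - y ^+ 6 / 45))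
  (fun y => (y - tanh y) - (y ^+ 3 / 3 - 2 * y ^+ 5 / 15)) 0 t t0.
rewrite rate0 !expr0n/= !mul0r !subr0; apply.
  move=> y; apply: der_eq.
    by apply: der_add; [exact: der_rate|der].
  by rewrite /=; field.
by move=> y /andP[y0 _]; rewrite subr_ge0 tanh_sub_ge// ltW.
Qed.

Lemma crit_rate_quartic t : 0 <= t <= 1 -> t ^+ 4 / 20 <= crit_rate t.
Proof.
move=> /andP[t0 t1]; apply: le_trans (crit_rate_ge t0).
have t4 : 0 <= t ^+ 4 by rewrite exprn_ge0.
have : t ^+ 6 <= t ^+ 4 by rewrite ler_wiXn2l.
by lra.
Qed.

Lemma crit_rate_quadratic t : 1 <= t -> t ^+ 2 / 20 <= crit_rate t.
Proof.
move=> t1; have := @der_ge0_le R (fun y => crit_rate y - y ^+ 2 / 10)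
  (fun y => (y - tanh y) - y / 5) 1 t t1.
have r1 : 1 / 20 <= crit_rate 1.
  by have := @crit_rate_quartic 1; rewrite ler01 lexx expr1n; apply.
have h1 : tanh 1 <= 4 / 5 :> R.
  by have := @tanh_sub_ge R 1 ler01; rewrite !expr1n; lra.
have t2 : 1 <= t ^+ 2 by rewrite expr_ge1// (le_trans ler01).
rewrite expr1n => h; have {h} : crit_rate 1 - 1 / 10 <= crit_rate t - t ^+ 2 / 10.
  apply: h.
    move=> y; apply: der_eq; first by apply: der_add; [exact: der_rate|der].
    by rewrite /=; field.
  move=> y /andP[y1 _].
  have := tanh_slope (lexx 0) ltr01 y1; rewrite tanh0 !subr0 mulr1 => h.
  have y0 : 0 <= y - 1 by rewrite subr_ge0 ltW.
  have := ler_wpM2r y0 h1; lra.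
by lra.
Qed.

(** [n ^ (-1/4)], the scale of the critical mixing measure. *)
Definition crit_scale n : R := (Num.sqrt (Num.sqrt n%:R))^-1.

Lemma crit_scale_gt0 n : (0 < n)%N -> 0 < crit_scale n.
Proof. by move=> n0; rewrite invr_gt0 !sqrtr_gt0 ltr0n. Qed.

Lemma crit_scale2 n : crit_scale n ^+ 2 = (Num.sqrt n%:R)^-1.
Proof. by rewrite exprVn sqr_sqrtr ?sqrtr_ge0. Qed.

Lemma crit_scale4 n : crit_scale n ^+ 4 = n%:R^-1.
Proof. by rewrite (exprM _ 2 2) crit_scale2 exprVn sqr_sqrtr. Qed.

Lemma cvg_isqrt : (fun n : nat => (Num.sqrt n.+1%:R)^-1 : R) @ \oo --> (0 : R).
Proof.
have h : (fun n : nat => Num.sqrt (harmonic n) : R) @ \oo --> (Num.sqrt 0 : R).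
  exact: (cvg_comp _ _ cvg_harmonic (@sqrt_continuous R 0)).
rewrite sqrtr0 in h; apply: cvg_trans h; apply: near_eq_cvg; near=> n.
by rewrite /harmonic sqrtrV.
Unshelve. all: by end_near. Qed.

Lemma hl_scale (a : R) (G : R -> R) : 0 < a -> continuous G ->
  (forall x, 0 <= x -> 0 <= G x) -> hl G = hl (fun u => a * G (a * u)).
Proof.
move=> a0 cG G0; rewrite /hl /Rintegral; congr fine.
have dF x : has_der (fun u : R => a * u) x a.
  by apply: der_eq; [der|rewrite mul0r add0r mulr1].
have F'E : derive1 (fun u : R => a * u) = cst a.
  by apply/funext => x; rewrite derive1E; case: (dF x).
have := @increasing_ge0_integration_by_substitutiony R (fun u => a * u) G 0.
rewrite mulr0 F'E => ->//.
- by apply: eq_integral => x _; congr EFin; rewrite /= mulrC.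
- by move=> x y _ _ xy; rewrite ltr_pM2l.
- by move=> x _; exact: cvg_cst.
- exact: is_cvg_cst.
- exact: is_cvg_cst.
- split; first by move=> x _; case: (dF x).
  by apply: cvg_at_right_filter; exact: (der_cont dF).
- under eq_fun do rewrite mulrC.
  by apply/gt0_cvgMly => //; exact: cvg_id.
- exact: continuous_subspaceT.
- by move=> x; rewrite in_itv/= andbT => /ltW; exact: G0.
Qed.

Definition crit_int n j : R := hl (fun u => u ^+ j * cwW 1 0 (crit_scale n * u) ^+ n).
Definition crit_lim j : R := hl (fun u => u ^+ j * expR (- (u ^+ 4 / 12))).

Let dom j u : R := u ^+ j * expR (1 / 20 - u ^+ 2 / 20).

Lemma crit_dom n u : (0 < n)%N -> 0 <= u ->
  cwW 1 0 (crit_scale n * u) ^+ n <= expR (1 / 20 - u ^+ 2 / 20).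
Proof.
move=> n0 u0; have a0 := crit_scale_gt0 n0.
have n0' : 0 < n%:R :> R by rewrite ltr0n.
rewrite crit_W -expRM_natl ler_expR.
have au : 0 <= crit_scale n * u by rewrite mulr_ge0// ltW.
have [h|/ltW h] := leP (crit_scale n * u) 1.
  have au1 : 0 <= crit_scale n * u <= 1 by rewrite au.
  have := crit_rate_quartic au1; rewrite exprMn crit_scale4 => q.
  have : u ^+ 4 / 20 <= n%:R * crit_rate (crit_scale n * u).
    rewrite -(ler_pM2l n0') in q; apply: le_trans q.
    have -> : n%:R * (n%:R^-1 * u ^+ 4 / 20) = u ^+ 4 / 20; last exact: lexx.
    by move: (u ^+ 4) => c; field; rewrite gt_eqF.
  have : u ^+ 2 * 2 - 1 <= u ^+ 4.
    have e : u ^+ 4 - (u ^+ 2 * 2 - 1) = (u ^+ 2 - 1) ^+ 2 by ring.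
    by rewrite -subr_ge0 e sqr_ge0.
  by have := sqr_ge0 u; rewrite mulrN; move: (u ^+ 4) (u ^+ 2) (n%:R * _) => a b c; lra.
have := crit_rate_quadratic h; rewrite exprMn crit_scale2 => q.
have : u ^+ 2 / 20 <= n%:R * crit_rate (crit_scale n * u).
  rewrite -(ler_pM2l n0') in q; apply: le_trans q.
  have s1 : 1 <= Num.sqrt n%:R :> R by rewrite -[X in X <= _]sqrtr1 ler_wsqrtr// ler1n.
  have e : n%:R * (Num.sqrt n%:R)^-1 = Num.sqrt n%:R :> R.
    rewrite -{1}(@sqr_sqrtr _ n%:R)// expr2 mulfK// gt_eqF//.
    exact: lt_le_trans s1.
  have -> : n%:R * ((Num.sqrt n%:R)^-1 * u ^+ 2 / 20) =
      n%:R * (Num.sqrt n%:R)^-1 * (u ^+ 2 / 20) by ring.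
  by rewrite e ler_peMl// divr_ge0// sqr_ge0.
by rewrite mulrN; lra.
Qed.

Lemma edom_dom j : edom (dom j).
Proof.
have c : continuous (dom j) by rewrite /dom; apply: der_cont => t; der.
split; first exact: continuous_measurable_fun.
have [_ [C [K [C0 K0 h]]]] := tameX j (@tame_id R).
exists (C * expR (1 / 20 + 5 * (K + 1) ^+ 2)) => t t0.
rewrite /dom normrM (ger0_norm (expR_ge0 _)).
apply: le_trans (ler_wpM2r (expR_ge0 _) (h t t0)) _.
rewrite -[leLHS]mulrA -[leRHS]mulrA ler_wpM2l// -!expRD ler_expR -subr_ge0.
have -> : 1 / 20 + 5 * (K + 1) ^+ 2 + - t - (K * t + (1 / 20 - t ^+ 2 / 20)) =
  (t / 10 - (K + 1)) ^+ 2 * 5 by field.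
by rewrite mulr_ge0// sqr_ge0.
Qed.

Lemma edom_crit n j : (0 < n)%N -> edom (fun u => u ^+ j * cwW 1 0 (crit_scale n * u) ^+ n).
Proof.
move=> n0; have [_ [A hA]] := edom_dom j; split.
  apply: measurable_funM; first exact: measurable_funX.
  apply: continuous_measurable_fun => u.
  apply: (@continuous_comp _ _ _ (fun u => crit_scale n * u) (fun t => cwW 1 0 t ^+ n)).
    by apply: (@der_cont _ (fun u => crit_scale n * u)) => v; der.
  exact: continuous_cwWX.
exists A => t t0; apply: le_trans (hA t t0).
rewrite /dom !normrM ler_wpM2l// !ger0_norm ?expR_ge0 ?exprn_ge0 ?(ltW (cwW_gt0 _ _ _))//.
exact: crit_dom.
Qed.

Lemma wint_crit n j : (0 < n)%N ->
  wint 1 0 n (fun t => t ^+ j) = crit_scale n ^+ j.+1 * crit_int n j.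
Proof.
move=> n0; have a0 := crit_scale_gt0 n0; set a := crit_scale n in a0 *.
have cG : continuous (fun t => t ^+ j * cwW 1 0 t ^+ n : R).
  move=> t; apply: cvgM; first exact: exprn_continuous.
  exact: continuous_cwWX.
rewrite /wint (hl_scale a0 cG); last first.
  by move=> x x0; rewrite mulr_ge0 ?exprn_ge0// ltW// cwW_gt0.
have e : edom (fun u => u ^+ j * cwW 1 0 (a * u) ^+ n) by exact: edom_crit.
rewrite /crit_int -hlZ//; apply: eq_hl => t _.
by rewrite exprMn exprS !mulrA.
Qed.

Lemma crit_ptwise u : 0 <= u ->
  (fun n => cwW 1 0 (crit_scale n.+1 * u) ^+ n.+1 : R) @ \oo --> expR (- (u ^+ 4 / 12)).
Proof.
move=> u0.
have E n : cwW 1 0 (crit_scale n.+1 * u) ^+ n.+1 =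
    expR (- (n.+1%:R * crit_rate (crit_scale n.+1 * u))).
  by rewrite crit_W -expRM_natl mulrN.
under eq_fun do rewrite E.
suff h : (fun n => - (n.+1%:R * crit_rate (crit_scale n.+1 * u)) : R) @ \oo --> - (u ^+ 4 / 12).
  exact: (cvg_comp _ _ h (@continuous_expR R _)).
apply: cvgN.
apply: (@squeeze_cvgr _ _ _ _
  (fun n => u ^+ 4 / 12 - u ^+ 6 / 45 * (Num.sqrt n.+1%:R)^-1) (cst (u ^+ 4 / 12))).
- near=> n; have n0 : (0 < n.+1)%N by [].
  have n0' : 0 < n.+1%:R :> R by rewrite ltr0n.
  have a0 := crit_scale_gt0 n0.
  have au : 0 <= crit_scale n.+1 * u by rewrite mulr_ge0// ltW.
  have lo := crit_rate_ge au; have hi := crit_rate_le au.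
  rewrite -(ler_pM2l n0') in lo; rewrite -(ler_pM2l n0') in hi.
  have e4 : n.+1%:R * (crit_scale n.+1 * u) ^+ 4 = u ^+ 4.
    by rewrite exprMn crit_scale4 mulrA mulfV ?gt_eqF// mul1r.
  have e6 : n.+1%:R * (crit_scale n.+1 * u) ^+ 6 = u ^+ 6 * (Num.sqrt n.+1%:R)^-1.
    rewrite exprMn (exprD (crit_scale n.+1) 4 2) crit_scale4 crit_scale2.
    by rewrite -(mulrA n.+1%:R^-1) mulVKf ?gt_eqF// mulrC.
  move: lo hi e4 e6; move: (crit_scale n.+1 * u) => A lo hi e4 e6.
  rewrite (mulrA n.+1%:R (A ^+ 4)) e4 in hi.
  have EA : n.+1%:R * (A ^+ 4 / 12 - A ^+ 6 / 45) =
      (n.+1%:R * A ^+ 4) / 12 - (n.+1%:R * A ^+ 6) / 45 by ring.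
  rewrite EA e4 e6 in lo.
  by rewrite /cst hi andbT -(mulrAC (u ^+ 6)).
- rewrite -[X in _ --> X]subr0; apply: cvgB; first exact: cvg_cst.
  rewrite -(mulr0 (u ^+ 6 / 45)); apply: cvgM; [exact: cvg_cst|exact: cvg_isqrt].
- exact: cvg_cst.
Unshelve. all: by end_near. Qed.

(** Dominated convergence with the envelope [crit_dom]. *)
Lemma crit_int_cvg j : (fun n => crit_int n.+1 j) @ \oo --> crit_lim j.
Proof.
have mD : measurable (`[0%R, +oo[%classic : set R) by exact: measurable_itv.
have [] := @dominated_convergence _ _ R mu _ mD
  (fun n u => (u ^+ j * cwW 1 0 (crit_scale n.+1 * u) ^+ n.+1)%:E)
  (fun u => (u ^+ j * expR (- (u ^+ 4 / 12)))%:E) (fun u => (dom j u)%:E).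
- move=> n; apply/measurable_EFinP; apply: measurable_funTS.
  by case: (edom_crit j (ltn0Sn n)).
- apply/measurable_EFinP; apply: measurable_funTS; apply: continuous_measurable_fun.
  by apply: der_cont => t; der.
- apply: aeW => u /=; rewrite in_itv/= andbT => u0.
  apply: cvg_EFin; first exact: nearW.
  by apply: cvgM; [exact: cvg_cst|exact: crit_ptwise].
- exact: (edom_int (edom_dom j)).
- apply: aeW => u n /=; rewrite in_itv/= andbT => u0; rewrite lee_fin.
  rewrite ger0_norm ?mulr_ge0 ?exprn_ge0 ?(ltW (cwW_gt0 _ _ _))//.
  by rewrite /dom ler_wpM2l ?exprn_ge0// crit_dom.
move=> il _ cv.
have fin : (\int[mu]_(x in `[0%R, +oo[) (x ^+ j * expR (- (x ^+ 4 / 12)))%:E)%E \is a fin_num.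
  by apply: integrable_fin_num => //; exact: il.
rewrite /crit_int /crit_lim /hl /Rintegral.
by apply: fine_cvg; rewrite fineK.
Qed.

End Critical.

(** * Quartic integrals and Gamma at one quarter *)

Section Quartic.
Variable R : realType.
Notation mu := (@lebesgue_measure R).
Implicit Types (a c s t u v x : R) (j n : nat).

Lemma edom_quartic j c : 0 < c -> edom (fun u => u ^+ j * expR (- (c * u ^+ 4))).
Proof.
move=> c0; split.
  by apply: continuous_measurable_fun; apply: der_cont => t; der.
have [_ [C [K [C0 K0 h]]]] := tameX j (@tame_id R).
exists (C * expR (c / 4 + (K + 1) ^+ 2 / (4 * c))) => t t0.
rewrite normrM (ger0_norm (expR_ge0 _)).
apply: le_trans (ler_wpM2r (expR_ge0 _) (h t t0)) _.
rewrite -[leLHS]mulrA -[leRHS]mulrA ler_wpM2l// -!expRD ler_expR -subr_ge0.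
have -> : c / 4 + (K + 1) ^+ 2 / (4 * c) + - t - (K * t + - (c * t ^+ 4)) =
    c * (t ^+ 2 - 1 / 2) ^+ 2 + c * (t - (K + 1) / (2 * c)) ^+ 2.
  by field; rewrite gt_eqF.
by rewrite addr_ge0// mulr_ge0 ?sqr_ge0 ?(ltW c0).
Qed.

Definition quartic j : R := hl (fun u => u ^+ j * expR (- u ^+ 4)).

Lemma quartic_scale a j : 0 < a ->
  quartic j = a ^+ j.+1 * hl (fun u => u ^+ j * expR (- (a ^+ 4 * u ^+ 4))).
Proof.
move=> a0; rewrite /quartic (@hl_scale _ a)//.
- rewrite -hlZ; last by apply: edom_quartic; exact: exprn_gt0.
  by apply: eq_hl => u _; rewrite (exprMn 4) (exprMn j) (exprS a j); ring.
- by apply: der_cont => t; der.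
- by move=> x x0; rewrite mulr_ge0 ?exprn_ge0// expR_ge0.
Qed.

Lemma crit_lim_quartic j :
  crit_lim R j = Num.sqrt (Num.sqrt 12) ^+ j.+1 * quartic j.
Proof.
set r := Num.sqrt (Num.sqrt 12).
have r0 : 0 < r by rewrite !sqrtr_gt0 ltr0n.
have r4 : r ^+ 4 = 12 by rewrite (exprM _ 2 2) !sqr_sqrtr ?sqrtr_ge0.
have ri : 0 < r^-1 by rewrite invr_gt0.
rewrite (quartic_scale j ri) mulrA -exprMn mulfV ?gt_eqF// expr1n mul1r.
by apply: eq_hl => u _; rewrite exprVn r4 (mulrC _^-1).
Qed.

Lemma hlE f : edom f -> (\int[mu]_(x in `[0%R, +oo[) (f x)%:E = (hl f)%:E)%E.
Proof.
by move=> ef; rewrite /hl /Rintegral fineK//; apply: integrable_fin_num => //;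
  exact: edom_int.
Qed.

Lemma quartic_ge0 j : 0 <= quartic j.
Proof.
have e0 : edom (fun _ : R => 0 : R).
  by split; [exact: measurable_cst|exists 0 => t _; rewrite normr0 mul0r].
have h0 : hl (fun _ : R => 0 : R) = 0.
  by have := hlZ 0 e0; rewrite !mul0r.
rewrite -h0; apply: hl_le => //.
  have := edom_quartic j ltr01.
  by under eq_fun do rewrite mul1r.
by move=> t t0; rewrite mulr_ge0 ?exprn_ge0// expR_ge0.
Qed.

Let shell k n : set R := `[n.+2%:R^-1 ^+ k, n.+2%:R ^+ k]%classic.

Let shell_nd k : nondecreasing_seq (shell k).
Proof.
move=> m n mn; rewrite subsetEset => x; rewrite /shell/= !in_itv/= => /andP[h1 h2].
have h : m.+2%:R <= n.+2%:R :> R by rewrite ler_nat.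
apply/andP; split.
  apply: le_trans h1; apply: lerXn2r; rewrite ?nnegrE ?invr_ge0//.
  by rewrite lef_pV2 ?posrE.
by apply: le_trans h2 _; apply: lerXn2r; rewrite ?nnegrE.
Qed.

Let bigcup_shell k : (0 < k)%N -> \bigcup_n shell k n = `]0, +oo[%classic.
Proof.
move=> k0; apply/seteqP; split=> x /=.
  move=> [n _]; rewrite /shell/= !in_itv/= andbT => /andP[h _].
  by apply: lt_le_trans h; rewrite exprn_gt0// invr_gt0.
rewrite in_itv/= andbT => x0.
pose n := Num.bound (Num.max x x^-1).
have h : Num.max x x^-1 <= n.+2%:R.
  have := archi_boundP (_ : 0 <= Num.max x x^-1).
  rewrite le_max (ltW x0) => /(_ isT) /ltW /le_trans-> //.
  by rewrite ler_nat /n -addn2 leq_addr.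
move: h; rewrite ge_max => /andP[h1 h2].
exists n => //; rewrite /shell/= in_itv/=.
have hk : n.+2%:R <= n.+2%:R ^+ k :> R by rewrite ler_eXnr// ler1n.
rewrite (le_trans h1)// andbT exprVn -[leRHS]invrK lef_pV2 ?posrE ?exprn_gt0 ?invr_gt0//.
exact: le_trans hk.
Qed.

(** The substitution [x = s ^+ 4] is made on compact shells that exhaust the open
    half-line, because the integrand is singular at [0]. *)
Lemma Gamma_quarter : Gamma (1 / 4) = 4 * quartic 0.
Proof.
pose G x : R := x `^ (1 / 4 - 1) * expR (- x).
pose H s : R := 4 * expR (- s ^+ 4).
have mI : measurable (`]0%R, +oo[%classic : set R) by exact: measurable_itv.
have G0 x : 0 <= G x by rewrite mulr_ge0 ?powR_ge0 ?expR_ge0.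
have H0 x : 0 <= H x by rewrite mulr_ge0 ?expR_ge0.
have mG : measurable_fun [set: R] G.
  by apply: measurable_funM; [exact: measurable_powR|exact: mfun_expN].
have cH : continuous H by apply: der_cont => s; der.
have mH : measurable_fun [set: R] H by exact: continuous_measurable_fun.
have sub n : (\int[mu]_(x in shell 4 n) (G x)%:E = \int[mu]_(x in shell 1 n) (H x)%:E)%E.
  have a0 : 0 < n.+2%:R^-1 :> R by rewrite invr_gt0.
  have aN : n.+2%:R^-1 <= n.+2%:R :> R.
    by rewrite (@le_trans _ _ 1)// ?ler1n// invf_le1// ler1n.
  have dF x : has_der (fun s : R => s ^+ 4) x (4 * x ^+ 3).
    by apply: der_eq; [der|rewrite /= mulr1].
  have F'E : derive1 (fun s : R => s ^+ 4) = (fun s => 4 * s ^+ 3).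
    by apply/funext => x; rewrite derive1E; case: (dF x).
  have cF' : continuous (fun s : R => 4 * s ^+ 3) by apply: der_cont => s; der.
  have := @integration_by_substitution_increasing R (fun s => s ^+ 4) G
    n.+2%:R^-1 n.+2%:R aN.
  rewrite F'E => ->.
  - rewrite /shell !expr1; apply: eq_integral => s; rewrite inE/= in_itv/= => /andP[h _].
    have s0 : 0 < s by exact: lt_le_trans h.
    have p : (s ^+ 4) `^ (1 / 4 - 1) = (s ^+ 3)^-1.
      rewrite -(powR_mulrn 4 (ltW s0)) -powRrM.
      have -> : 4%:R * (1 / 4 - 1) = - 3%:R :> R by field.
      by rewrite powRN (powR_mulrn 3 (ltW s0)).
    congr EFin; rewrite /G /H.
    change ((s ^+ 4) `^ (1 / 4 - 1) * expR (- s ^+ 4) * (4 * s ^+ 3) =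
      4 * expR (- s ^+ 4)).
    by rewrite p; field; rewrite gt_eqF.
  - move=> x y; rewrite !in_itv/= => /andP[hx _] /andP[hy _] xy.
    by rewrite ltrXn2r// (le_trans (ltW a0)).
  - by move=> x _; exact: cF'.
  - by apply/cvg_ex; eexists; apply: cvg_at_right_filter; exact: cF'.
  - by apply/cvg_ex; eexists; apply: cvg_at_left_filter; exact: cF'.
  - split; first by move=> x _; case: (dF x).
      by apply: cvg_at_right_filter; exact: (der_cont dF).
    by apply: cvg_at_left_filter; exact: (der_cont dF).
  - apply: continuous_in_subspaceT => x; rewrite inE/= in_itv/= => /andP[h _].
    have x0 : 0 < x by apply: lt_le_trans h; exact: exprn_gt0.
    apply: cvgM; last by apply: (@der_cont _ (fun x => expR (- x))) => y; der.
    have dp : derivable (fun y : R => y `^ (1 / 4 - 1)) x 1.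
      by apply: derivable_powR; rewrite in_itv/= andbT.
    have cp : {for x, continuous (fun y : R => y `^ (1 / 4 - 1))}.
      exact/differentiable_continuous/derivable1_diffP.
    exact: cp.
have E : (\int[mu]_(x in `]0%R, +oo[) (G x)%:E = \int[mu]_(x in `]0%R, +oo[) (H x)%:E)%E.
  have cv k (f : R -> R) : (0 < k)%N -> measurable_fun [set: R] f -> (forall x, 0 <= f x) ->
      (\int[mu]_(x in shell k n) (f x)%:E @[n --> \oo] -->
       \int[mu]_(x in `]0%R, +oo[) (f x)%:E)%E.
    move=> k0 mf f0; rewrite -(bigcup_shell k0).
    apply: ge0_nondecreasing_set_cvg_integral => //.
    + by move=> i; exact: measurable_itv.
    + by move=> i; apply/measurable_EFinP; exact: measurable_funTS.
    + by move=> i x _; rewrite lee_fin.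
  have h4 := cv 4%N G isT mG G0; have h1 := cv 1%N H isT mH H0.
  rewrite (funext sub) in h4.
  by rewrite -(cvg_lim _ h4)// (cvg_lim _ h1).
have e1 := edom_quartic 0 ltr01.
rewrite /Gamma /quartic -hlZ; last by under eq_fun do rewrite -[_ ^+ 4]mul1r.
rewrite /hl /Rintegral E; congr fine.
rewrite integral_itv_obnd_cbnd; last first.
  by apply/measurable_EFinP; exact: measurable_funTS.
by apply: eq_integral => s _; rewrite expr0 mul1r.
Qed.

End Quartic.

(** * The product of two quartic integrals *)

Section Reflection.
Variable R : realType.
Notation mu := (@lebesgue_measure R).
Implicit Types (c s t u v x : R).

Let q : R := Num.sqrt 2.

Let q2 : q ^+ 2 = 2.
Proof. by rewrite sqr_sqrtr. Qed.

Let q0 : 0 < q.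
Proof. by rewrite sqrtr_gt0. Qed.

Let quad_gt0 c s : c ^+ 2 = 2 -> 0 < s ^+ 2 + c * s + 1.
Proof.
move=> c2; have -> : s ^+ 2 + c * s + 1 = (s + c / 2) ^+ 2 + 1 / 2.
  have -> : (s + c / 2) ^+ 2 + 1 / 2 = s ^+ 2 + c * s + (c ^+ 2) / 4 + 1 / 2 by field.
  by rewrite c2; field.
by rewrite ltr_wpDl ?sqr_ge0.
Qed.

Let P s : R := s ^+ 2 + q * s + 1.
Let M s : R := s ^+ 2 + (- q) * s + 1.

Let P0 s : 0 < P s. Proof. exact: quad_gt0. Qed.
Let M0 s : 0 < M s. Proof. by apply: quad_gt0; rewrite sqrrN. Qed.

Let PM s : P s * M s = 1 + s ^+ 4.
Proof.
have -> : P s * M s = 1 + s ^+ 4 + (2 - q ^+ 2) * s ^+ 2 by rewrite /P /M; ring.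
by rewrite q2 subrr mul0r addr0.
Qed.

(** A primitive of [s ^+ 2 / (1 + s ^+ 4)] by partial fractions, from the factorization
    of [1 + s ^+ 4] into [s ^+ 2 + q * s + 1] and [s ^+ 2 - q * s + 1]. *)
Definition rat_prim s : R := (4 * q)^-1 * (ln (M s) - ln (P s)) +
  (2 * q)^-1 * (atan (q * s + 1) + atan (q * s - 1)).

Lemma der_rat_prim s : has_der rat_prim s (s ^+ 2 / (1 + s ^+ 4)).
Proof.
have p0 := P0 s; have m0 := M0 s.
apply: der_eq.
  rewrite /rat_prim; apply: der_add; apply: der_mul; [der| |der|].
    apply: der_add; first by apply: der_ln; [exact: M0|rewrite /M; der].
    by apply: der_opp; apply: der_ln; [exact: P0|rewrite /P; der].
  by apply: der_add; der.
have -> : 1 + (q * s + 1) ^+ 2 = 2 * P s.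
  have -> : 2 * P s = 1 + (q * s + 1) ^+ 2 + (2 - q ^+ 2) * s ^+ 2 by rewrite /P; ring.
  by rewrite q2 subrr mul0r addr0.
have -> : 1 + (q * s - 1) ^+ 2 = 2 * M s.
  have -> : 2 * M s = 1 + (q * s - 1) ^+ 2 + (2 - q ^+ 2) * s ^+ 2 by rewrite /M; ring.
  by rewrite q2 subrr mul0r addr0.
rewrite -PM; have e : P s = M s + 2 * q * s by rewrite /P /M; ring.
move: p0 m0 q0; rewrite e; move: (M s) (ln _) (ln _) (atan _) (atan _) => m a1 a2 a3 a4.
by move: q => r p0 m0 r0; rewrite /=; field; rewrite !gt_eqF.
Qed.

Lemma rat_prim0 : rat_prim 0 = 0.
Proof.
rewrite /rat_prim /M /P expr0n/= !mulr0 !add0r subrr mulr0 add0r.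
by rewrite atanN subrr mulr0.
Qed.

(** Both quadratics are [x ^+ 2] times a factor tending to [1], and the logarithms of
    [x ^+ 2] cancel. *)
Lemma rat_prim_cvg : rat_prim x @[x --> +oo%R] --> (pi / (2 * q) : R).
Proof.
have cinv : x^-1 @[x --> +oo%R] --> (0 : R).
  by apply/gtr0_cvgV0; [near=> x; near: x; exact: nbhs_pinfty_gt|exact: cvg_id].
have cl c : c ^+ 2 = 2 -> ln (1 + c * x^-1 + x^-1 ^+ 2) @[x --> +oo%R] --> (0 : R).
  move=> _; rewrite -[X in _ --> X](@ln1 R).
  have h : 1 + c * x^-1 + x^-1 ^+ 2 @[x --> +oo%R] --> (1 : R).
    rewrite [X in _ --> X](_ : 1 = 1 + c * 0 + 0 ^+ 2 :> R); last first.
      by rewrite expr0n/= mulr0 !addr0.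
    apply: cvgD; first by apply: cvgD; [exact: cvg_cst|apply: cvgM => //; exact: cvg_cst].
    by apply: cvgM.
  apply: (cvg_comp _ _ h); exact: (continuous_ln ltr01).
have at1 d : atan (q * x + d) @[x --> +oo%R] --> (pi / 2 : R).
  have h : q * x + d @[x --> +oo%R] --> +oo%R.
    have h1 : x * q @[x --> +oo%R] --> +oo%R by apply: gt0_cvgMly => //; exact: cvg_id.
    have h2 := cvg_comp _ _ h1 (cvg_addrr d).
    by apply: cvg_trans h2; apply: near_eq_cvg; near=> x; rewrite /= mulrC.
  exact: (cvg_comp _ _ h (@cvgy_atan R)).
pose L x : R := (4 * q)^-1 * (ln (1 + (- q) * x^-1 + x^-1 ^+ 2) - ln (1 + q * x^-1 + x^-1 ^+ 2)) +
  (2 * q)^-1 * (atan (q * x + 1) + atan (q * x - 1)).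
have E : {near +oo%R, L =1 rat_prim}.
  near=> x; have x0 : 0 < x by near: x; exact: nbhs_pinfty_gt.
  have x20 : 0 < x ^+ 2 by exact: exprn_gt0.
  rewrite /L /rat_prim; congr (_ * _ + _).
  have lnE c : 0 < x ^+ 2 + c * x + 1 ->
      ln (x ^+ 2 + c * x + 1) = ln (x ^+ 2) + ln (1 + c * x^-1 + x^-1 ^+ 2).
    have e : x ^+ 2 + c * x + 1 = x ^+ 2 * (1 + c * x^-1 + x^-1 ^+ 2).
      by field; rewrite gt_eqF.
    by rewrite e pmulr_rgt0// => h; rewrite lnM.
  by rewrite /M /P !lnE ?quad_gt0 ?sqrrN//; ring.
suff h : L x @[x --> +oo%R] --> (pi / (2 * q) : R).
  by apply: cvg_trans h; exact: near_eq_cvg E.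
rewrite [X in _ --> X](_ : _ = (4 * q)^-1 * (0 - 0) + (2 * q)^-1 * (pi / 2 + pi / 2)); last first.
  by move: (pi : R) q q0 => p r r0; field; rewrite gt_eqF.
apply: cvgD; apply: cvgM; try exact: cvg_cst.
  by apply: cvgB; apply: cl; rewrite ?sqrrN.
by apply: cvgD; exact: at1.
Unshelve. all: by end_near. Qed.

Let den_gt0 s : 0 < 1 + s ^+ 4.
Proof. by rewrite -PM mulr_gt0. Qed.

Lemma integral_rat :
  (\int[mu]_(s in `[0%R, +oo[) (s ^+ 2 / (4 * (1 + s ^+ 4)))%:E = (pi / (8 * q))%:E)%E.
Proof.
rewrite (@hl_FTC_ge0 _ _ (fun s => 4^-1 * (rat_prim s - pi / (2 * q)))).
- rewrite rat_prim0; congr EFin.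
  by move: (pi : R) q q0 => p r r0; field; rewrite gt_eqF.
- by move=> t _; rewrite divr_ge0 ?sqr_ge0// mulr_ge0// ltW.
- move=> s; apply: cvgM; first exact: exprn_continuous.
  apply: cvgV; first by rewrite gt_eqF// mulr_gt0.
  by apply: (@der_cont _ (fun s => 4 * (1 + s ^+ 4))) => t; der.
- move=> s; apply: der_eq.
    by apply: der_mul; [der|apply: der_add; [exact: der_rat_prim|exact: der_cst]].
  by rewrite mul0r add0r addr0 invfM mulrCA.
- rewrite -(mulr0 4^-1) -(subrr (pi / (2 * q))).
  by apply: cvgM; [exact: cvg_cst|apply: cvgB; [exact: rat_prim_cvg|exact: cvg_cst]].
Qed.

Lemma integral_cubic c : 0 < c ->
  (\int[mu]_(v in `[0%R, +oo[) (v ^+ 3 * expR (- (c * v ^+ 4)))%:E = (4 * c)^-1%:E)%E.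
Proof.
move=> c0; rewrite (@hl_FTC_ge0 _ _ (fun v => - (4 * c)^-1 * expR (- (c * v ^+ 4)))).
- by rewrite expr0n/= mulr0 oppr0 expR0 mulr1 opprK.
- by move=> t t0; rewrite mulr_ge0 ?exprn_ge0 ?expR_ge0.
- by apply: der_cont => t; der.
- by move=> v; apply: der_eq; [der|move: (expR _) => e; rewrite /=; field; rewrite gt_eqF].
- rewrite -(mulr0 (- (4 * c)^-1)); apply: cvgM; first exact: cvg_cst.
  apply: (@squeeze_cvgr _ _ _ _ (cst 0) (fun t => expR (- t))).
  + near=> t; rewrite expR_ge0/= ler_expR lerN2.
    have t1 : 1 <= t by near: t; exact: nbhs_pinfty_ge.
    have tc : c^-1 <= t by near: t; apply: nbhs_pinfty_ge; exact: num_real.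
    have t0 : 0 <= t by exact: le_trans t1.
    have h : t <= t ^+ 3 by rewrite ler_eXnr.
    have h2 : 1 <= c * t ^+ 3.
      by rewrite mulrC -ler_pdivrMr// mul1r (le_trans tc).
    by rewrite exprSr mulrA ler_peMl.
  + exact: cvg_cst.
  + exact: cvgr_expR.
Unshelve. all: by end_near. Qed.

Lemma integral_indicM (D : set R) (h : R -> R) : measurable D ->
  (\int[mu]_x (\1_D x * h x)%:E = \int[mu]_(x in D) (h x)%:E)%E.
Proof.
move=> mD; rewrite [RHS]integral_mkcond; apply: eq_integral => x _.
by rewrite patchE indicE; case: (x \in D); rewrite ?mul1r ?mul0r.
Qed.

(** In the product of the integrals over [v] and [u], substitute [u = v * s]; exchanging
    the integrals leaves the integral of a rational function. Given
    [Gamma_quarter], this is the reflection formula of [Gamma] at [1 / 4]. *)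
Lemma quartic02 : quartic R 0 * quartic R 2 = pi / (8 * q).
Proof.
(* The half-line in [v] is open since the substitution needs [0 < v]. *)
pose D0 : set R := `]0, +oo[%classic; pose D : set R := `[0, +oo[%classic.
have mD0 : measurable D0 by exact: measurable_itv.
have mD : measurable D by exact: measurable_itv.
pose k v s : R := v ^+ 3 * s ^+ 2 * expR (- (v ^+ 4 * (1 + s ^+ 4))).
pose f (z : R * R) : \bar R := (\1_D0 z.1 * (\1_D z.2 * k z.1 z.2))%:E.
have k0 v s : 0 <= v -> 0 <= k v s.
  move=> v0; rewrite /k; apply: mulr_ge0; last exact: expR_ge0.
  by apply: mulr_ge0; [exact: exprn_ge0|exact: sqr_ge0].
have f0 z : (0 <= f z)%E.
  rewrite lee_fin indicE; case: (boolP (z.1 \in D0)); last by rewrite mul0r.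
  rewrite inE /D0/= in_itv/= andbT => z0.
  by rewrite mul1r; apply: mulr_ge0; [rewrite indicE ler0n|exact/k0/ltW].
have mf : measurable_fun [set: R * R] f.
  apply/measurable_EFinP; apply: measurable_funM.
    by apply: measurableT_comp; [exact: measurable_indic|exact: measurable_fst].
  apply: measurable_funM.
    by apply: measurableT_comp; [exact: measurable_indic|exact: measurable_snd].
  apply: measurable_funM.
    by apply: measurable_funM; apply: measurable_funX;
      [exact: measurable_fst|exact: measurable_snd].
  apply: measurableT_comp; first exact: measurable_expR.
  apply: measurableT_comp; first exact: oppr_measurable.
  apply: measurable_funM; first by apply: measurable_funX; exact: measurable_fst.
  by apply: measurable_funD; [exact: measurable_cst|
    apply: measurable_funX; exact: measurable_snd].
have := @fubini_tonelli _ _ _ _ R mu mu f mf f0.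
have e2 : edom (fun u : R => u ^+ 2 * expR (- u ^+ 4)).
  by have := edom_quartic 2 (@ltr01 R); under eq_fun do rewrite mul1r.
have e0 : edom (fun u : R => expR (- u ^+ 4)).
  have := edom_quartic 0 (@ltr01 R).
  by under eq_fun do rewrite expr0 !mul1r.
have inner v : (\int[mu]_s f (v, s) = (\1_D0 v * (quartic R 2 * expR (- v ^+ 4)))%:E)%E.
  rewrite indicE; case: (boolP (v \in D0)) => vD; last first.
    rewrite mul0r integral0_eq// => s _.
    by rewrite /f/= indicE (negbTE vD) mul0r.
  have v0 : 0 < v by move: vD; rewrite inE /D0/= in_itv/= andbT.
  under eq_integral do rewrite /f/= indicE vD mul1r.
  rewrite integral_indicM// mul1r /k.
  have e : edom (fun s => v ^+ 3 * expR (- v ^+ 4) * (s ^+ 2 * expR (- (v ^+ 4 * s ^+ 4)))).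
    by apply: edomZ; apply: edom_quartic; exact: exprn_gt0.
  transitivity ((hl (fun s => v ^+ 3 * expR (- v ^+ 4) * (s ^+ 2 * expR (- (v ^+ 4 * s ^+ 4)))))%:E).
    rewrite -hlE//; apply: eq_integral => s _; congr EFin.
    by rewrite mulrDr mulr1 opprD expRD; ring.
  rewrite hlZ ?(quartic_scale 2 v0); last by apply: edom_quartic; exact: exprn_gt0.
  by congr EFin; ring.
have outer s : (\int[mu]_v f (v, s) = (\1_D s * (s ^+ 2 / (4 * (1 + s ^+ 4))))%:E)%E.
  have c0 := den_gt0 s.
  transitivity (\int[mu]_v (\1_D0 v * (\1_D s * k v s))%:E)%E; first by [].
  rewrite integral_indicM// indicE; case: (s \in D); last first.
    by under eq_integral do rewrite mul0r; rewrite integral0 mul0r.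
  under eq_integral do rewrite mul1r.
  rewrite integral_itv_obnd_cbnd; last first.
    apply/measurable_EFinP; apply: measurable_funTS; apply: continuous_measurable_fun.
    by rewrite /k; apply: der_cont => t; der.
  transitivity (\int[mu]_(v in `[0%R, +oo[) ((s ^+ 2)%:E * (v ^+ 3 * expR (- ((1 + s ^+ 4) * v ^+ 4)))%:E))%E.
    by apply: eq_integral => v _; rewrite -EFinM /k (mulrC (v ^+ 4)); congr EFin; ring.
  rewrite ge0_integralZl// ?integral_cubic//; last 3 first.
  - apply/measurable_EFinP; apply: measurable_funTS; apply: continuous_measurable_fun.
    by apply: der_cont => t; der.
  - move=> v /=; rewrite in_itv/= andbT => v0.
    by rewrite lee_fin mulr_ge0 ?exprn_ge0 ?expR_ge0.
  - by rewrite lee_fin sqr_ge0.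
  by rewrite -EFinM mul1r.
under eq_integral do rewrite inner.
under [X in _ = X -> _]eq_integral do rewrite outer.
rewrite !integral_indicM// integral_rat.
rewrite integral_itv_obnd_cbnd; last first.
  apply/measurable_EFinP; apply: measurable_funTS; apply: continuous_measurable_fun.
  by apply: der_cont => t; der.
rewrite (hlE (edomZ (quartic R 2) e0)) hlZ// => -[<-].
rewrite mulrC /quartic; congr (_ * _); apply: eq_hl => u _.
by rewrite expr0 mul1r.
Qed.

End Reflection.

(** * Second-order expansion at the critical point *)

Section CriticalExpansion.
Variable R : realType.
Implicit Types (n j : nat) (f : R -> R).

Lemma crit_lim0_gt0 : 0 < crit_lim R 0.
Proof.
have r0 : 0 < Num.sqrt (Num.sqrt 12) :> R by rewrite !sqrtr_gt0.
rewrite crit_lim_quartic; apply: mulr_gt0; first by rewrite expr1.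
rewrite lt_neqAle quartic_ge0 andbT eq_sym; apply/eqP => q0.
have := @quartic02 R; rewrite q0 mul0r => /esym/eqP; apply/negP.
by rewrite mulf_neq0 ?gt_eqF ?pi_gt0// invr_gt0 mulr_gt0 ?sqrtr_gt0.
Qed.

Lemma crit_const : 2 * 3 `^ (1 / 2) * pi `^ (1 / 2) / Gamma (1 / 4) ^+ 2 =
  Num.sqrt (2 / pi) * (crit_lim R 2 / crit_lim R 0 / 2).
Proof.
have p0 := pi_gt0 R; have q02 := @quartic02 R.
have l0 := crit_lim0_gt0.
rewrite Gamma_quarter !mul1r !powR12_sqrt//; last exact: ltW.
move: l0; rewrite !crit_lim_quartic.
move: (quartic R 0) (quartic R 2) q02 => q0 q2 q02 l0.
have qn : q0 != 0 by apply: contraTneq l0 => ->; rewrite mulr0 ltxx.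
have -> : q2 = pi / (8 * Num.sqrt 2) / q0 by rewrite -q02 mulrAC mulfV// mul1r.
have s12 : Num.sqrt (Num.sqrt 12) ^+ 2 = 2 * Num.sqrt 3 :> R.
  rewrite sqr_sqrtr ?sqrtr_ge0// (_ : 12 = 2 ^+ 2 * 3); last by ring.
  by rewrite sqrtrM ?sqrtr_sqr ?ger0_norm.
have r0 : 0 < Num.sqrt (Num.sqrt 12) :> R by rewrite !sqrtr_gt0.
have sp : Num.sqrt pi ^+ 2 = pi :> R by rewrite sqr_sqrtr// ltW.
have sp0 : 0 < Num.sqrt pi :> R by rewrite sqrtr_gt0.
have s20 : 0 < Num.sqrt 2 :> R by rewrite sqrtr_gt0.
rewrite sqrtrM// sqrtrV ?(ltW p0)// expr1 (exprS _ 2) s12 -{3}sp.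
move: (Num.sqrt (Num.sqrt 12)) r0 (Num.sqrt pi) sp0 (Num.sqrt 2) s20 (Num.sqrt 3).
move=> r r0 a a0 b b0 c.
by field; rewrite qn !gt_eqF.
Qed.

Let ratio n j : R := crit_int R n j / crit_int R n 0.

Let ratio_cvg j : (fun n => ratio n j) @ \oo --> crit_lim R j / crit_lim R 0.
Proof.
rewrite -(cvg_shiftS (fun n => ratio n j)) /=.
apply: cvgM; first exact: crit_int_cvg.
by apply: cvgV; [rewrite gt_eqF// crit_lim0_gt0|exact: crit_int_cvg].
Qed.

Lemma wint_ratio n j : (0 < n)%N ->
  wint 1 0 n (fun t => t ^+ j) / wmass 1 0 n = crit_scale R n ^+ j * ratio n j.
Proof.
move=> n0; have a0 := crit_scale_gt0 R n0.
have -> : wmass 1 0 n = crit_scale R n ^+ 1 * crit_int R n 0.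
  by rewrite -wint_crit//; apply: eq_wint => t _; rewrite expr0.
rewrite wint_crit// exprSr expr1 /ratio.
have c0 : crit_int R n 0 != 0.
  have := wmass_gt0 0 (@ltr01 R) n0; rewrite /wmass.
  rewrite (@eq_wint _ _ _ _ _ (fun t => t ^+ 0)); last by move=> t _; rewrite expr0.
  by rewrite wint_crit// expr1 pmulr_rgt0// => /lt0r_neq0.
move: (crit_scale R n ^+ j) (crit_int R n 0) c0 (crit_int R n j) => s c c0 x.
by field; rewrite c0 gt_eqF.
Qed.

(** All moments are given by [wint_ratio]; after multiplication by [sqrt n], the second
    one stays and the others are [O(n ^ (-1/2))]. *)
Lemma vexp_critical_bound : exists2 C, 0 <= C & forall n f, (1 < n)%N -> local_prob n f ->
  `|Num.sqrt n%:R * (Num.sqrt (pi * n./2%:R) * vexp 1 0 n f - 1) - ratio n 2 / 2| <=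
  C * ((3 + ratio n 4 + ratio n 8) * (Num.sqrt n%:R)^-1).
Proof.
have [D D0 hD] := pointwise_expansion0 R.
exists D => // n f n1 [tf f01 hf]; have [m0 mn mn'] := half_bounds R n1.
set m := n./2 in hf m0 mn mn' *.
have n0 : (0 < n)%N by exact: ltnW.
have n0' : 0 < n%:R :> R by rewrite ltr0n.
have r1 := @ltr01 R.
have Z0 := wmass_gt0 0 r1 n0.
rewrite (vexp_symmetric r1 n0 tf).
set Z := wmass 1 0 n in Z0 *.
pose sq := Num.sqrt (pi * m%:R) : R.
have tX : tame (fun t : R => t) by exact: tame_id.
pose E t : R := m%:R^-1 + t ^+ 4 + Num.sqrt m%:R * t ^+ 8.
have tE : tame E by rewrite /E; tame.
have tL : tame (fun t => sq * f t + - (1 + t ^+ 2 * 2^-1)) by tame.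
have hF t : 0 <= t -> `|sq * f t - (1 + t ^+ 2 * 2^-1)| <= D * E t.
  move=> t0; apply: hD => //.
  by have /andP[a1 a2] := f01 t; rewrite mulr_ge0 ?sqrtr_ge0//= ler_piMr ?sqrtr_ge0.
have hI : `|wint 1 0 n (fun t => sq * f t + - (1 + t ^+ 2 * 2^-1))| <=
    wint 1 0 n (fun t => D * E t).
  by apply: wint_norm_le => //; tame.
have L : wint 1 0 n (fun t => sq * f t + - (1 + t ^+ 2 * 2^-1)) =
    sq * wint 1 0 n f - (Z + 2^-1 * wint 1 0 n (fun t => t ^+ 2)).
  rewrite wintD//; try by tame.
  rewrite wintZ// wintN//; try by tame.
  rewrite wintD//; try by tame.
  rewrite [wint 1 0 n (fun t => _ * 2^-1)](_ : _ = 2^-1 * wint 1 0 n (fun t => t ^+ 2))//.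
  rewrite -wintZ//; try by tame.
  by apply: eq_wint => t _; rewrite mulrC.
have U : wint 1 0 n (fun t => D * E t) = D * (m%:R^-1 * Z +
    wint 1 0 n (fun t => t ^+ 4) + Num.sqrt m%:R * wint 1 0 n (fun t => t ^+ 8)).
  rewrite wintZ// /E wintD//; try by tame.
  rewrite wintD//; try by tame.
  rewrite [wint 1 0 n (fun _ => _^-1)](_ : _ = m%:R^-1 * Z); last first.
    rewrite /Z /wmass -wintZ//; try by tame.
    by apply: eq_wint => t _; rewrite mulr1.
  by rewrite [wint 1 0 n (fun t => _ * t ^+ 8)]wintZ//; tame.
rewrite L U in hI.
have s0 : 0 < Num.sqrt n%:R :> R by rewrite sqrtr_gt0.
have s2 : Num.sqrt n%:R ^+ 2 = n%:R :> R by rewrite sqr_sqrtr// ltW.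
have s1 : 1 <= Num.sqrt n%:R :> R by rewrite -[X in X <= _]sqrtr1 ler_wsqrtr// ler1n.
have M2 := wint_ratio 2 n0; have M4 := wint_ratio 4 n0; have M8 := wint_ratio 8 n0.
rewrite -/Z crit_scale2 in M2.
rewrite -/Z crit_scale4 in M4.
rewrite -/Z (exprM _ 4 2) crit_scale4 in M8.
have W4 : 0 <= ratio n 4.
  have : 0 <= n%:R^-1 * ratio n 4.
    rewrite -M4 divr_ge0 ?(ltW Z0)//; apply: wint_ge0 => //; first by tame.
    by move=> t t0; exact: exprn_ge0.
  by rewrite pmulr_rge0 ?invr_gt0.
have W8 : 0 <= ratio n 8.
  have : 0 <= n%:R^-1 ^+ 2 * ratio n 8.
    rewrite -M8 divr_ge0 ?(ltW Z0)//; apply: wint_ge0 => //; first by tame.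
    by move=> t t0; exact: exprn_ge0.
  by rewrite pmulr_rge0 ?exprn_gt0 ?invr_gt0.
have -> : Num.sqrt n%:R * (sq * (wint 1 0 n f / Z) - 1) - ratio n 2 / 2 =
    Num.sqrt n%:R * ((sq * wint 1 0 n f - (Z + 2^-1 * wint 1 0 n (fun t => t ^+ 2))) / Z).
  have -> : ratio n 2 = Num.sqrt n%:R * (wint 1 0 n (fun t => t ^+ 2) / Z).
    by rewrite M2 mulVKf// gt_eqF.
  by clear - Z0; move: (wint _ _ _ _) (wint _ _ _ _) Z Z0 => A B C C0; field; rewrite gt_eqF.
rewrite !normrM normfV (gtr0_norm s0) (gtr0_norm Z0).
apply: (@le_trans _ _ (Num.sqrt n%:R * (D * (m%:R^-1 +
    n%:R^-1 * ratio n 4 + Num.sqrt m%:R * (n%:R^-1 ^+ 2 * ratio n 8))))).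
  rewrite ler_pM2l// ler_pdivrMr//; apply: le_trans hI _.
  rewrite -M4 -M8 le_eqVlt; apply/orP; left; apply/eqP.
  by clear - Z0; move: (wint _ _ _ _) (wint _ _ _ _) Z Z0 (m%:R^-1) => A B C C0 im; field; rewrite gt_eqF.
rewrite mulrCA ler_wpM2l//.
have ni : n%:R^-1 = (Num.sqrt n%:R)^-1 ^+ 2 :> R by rewrite exprVn s2.
have sm : Num.sqrt m%:R <= Num.sqrt n%:R :> R by rewrite ler_wsqrtr.
move: mn sm; rewrite ni; move: (Num.sqrt n%:R) (Num.sqrt m%:R) (m%:R^-1) s0 s1.
move=> s r im s0 s1 mn rs.
have i0 : 0 < s^-1 by rewrite invr_gt0.
have i1 : s^-1 <= 1 by rewrite invf_le1.
have a1 : s * im <= 3 * s^-1.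
  rewrite -(ler_pM2l s0) in mn; apply: le_trans mn _.
  by rewrite le_eqVlt; apply/orP; left; apply/eqP; field; rewrite gt_eqF.
have a2 : s * (s^-1 ^+ 2 * ratio n 4) = ratio n 4 * s^-1 by field; rewrite gt_eqF.
have a3 : s * (r * (s^-1 ^+ 2 ^+ 2 * ratio n 8)) <= ratio n 8 * s^-1.
  have h : r * (s * (s^-1 ^+ 2 ^+ 2 * ratio n 8)) <= s * (s * (s^-1 ^+ 2 ^+ 2 * ratio n 8)).
    rewrite ler_wpM2r//; apply: mulr_ge0; first exact: ltW.
    by apply: mulr_ge0 => //; rewrite sqr_ge0.
  rewrite mulrCA; apply: le_trans h _.
  have -> : s * (s * (s^-1 ^+ 2 ^+ 2 * ratio n 8)) = ratio n 8 * s^-1 * s^-1 by field; rewrite gt_eqF.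
  by rewrite ler_piMr// mulr_ge0// ltW.
rewrite !mulrDr !mulrDl a2; lra.
Qed.

Lemma vexp_critical (f : nat -> R -> R) : (forall n, (1 < n)%N -> local_prob n (f n)) ->
  (fun n => Num.sqrt n%:R * (Num.sqrt (pi * n./2%:R) * vexp 1 0 n (f n) - 1)) @ \oo -->
  crit_lim R 2 / crit_lim R 0 / 2.
Proof.
move=> lf; have [C C0 hC] := vexp_critical_bound.
have iC : (fun n : nat => (Num.sqrt n%:R)^-1 : R) @ \oo --> (0 : R).
  by rewrite -(cvg_shiftS (fun n => (Num.sqrt n%:R)^-1)); exact: cvg_isqrt.
pose e n : R := C * ((3 + ratio n 4 + ratio n 8) * (Num.sqrt n%:R)^-1).
have e0 : e @ \oo --> (0 : R).
  pose l : R := 3 + crit_lim R 4 / crit_lim R 0 + crit_lim R 8 / crit_lim R 0.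
  rewrite -[X in _ --> X](mulr0 C) -(mulr0 l).
  apply: cvgM; first exact: cvg_cst.
  apply: cvgM => //; apply: cvgD; last exact: ratio_cvg.
  by apply: cvgD; [exact: cvg_cst|exact: ratio_cvg].
have c2 : (fun n => ratio n 2 / 2) @ \oo --> crit_lim R 2 / crit_lim R 0 / 2.
  by apply: cvgM; [exact: ratio_cvg|exact: cvg_cst].
apply: (@squeeze_cvgr _ _ _ _ (fun n => ratio n 2 / 2 - e n) (fun n => ratio n 2 / 2 + e n)).
- near=> n; have n1 : (1 < n)%N by near: n; exact: nbhs_infty_gt.
  by rewrite -ler_distl; exact: hC (lf n n1).
- by rewrite -[X in _ --> X]subr0; apply: cvgB.
- by rewrite -[X in _ --> X]addr0; apply: cvgD.
Unshelve. all: by end_near. Qed.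

End CriticalExpansion.

(** * From balanced coefficients to the concentration function *)

Section Assembly.
Variable R : realType.
Implicit Types (d n : nat) (beta h b q G C : R).

Let half_scale n : R := Num.sqrt (pi * n./2%:R).

(** Without interaction the mixture degenerates: the spins are independent with tilt [h]. *)
Lemma Q_free d h n : bal_low n (cosh h ^- 2) <= Q d 0 h n <= bal n./2 (cosh h ^- 2).
Proof.
have wE (A : {set spins n}) : \sum_(s in A) cw_weight d 0 h s = tilt h A.
  by apply: eq_bigr => s _; rewrite /cw_weight mulr0 !mul0r add0r.
have ZE : cw_Z d 0 h n = (2 * cosh h) ^+ n.
  rewrite -tilt_setT -wE; apply: eq_bigl => s.
  by rewrite finset.in_setT.
have up (v : 'I_n -> R) x : (forall i, 1 <= `|v i|) ->
    small_ball d 0 h v x <= bal n./2 (cosh h ^- 2).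
  move=> v1; rewrite small_ballE wE ZE ler_pdivrMr ?twice_cosh_gt0// mulrC.
  exact: tilt_ball_le.
apply/andP; split; last exact: Q_le up.
have [v [x [x' [v1 vle]]]] := @tilt_low R n.
have g1 := @Q_ge _ d 0 h n _ up v x v1; have g2 := @Q_ge _ d 0 h n _ up v x' v1.
have := vle h; rewrite !small_ballE !wE ZE in g1 g2 *.
rewrite ler_pdivrMr ?twice_cosh_gt0// in g1.
rewrite ler_pdivrMr ?twice_cosh_gt0// in g2 => g3.
rewrite -(ler_pM2l (@twice_cosh_gt0 R n h)).
by move: g1 g2 g3; rewrite (mulrC (Q _ _ _ _)); lra.
Qed.

Lemma sandwich_rate n q lo up G C : (0 < n)%N -> lo <= q <= up ->
  `|half_scale n * lo - G| <= C / n%:R -> `|half_scale n * up - G| <= C / n%:R ->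
  `|half_scale n * q - G| <= C / n%:R.
Proof.
move=> n0 /andP[lq qu]; rewrite !ler_norml => /andP[h1 _] /andP[_ h2].
have s0 : 0 <= half_scale n by rewrite sqrtr_ge0.
by have := ler_wpM2l s0 lq; have := ler_wpM2l s0 qu; lra.
Qed.

Lemma Q_free_rate d h : exists2 C, 0 <= C & forall n, (1 < n)%N ->
  `|half_scale n * Q d 0 h n - cosh h| <= C / n%:R.
Proof.
have c5 : 0 <= 7 * cosh h ^+ 5 :> R by rewrite mulr_ge0// exprn_ge0// ltW// cosh_gt0.
exists (7 * cosh h ^+ 5 * 3); first by rewrite mulr_ge0.
move=> n n1; have [m0 mn _] := half_bounds R n1.
have le x : `|half_scale n * x - cosh h| <= 7 * cosh h ^+ 5 / n./2%:R ->
    `|half_scale n * x - cosh h| <= 7 * cosh h ^+ 5 * 3 / n%:R.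
  by move=> h1; apply: le_trans h1 _; rewrite -[leRHS]mulrA ler_wpM2l.
have [_ _ hu] := bal_local R n1; have [_ _ hl] := bal_low_local R n1.
by apply: (sandwich_rate (ltnW n1) (Q_free d h n)); apply: le.
Qed.

Lemma Q_mixture_rate d beta h ts : (1 <= d)%N -> 0 < beta -> 0 <= ts ->
  concentrated (coupling d beta) `|h| ts ->
  exists2 C, 0 <= C & forall n, (1 < n)%N ->
  `|half_scale n * Q d beta h n - cosh ts| <= C / n%:R.
Proof.
move=> d1 beta0 ts0 cc; have b0 := coupling_gt0 d1 beta0.
have [C C0 hC] := vexp_expansion b0 (normr_ge0 h) ts0 cc.
exists C => // n n1.
apply: (sandwich_rate (ltnW n1) (Q_mixture h d1 beta0 n1)); apply: hC => //.
  exact: bal_low_local.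
exact: bal_local.
Qed.

Lemma Q_critical d beta : (1 <= d)%N -> coupling d beta = 1 ->
  (fun n => Num.sqrt n%:R * (half_scale n * Q d beta 0 n - 1)) @ \oo -->
  crit_lim R 2 / crit_lim R 0 / 2.
Proof.
move=> d1 b1; have beta0 : 0 < beta.
  by have := @ltr01 R; rewrite -b1 /coupling pmulr_rgt0// mulr_gt0// ltr0n.
apply: (@squeeze_cvgr _ _ _ _
  (fun n => Num.sqrt n%:R * (half_scale n * vexp 1 0 n (fun t => bal_low n (cosh t ^- 2)) - 1))
  (fun n => Num.sqrt n%:R * (half_scale n * vexp 1 0 n (fun t => bal n./2 (cosh t ^- 2)) - 1))).
- near=> n; have n1 : (1 < n)%N by near: n; exact: nbhs_infty_gt.
  have /andP[lo up] := Q_mixture 0 d1 beta0 n1.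
  rewrite b1 normr0 in lo up.
  by apply/andP; split; rewrite ler_wpM2l ?sqrtr_ge0// lerD2r ler_wpM2l ?sqrtr_ge0.
- by apply: vexp_critical => n; exact: bal_low_local.
- by apply: vexp_critical => n; exact: bal_local.
Unshelve. all: by end_near. Qed.

Let peak : R := Num.sqrt (2 / pi).

Let peak_gt0 : 0 < peak.
Proof. by rewrite sqrtr_gt0 divr_gt0// pi_gt0. Qed.

(** Replaces [sqrt (pi * n./2)] by [sqrt (pi * n / 2)]. Their ratio [w] satisfies
    [1 - 1 / n <= w ^+ 2 <= 1], the lower bound being attained for odd [n]. *)
Lemma half_scale_correction n q G : (1 < n)%N -> 0 <= G ->
  `|q - peak / Num.sqrt n%:R * G| <=
  2 * (peak / Num.sqrt n%:R) * (`|half_scale n * q - G| + G / n%:R).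
Proof.
move=> n1 G0; have [m0 mn _] := half_bounds R n1.
have n0 : 0 < n%:R :> R by rewrite ltr0n ltnW.
have m0' : 0 < n./2%:R :> R by rewrite ltr0n.
have sn : 0 < Num.sqrt n%:R :> R by rewrite sqrtr_gt0.
set y := peak / Num.sqrt n%:R; have y0 : 0 < y by rewrite divr_gt0.
have hs : 0 < half_scale n by rewrite sqrtr_gt0 mulr_gt0// pi_gt0.
pose w := half_scale n * y; have w0 : 0 < w by rewrite mulr_gt0.
have w2 : w ^+ 2 = 2 * n./2%:R / n%:R.
  have p0 := pi_gt0 R.
  rewrite /w /y !exprMn exprVn !sqr_sqrtr ?divr_ge0 ?mulr_ge0 ?(ltW p0)// ?(ltW n0)//.
  by move: (pi : R) p0 (n%:R) n0 => p p0 N N0; field; rewrite !gt_eqF.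
have nE : n%:R = (odd n)%:R + 2 * n./2%:R :> R.
  by rewrite -{1}(odd_double_half n) natrD -mul2n natrM.
have [odd0 odd1] : 0 <= (odd n)%:R :> R /\ (odd n)%:R <= 1 :> R by case: (odd n).
have w1 : 1 - n%:R^-1 <= w ^+ 2 <= 1.
  rewrite w2 ler_pdivrMr// mul1r ler_pdivlMr// mulrBl mulVf ?gt_eqF// mul1r.
  by apply/andP; split; move: nE odd0 odd1; lra.
have wle : w <= 1.
  rewrite -(@ler_pXn2r _ 2)// ?nnegrE ?(ltW w0)// expr1n.
  by case/andP: w1.
have w1n : 1 - w <= n%:R^-1.
  have : w ^+ 2 <= w by rewrite expr2 ler_piMl// ltW.
  by case/andP: w1; lra.
have wh : 2^-1 <= w.
  have : n%:R^-1 <= 2^-1 :> R by rewrite lef_pV2 ?posrE// ler_nat.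
  by lra.
have -> : q - y * G = y / w * ((half_scale n * q - G) + (1 - w) * G).
  have -> : half_scale n = w / y by rewrite /w mulfK// gt_eqF.
  by clearbody w y; field; rewrite !gt_eqF.
rewrite normrM (gtr0_norm (divr_gt0 y0 w0)).
apply: ler_pM => //; first by rewrite divr_ge0// ltW.
  rewrite mulrC ler_wpM2r ?(ltW y0)//.
  by rewrite -[leRHS]invrK lef_pV2 ?posrE.
apply: le_trans (ler_normD _ _) _; rewrite lerD2l normrM (ger0_norm G0) mulrC ler_wpM2l//.
by rewrite ger0_norm// subr_ge0.
Qed.

Lemma powR_Nhalf n : n%:R `^ (- (1 / 2)) = (Num.sqrt n%:R)^-1 :> R.
Proof. by rewrite powRN mul1r powR12_sqrt. Qed.

Lemma powR_N3half n : n%:R `^ (- (3 / 2)) = (Num.sqrt n%:R)^-1 / n%:R :> R.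
Proof.
have -> : - (3 / 2) = - (1 / 2) + - 1 :> R by field.
have [->|n0] := posnP n.
  by rewrite powR0 ?invr0 ?mulr0//; apply/eqP; lra.
rewrite powRD; last by apply/implyP => _; rewrite pnatr_eq0 -lt0n.
by rewrite powR_Nhalf powRN powRr1.
Qed.

Lemma powR_N1 n : n%:R `^ (- 1) = n%:R^-1 :> R.
Proof. by rewrite powRN powRr1. Qed.

Lemma leading_ratio (q : nat -> R) G : 0 < G -> (fun n => half_scale n * q n) @ \oo --> G ->
  (fun n => q n / (n%:R `^ (- (1 / 2)) * peak * G)) @ \oo --> (1 : R).
Proof.
move=> G0 cq; apply/cvgrPdist_le => /= e e0.
have e1 : 0 < e * G / 4 by rewrite divr_gt0// mulr_gt0.
have ni : (fun n => n%:R^-1 : R) @ \oo --> (0 : R).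
  by rewrite -(cvg_shiftS (fun n => n%:R^-1 : R)); exact: cvg_harmonic.
move/cvgrPdist_le : cq => /(_ _ e1) cq.
have e4 : 0 < e / 4 by rewrite divr_gt0.
move/cvgrPdist_le : ni => /(_ _ e4) ni.
near=> n; have n1 : (1 < n)%N by near: n; exact: nbhs_infty_gt.
have h1 : `|G - half_scale n * q n| <= e * G / 4 by near: n; exact: cq.
have h2 : `|0 - n%:R^-1| <= e / 4 :> R by near: n; exact: ni.
rewrite distrC in h1; rewrite sub0r normrN ger0_norm// in h2.
have sn : 0 < Num.sqrt n%:R :> R by rewrite sqrtr_gt0 ltr0n ltnW.
have y0 : 0 < peak / Num.sqrt n%:R by rewrite divr_gt0.
have := half_scale_correction (q n) n1 (ltW G0); rewrite powR_Nhalf (mulrC _ peak).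
set y := peak / Num.sqrt n%:R in y0 * => h3.
have -> : 1 - q n / (y * G) = - ((q n - y * G) / (y * G)).
  by clearbody y; field; rewrite !gt_eqF.
clearbody y; rewrite normrN normrM normfV (gtr0_norm (mulr_gt0 y0 G0)) ler_pdivrMr ?mulr_gt0//.
apply: le_trans h3 _; rewrite -mulrA.
have -> : e * (y * G) = 2 * (y * (e * G / 4 + G * (e / 4))) by field.
by rewrite ler_pM2l// ler_pM2l// lerD// ler_pM2l.
Unshelve. all: by end_near. Qed.

Lemma rate_cvg (q : nat -> R) G C : (forall n, (1 < n)%N ->
  `|half_scale n * q n - G| <= C / n%:R) -> (fun n => half_scale n * q n) @ \oo --> G.
Proof.
move=> hC; have ni : (fun n => n%:R^-1 : R) @ \oo --> (0 : R).
  by rewrite -(cvg_shiftS (fun n => n%:R^-1 : R)); exact: cvg_harmonic.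
have c0 : (fun n => C / n%:R) @ \oo --> (0 : R).
  by rewrite -[X in _ --> X](mulr0 C); apply: cvgM => //; exact: cvg_cst.
apply: (@squeeze_cvgr _ _ _ _ (fun n => G - C / n%:R) (fun n => G + C / n%:R)).
- near=> n; have n1 : (1 < n)%N by near: n; exact: nbhs_infty_gt.
  by rewrite -ler_distl; exact: hC.
- by rewrite -[X in _ --> X]subr0; apply: cvgB => //; exact: cvg_cst.
- by rewrite -[X in _ --> X]addr0; apply: cvgD => //; exact: cvg_cst.
Unshelve. all: by end_near. Qed.

Lemma rate_bigO (q : nat -> R) G C : 0 <= G -> 0 <= C -> (forall n, (1 < n)%N ->
  `|half_scale n * q n - G| <= C / n%:R) ->
  q = (fun n : nat => peak * G * n%:R `^ (- (1 / 2)))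
      +O_\oo (fun n : nat => n%:R `^ (- (3 / 2)) : R).
Proof.
move=> G0 C0 hC; apply/eqaddOP/bigO_exP; exists (2 * peak * (C + G) + 1).
  by rewrite ltr_wpDl// !mulr_ge0// ?addr_ge0// ltW.
near=> n; have n1 : (1 < n)%N by near: n; exact: nbhs_infty_gt.
have sn : 0 < Num.sqrt n%:R :> R by rewrite sqrtr_gt0 ltr0n ltnW.
have n0 : 0 < n%:R :> R by rewrite ltr0n ltnW.
rewrite powR_N3half; change ((q - _) n) with (q n - peak * G * n%:R `^ (- (1 / 2))).
rewrite powR_Nhalf (mulrAC peak) [X in _ <= _ * X]ger0_norm ?divr_ge0 ?invr_ge0 ?(ltW sn)//.
apply: le_trans (half_scale_correction (q n) n1 G0) _.
apply: (@le_trans _ _ (2 * (peak / Num.sqrt n%:R) * (C / n%:R + G / n%:R))).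
  by rewrite ler_wpM2l ?lerD2r ?hC// mulr_ge0// divr_ge0// ltW.
have -> : 2 * (peak / Num.sqrt n%:R) * (C / n%:R + G / n%:R) =
   2 * peak * (C + G) * ((Num.sqrt n%:R)^-1 / n%:R) by ring.
by rewrite ler_wpM2r ?lerDl// divr_ge0 ?invr_ge0 ?ltW.
Unshelve. all: by end_near. Qed.

Lemma critical_littleo (q : nat -> R) (l : R) : 0 <= l ->
  (fun n => Num.sqrt n%:R * (half_scale n * q n - 1)) @ \oo --> l ->
  q = (fun n : nat => peak * n%:R `^ (- (1 / 2)) + peak * l * n%:R `^ (- 1))
      +o_\oo (fun n : nat => n%:R `^ (- 1) : R).
Proof.
move=> l0 cl; apply/eqaddoP => e e0.
have iC : (fun n : nat => (Num.sqrt n%:R)^-1 : R) @ \oo --> (0 : R).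
  by rewrite -(cvg_shiftS (fun n => (Num.sqrt n%:R)^-1 : R)); exact: cvg_isqrt.
have e1 : 0 < e / (4 * peak) by rewrite divr_gt0// mulr_gt0.
have e2 : 0 < e / (4 * peak) / (1 + l) by rewrite divr_gt0// ltr_wpDr.
move/cvgrPdist_le : cl => /(_ _ e1) cl; move/cvgrPdist_le : iC => /(_ _ e2) iC.
near=> n; have n1 : (1 < n)%N by near: n; exact: nbhs_infty_gt.
have sn : 0 < Num.sqrt n%:R :> R by rewrite sqrtr_gt0 ltr0n ltnW.
have n0 : 0 < n%:R :> R by rewrite ltr0n ltnW.
have s2 : Num.sqrt n%:R ^+ 2 = n%:R :> R by rewrite sqr_sqrtr// ltW.
have s1 : 1 <= Num.sqrt n%:R :> R by rewrite -[X in X <= _]sqrtr1 ler_wsqrtr// ler1n ltnW.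
have h1 : `|l - Num.sqrt n%:R * (half_scale n * q n - 1)| <= e / (4 * peak).
  by near: n; exact: cl.
have h2 : `|0 - (Num.sqrt n%:R)^-1| <= e / (4 * peak) / (1 + l) by near: n; exact: iC.
rewrite sub0r normrN ger0_norm ?invr_ge0 ?(ltW sn)// in h2.
rewrite ler_pdivlMr ?ltr_wpDr// in h2.
rewrite powR_N1; change ((q - _) n) with
  (q n - (peak * n%:R `^ (- (1 / 2)) + peak * l * n%:R `^ (- 1))).
rewrite powR_Nhalf powR_N1 [X in _ <= _ * X]ger0_norm ?invr_ge0 ?(ltW n0)//.
(* The two terms of the expansion are the leading factor times [G]. *)
pose G := 1 + l / Num.sqrt n%:R.
have G0 : 0 <= G by rewrite addr_ge0// divr_ge0// ltW.
have -> : peak / Num.sqrt n%:R + peak * l / n%:R = peak / Num.sqrt n%:R * G.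
  by rewrite /G -{2}s2; clear - sn; move: (Num.sqrt n%:R) sn peak => s s0 p; field; rewrite gt_eqF.
apply: le_trans (half_scale_correction (q n) n1 G0) _.
have d1 : Num.sqrt n%:R * `|half_scale n * q n - G| <= e / (4 * peak).
  rewrite -{1}(gtr0_norm sn) -normrM; apply: le_trans h1; rewrite distrC.
  rewrite le_eqVlt; apply/orP; left; apply/eqP; congr (`|_|).
  rewrite /G; clear - sn; move: (Num.sqrt n%:R) sn (half_scale n * q n) => s s0 p.
  by field; rewrite gt_eqF.
have d2 : Num.sqrt n%:R * (G / n%:R) <= e / (4 * peak).
  apply: le_trans h2; rewrite -{2}s2.
  have -> : Num.sqrt n%:R * (G / Num.sqrt n%:R ^+ 2) = (Num.sqrt n%:R)^-1 * G.
    by clear - sn; move: (Num.sqrt n%:R) sn G => s s0 g; field; rewrite gt_eqF.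
  rewrite ler_wpM2l ?invr_ge0 ?(ltW sn)// lerD2l ler_pdivrMr// ler_peMr//.
have := lerD d1 d2; rewrite -mulrDr => d3.
have -> : e / n%:R = 2 * (peak / Num.sqrt n%:R) *
    ((e / (4 * peak) + e / (4 * peak)) / Num.sqrt n%:R).
  rewrite -{1}s2; clear - sn peak_gt0; move: (Num.sqrt n%:R) sn peak peak_gt0 => s s0 p p0.
  by field; rewrite !gt_eqF.
rewrite ler_pM2l ?mulr_gt0 ?invr_gt0//.
by rewrite ler_pdivlMr// mulrC.
Unshelve. all: by end_near. Qed.

End Assembly.

(** * Solutions of the mean-field equation *)

Section MeanField.
Variable R : realType.
Variables (d : nat) (beta h zs ts : R).
Hypothesis d1 : (1 <= d)%N.
Hypothesis beta_ge0 : 0 <= beta.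
Hypothesis zsP : max_mean_field d beta h zs.
Hypothesis tsE : ts = 2 * d%:R * beta * zs + `|h|.

Let b : R := coupling d beta.

Let dd0 : 0 < 2 * d%:R :> R.
Proof. by rewrite mulr_gt0// ltr0n. Qed.

Let b_ge0 : 0 <= b.
Proof. by rewrite mulr_ge0// ltW. Qed.

Let meanE z : mean_field d beta h z <-> tanh (b * z + `|h|) = z.
Proof. by rewrite /mean_field /beta_c invrK (mulrC beta). Qed.

Lemma tanh_ts : tanh ts = zs.
Proof. by rewrite tsE; case: zsP => _ /meanE. Qed.

Lemma ts_ge0 : 0 <= ts.
Proof. by case: zsP => z0 _ _; rewrite tsE addr_ge0// mulr_ge0. Qed.

Lemma cwg_ts : 0 < beta -> cwg b `|h| ts = 0.
Proof.
move=> beta0; rewrite /cwg tanh_ts {1}tsE addrK -/(coupling d beta) -/b.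
by rewrite (mulrC b) mulfK ?subrr// gt_eqF// /b coupling_gt0.
Qed.

Lemma coupling_lt1 : beta < beta_c d -> b < 1.
Proof. by move=> h1; rewrite -(ltr_pM2l dd0) mulfV ?gt_eqF// in h1. Qed.

Lemma coupling_gt1 : beta_c d < beta -> 1 < b.
Proof. by move=> h1; rewrite -(ltr_pM2l dd0) mulfV ?gt_eqF// in h1. Qed.

Lemma coupling_eq1 : beta = beta_c d -> b = 1.
Proof. by rewrite /b /coupling => ->; rewrite mulfV// gt_eqF. Qed.

(** A positive solution [zs] of [zs <= tanh zs] would contradict the strict concavity of
    [tanh] at [0], [zs / 2] and [zs]. *)
Lemma ts_subcritical : h = 0 -> b <= 1 -> ts = 0.
Proof.
move=> h0 b1; have [z0 /meanE + _] := zsP; rewrite tsE h0 normr0 !addr0 => zE.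
suff -> : zs = 0 by rewrite mulr0.
apply/eqP; rewrite eq_le z0 andbT leNgt; apply/negP => zs0.
have h2 : 0 < zs / 2 by rewrite divr_gt0.
have h21 : zs / 2 < zs by lra.
have := tanh_slope (lexx 0) h2 h21; rewrite tanh0 !subr0.
have -> : zs - zs / 2 = zs / 2 by field.
rewrite ltr_pM2r// => h3.
have h4 := tanh_le (ltW h2).
have : tanh (b * zs) <= tanh zs by apply: ler_tanh; rewrite ler_piMl.
by rewrite zE; lra.
Qed.

(** The slope [b] of [tanh (b * z)] at [0] exceeds [1], so a positive solution exists by
    the intermediate value theorem, and it is at most the maximal one. *)
Lemma ts_supercritical : h = 0 -> 1 < b -> 0 < ts.
Proof.
move=> h0 b1; have [z0 _ zmax] := zsP; have b0 : 0 < b by lra.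
rewrite tsE h0 normr0 addr0 -/(coupling d beta) -/b mulr_gt0//.
(* With this [e] the cubic error [(b * e) ^+ 3 / 3] is at most [(b - 1) * e / 3]. *)
pose e := (b - 1) / b ^+ 3.
have b3 : 0 < b ^+ 3 by rewrite exprn_gt0.
have e0 : 0 < e by rewrite divr_gt0// subr_gt0.
have e1 : e <= 1.
  rewrite ler_pdivrMr// mul1r; have : b <= b ^+ 3 by rewrite ler_eXnr// ltW.
  by lra.
have cg : continuous (fun z => tanh (b * z) - z).
  apply: (@der_cont _ _ (fun z => b * (1 - tanh (b * z) ^+ 2) - 1)) => z.
  apply: der_add; last by der.
  apply: (der_comp _ (der_tanh_id _)); apply: der_eq; first by der.
  by rewrite mul0r add0r mulr1.
have [c cI gc] : exists2 c, c \in `[e, 1]%R & tanh (b * c) - c = 0.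
  apply: IVT => //; first exact: continuous_subspaceT.
  have g1 : tanh (b * 1) - 1 <= 0.
    have := tanh2_lt1 (b * 1); rewrite subr_le0 => h1.
    by rewrite -(@ler_pXn2r _ 2)// ?nnegrE ?tanh_ge0 ?mulr1// expr1n -(mulr1 b) ltW.
  have ge : 0 <= tanh (b * e) - e.
    have be : 0 <= b * e by rewrite mulr_ge0// ltW.
    have := tanh_sub_le be.
    have -> : (b * e) ^+ 3 / 3 = (b - 1) * e * e / 3.
      by rewrite /e; field; rewrite gt_eqF.
    have : (b - 1) * e * e <= (b - 1) * e.
      by rewrite ler_piMr// mulr_ge0// ltW// subr_gt0.
    have : 0 < (b - 1) * e by rewrite mulr_gt0// subr_gt0.
    have -> : b * e = (b - 1) * e + e by ring.
    by move: ((b - 1) * e * e) ((b - 1) * e) => u v; lra.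
  by rewrite ge_min g1 orbT le_max ge.
move: cI; rewrite in_itv/= => /andP[ec _].
have /zmax : mean_field d beta h c.
  by apply/meanE; rewrite h0 normr0 addr0; apply/eqP; rewrite -subr_eq0 gc.
by apply: lt_le_trans; exact: lt_le_trans ec.
Qed.

Lemma ts_field : h != 0 -> 0 < ts.
Proof.
case: zsP => z0 _ _ hn; rewrite tsE ltr_wpDl ?normr_gt0// mulr_ge0//.
Qed.

Definition peak_rate := exists2 C : R, 0 <= C & forall n, (1 < n)%N ->
  `|Num.sqrt (pi * n./2%:R) * Q d beta h n - cosh ts| <= C / n%:R.

Lemma peak_rate_free : beta = 0 -> peak_rate.
Proof.
move=> b0; rewrite /peak_rate; have -> : cosh ts = cosh h.
  rewrite tsE b0 mulr0 mul0r add0r.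
  by case: (ger0P h) => _; rewrite ?coshN.
by rewrite b0; exact: Q_free_rate.
Qed.

Lemma peak_rate_subcritical : h = 0 -> b < 1 -> peak_rate.
Proof.
move=> h0 b1; move: beta_ge0; rewrite le_eqVlt => /predU1P[/esym|] beta0.
  exact: peak_rate_free.
apply: Q_mixture_rate => //; first exact: ts_ge0.
rewrite (ts_subcritical h0 (ltW b1)) h0 normr0; apply: concentrated_sub => //.
exact: coupling_gt0.
Qed.

Lemma peak_rate_supercritical : 0 < ts -> peak_rate.
Proof.
move=> ts0; move: beta_ge0; rewrite le_eqVlt => /predU1P[/esym|] beta0.
  exact: peak_rate_free.
apply: Q_mixture_rate => //; first exact: ts_ge0.
by apply: concentrated_super => //; [exact: coupling_gt0|exact: cwg_ts].
Qed.

Lemma peak_cvg : (fun n => Num.sqrt (pi * n./2%:R) * Q d beta h n) @ \oo --> cosh ts.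
Proof.
suff [[C _]|[h0 b1]] : peak_rate \/ (h = 0 /\ b = 1); first exact: rate_cvg.
  rewrite (ts_subcritical h0) ?b1// cosh0 h0.
  have cr := Q_critical d1 b1.
  have iC : (fun n : nat => (Num.sqrt n%:R)^-1 : R) @ \oo --> (0 : R).
    by rewrite -(cvg_shiftS (fun n => (Num.sqrt n%:R)^-1 : R)); exact: cvg_isqrt.
  rewrite [X in _ --> X](_ : _ = 0 * (crit_lim R 2 / crit_lim R 0 / 2) + 1); last first.
    by rewrite mul0r add0r.
  pose g n : R := (Num.sqrt n%:R)^-1 *
    (Num.sqrt n%:R * (Num.sqrt (pi * n./2%:R) * Q d beta 0 n - 1)) + 1.
  have cg : g @ \oo --> 0 * (crit_lim R 2 / crit_lim R 0 / 2) + 1.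
    by apply: cvgD; [exact: cvgM|exact: cvg_cst].
  apply: cvg_trans cg; apply: near_eq_cvg.
  near=> n; have n0 : (0 < n)%N by near: n; exact: nbhs_infty_gt.
  have sn : 0 < Num.sqrt n%:R :> R by rewrite sqrtr_gt0 ltr0n.
  by rewrite /g mulKf ?subrK// gt_eqF.
have [h0|hn] := eqVneq h 0; last by left; apply/peak_rate_supercritical/ts_field.
have [b1|b1|b1] := ltgtP b 1; last by right.
  by left; exact: peak_rate_subcritical.
by left; apply/peak_rate_supercritical/ts_supercritical.
Unshelve. all: by end_near. Qed.

End MeanField.

Theorem theorem1p5 (R : realType) (d : nat) (beta h zs ts : R)
    (hd : (1 <= d)%N) (hbeta : 0 <= beta)
    (hzs : max_mean_field d beta h zs)
    (hts : ts = 2 * d%:R * beta * zs + `|h|) :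
  [/\ (fun n : nat => Q d beta h n /
          (n%:R `^ (- (1 / 2)) * Num.sqrt (2 / pi) * cosh ts)) @ \oo --> (1 : R),
      h = 0 -> beta < beta_c d ->
        ts = 0 /\
        Q d beta h =
          (fun n : nat => Num.sqrt (2 / pi) * n%:R `^ (- (1 / 2)))
          +O_\oo (fun n : nat => n%:R `^ (- (3 / 2)) : R),
      h = 0 -> beta = beta_c d ->
        ts = 0 /\
        Q d beta h =
          (fun n : nat => Num.sqrt (2 / pi) * n%:R `^ (- (1 / 2))
             + 2 * 3 `^ (1 / 2) * pi `^ (1 / 2) / Gamma (1 / 4) ^+ 2
               * n%:R `^ (- 1))
          +o_\oo (fun n : nat => n%:R `^ (- 1) : R),
      h = 0 -> beta_c d < beta ->
        0 < ts /\
        Q d beta h =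
          (fun n : nat => Num.sqrt (2 / pi) * cosh ts * n%:R `^ (- (1 / 2)))
          +O_\oo (fun n : nat => n%:R `^ (- (3 / 2)) : R) &
      h != 0 ->
        0 < ts /\
        Q d beta h =
          (fun n : nat => Num.sqrt (2 / pi) * cosh ts * n%:R `^ (- (1 / 2)))
          +O_\oo (fun n : nat => n%:R `^ (- (3 / 2)) : R)].
Proof.
have super : 0 < ts -> Q d beta h =
    (fun n : nat => Num.sqrt (2 / pi) * cosh ts * n%:R `^ (- (1 / 2)))
    +O_\oo (fun n : nat => n%:R `^ (- (3 / 2)) : R).
  move=> ts0; have [C C0 hC] := peak_rate_supercritical hd hbeta hzs hts ts0.
  exact: (rate_bigO (ltW (cosh_gt0 ts)) C0 hC).
split.
- by apply: leading_ratio; [exact: cosh_gt0|exact: (peak_cvg hd hbeta hzs hts)].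
- move=> h0 /(coupling_lt1 hd) b1.
  have ts0 := ts_subcritical hzs hts h0 (ltW b1).
  have [C C0] := peak_rate_subcritical hd hbeta hzs hts h0 b1.
  rewrite ts0 cosh0 => hC; split => //.
  have := rate_bigO ler01 C0 hC.
  by under eq_fun do rewrite mulr1.
- move=> h0 /(coupling_eq1 hd) b1; split.
    by apply: (ts_subcritical hzs hts h0); rewrite b1.
  rewrite crit_const h0; apply: critical_littleo (Q_critical hd b1).
  have l0 := crit_lim0_gt0 R.
  rewrite !divr_ge0 ?(ltW l0)// crit_lim_quartic mulr_ge0 ?quartic_ge0// exprn_ge0// sqrtr_ge0//.
- move=> h0 /(coupling_gt1 hd) b1.
  by have ts0 := ts_supercritical hbeta hzs hts h0 b1; split => //; exact: super.
- by move=> hn; have ts0 := ts_field hbeta hzs hts hn; split => //; exact: super.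
Qed.
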